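(* Let $\theta\in[0,\tfrac12)$ with $\sigma(\theta)$ periodic under $\sigma$, put $\theta'=\theta+\tfrac12$, and suppose that the critical diameter $\ell_\theta=\overline{\theta\theta'}$ is of rotational depth $m$ for some $m$. Then there exist arcs $I,I'\subset\mathbb{T}$ such that $D=I\cup I'$ generates a traveling horseshoe $D_\infty$ and $\theta,\theta'\notin D_\infty\cup M(D)$. In particular, there exists a non-degenerate invariant lamination $\sim$ with $\theta\sim\theta'$.
   Context: $\mathbb{T}=\mathbb{R}/\mathbb{Z}$ is identified with the boundary of the closed unit disk $\mathbb{D}$; $\sigma(x)=2x\bmod1$; for $x\in\mathbb{T}$, $x'=x+\tfrac12$; $[x,y]$, $(x,y)$ are arcs running counterclockwise from $x$ to $y$. Laminations. Two closed sets $A,B\subset\mathbb{T}$ are unlinked if their convex hulls in $\mathbb{D}$ are disjoint. A lamination is a closed equivalence relation on $\mathbb{T}$ (closed graph) with nowhere dense classes such that distinct classes are unlinked. The degenerate lamination identifies all points. A lamination is invariant if $\sigma(C)$ is a class for every class $C$. General and traveling horseshoes. Let $I=[\alpha,\beta]$ and $I'=[\alpha',\beta']$ be two disjoint closed arcs not containing $0$ or $\tfrac12$ (where $\alpha'=\alpha+\tfrac12$, $\beta'=\beta+\tfrac12$), with either $\beta,\alpha'$ periodic of period $k$, or $\beta',\alpha$ periodic of period $k$. Then $\sigma^k$ maps each of the four endpoints of $I$, $I'$ to one of these endpoints. For each endpoint $e$ of $I$ or $I'$, let $J\in\{I,I'\}$ be the arc having $\sigma^k(e)$ as an endpoint and let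 $e^*$ be the other endpoint of $J$; let $H_e$ be the closed subarc from $e$ to the $\sigma^k$-preimage of $e^*$ closest to $e$ within the one of $I,I'$ that contains $e$. Let $H$ be the union of the four arcs $H_e$. The general horseshoe of period $k$ generated by $D=I\cup I'$ is $D_\infty=\{x:\sigma^{ki}(x)\in H\text{ for all }i\ge0\}$. The main holes are the two components $(\beta',\alpha)$ and $(\beta,\alpha')$ of $\mathbb{T}\setminus D$, and $M(D)$ is their union. $D_\infty$ is a traveling horseshoe if the convex hulls of $\sigma(H),\dots,\sigma^{k-1}(H)$ are disjoint from the convex hull of $H$, except possibly for their boundaries. Rotational orbit. A periodic orbit $E$ of $\sigma$ is rotational if $\sigma|_E$ is conjugate, by an orientation preserving homeomorphism of $\mathbb{T}$, to the restriction of a rigid rotation of $\mathbb{T}$ to the orbit of $0$. It is known (Bullett–Sentenac) that if $\theta\in[0,\tfrac12)$ is preperiodic then $[\theta,\theta']$ contains a unique rotational periodic orbit $A_\theta$. A critical diameter $\ell_\theta$ with $\theta\in[0,\frac12)$ and $\sigma(\theta)$ periodic is basic rotational if $\{\theta,\theta'\}\cap A_\theta\ne\emptyset$ (this includes $\theta=0$, where $A_0=\{0\}$). Canonic horseshoe and pruning. Let $\theta\in(0,\tfrac12)$ with $\sigma(\theta)$ periodic; then $A=A_\theta$ has period $k\ge2$ and $\mathbb{T}\setminus A$ has a unique component of length greater than $\tfrac12$; write it as $(\alpha',\beta)$ (counterclockwise, it contains $0$), and put $\alpha=\alpha'+\tfrac12$, $\beta'=\beta+\tfrac12$, $D=[\alpha,\beta]\cup[\alpha',\beta']$.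 The canonic traveling horseshoe, generated by this $D$, is $D_\infty(A_\theta)=\{x:\sigma^{ki}(x)\in D\ \forall i\ge0\}$, a Cantor set. The canonic pruning $\varphi:\mathbb{T}\to\mathbb{T}$ is the orientation preserving monotone map which collapses the closure of each component of $\mathbb{T}\setminus D_\infty(A_\theta)$ to a point, maps $D_\infty(A_\theta)$ onto $\mathbb{T}$, satisfies $\varphi\circ\sigma^k=\sigma\circ\varphi$ on $D_\infty(A_\theta)$, and has $\varphi(\beta)=\varphi(\alpha')=0$, $\varphi(\alpha)=\varphi(\beta')=\tfrac12$. The diameter $\ell_\theta$ is basic non-rotational if $\{\theta,\theta'\}\cap D_\infty(A_\theta)=\emptyset$. Renormalization and depth. If $\ell_\theta$ is neither basic rotational nor basic non-rotational, then $\{\theta,\theta'\}\subset D_\infty(A_\theta)\setminus A_\theta$, and the critical diameter with endpoints $\varphi(\theta)$ and $\varphi(\theta')=\varphi(\theta)+\tfrac12$, which again has periodic image $\sigma(\varphi(\theta))$ but of smaller period, is the rotational renormalization of $\ell_\theta$. Starting with $\ell_0=\ell_\theta$, let $\ell_{n+1}$ be the rotational renormalization of $\ell_n$ as long as $\ell_n$ is neither basic rotational nor basic non-rotational. The process terminates. If the last diameter obtained is basic non-rotational, $\ell_\theta$ is said to be of rotational depth $m$, where $m$ is determined by the number of steps (a basic non-rotational $\ell_\theta$ itself is the base case, $m=1$, and each renormalization step adds $1$). *)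

(* Defs.v *)
From HB Require Import structures.
From mathcomp Require Import all_boot all_order all_algebra generic_quotient.
From mathcomp Require Import all_classical all_reals all_analysis.

Set Implicit Arguments.
Unset Strict Implicit.
Unset Printing Implicit Defensive.

Import Order.TTheory GRing.Theory Num.Theory.
Import numFieldNormedType.Exports.

Local Open Scope classical_set_scope.
Local Open Scope ring_scope.
Local Open Scope quotient_scope.

(** * The circle [R/Z], the doubling map, arcs *)

Definition integers (R : realType) : zmodClosed R :=
  GRing.ZmodClosed.clone R (@Num.int_num_subdef R) _.

Definition circle (R : realType) : Type :=
  quotient_topology (Quotient.quot (integers R)).

HB.instance Definition _ (R : realType) := Topological.on (circle R).
HB.instance Definition _ (R : realType) :=
  Quotient.on (circle R).
HB.instance Definition _ (R : realType) :=
  GRing.Zmodule.copy (circle R) (Quotient.quot (integers R)).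

Section Circle.
Context {R : realType}.
Implicit Types (x y z e : circle R) (A B E K : set (circle R)) (k n : nat).

Definition to_circle (t : R) : circle R := \pi_(circle R) t.

(* The representative of [x] in [0, 1[. *)
Definition angle x : R := repr x - (Num.floor (repr x))%:~R.

Definition half : circle R := to_circle (2^-1).

(* [x'] in the usual notation. *)
Definition opposite x : circle R := x + half.

Definition doubling x : circle R := x *+ 2.

(* The length of the counterclockwise arc from [x] to [y]; it is [0] when
   [x = y], so that [closed_arc x x] is a point and [open_arc x x] is empty. *)
Definition ccw x y : R := angle (y - x).

Definition closed_arc x y : set (circle R) := [set z | ccw x z <= ccw x y].
Definition open_arc x y : set (circle R) := [set z | 0 < ccw x z < ccw x y].

Definition has_period k x : Prop :=
  [/\ (0 < k)%N, iter k doubling x = x &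
      forall j, (0 < j < k)%N -> iter j doubling x <> x].

Definition periodic_point x : Prop := exists k, has_period k x.

Definition forward_orbit (f : circle R -> circle R) x : set (circle R) :=
  range (fun n => iter n f x).

(** * Laminations *)

(* The identification of [R/Z] with the boundary of the unit disk, the plane
   being [R * R]. *)
Definition embed x : (R^o * R^o)%type :=
  (cos (2 * pi * angle x), sin (2 * pi * angle x)).

Definition convex_hull (S : set (R^o * R^o)%type) : set (R^o * R^o)%type :=
  \bigcap_(C in [set C : set (R^o * R^o)%type | convex_set C /\ S `<=` C]) C.

Definition hull A : set (R^o * R^o)%type := convex_hull (embed @` A).

Definition boundary (S : set (R^o * R^o)%type) : set (R^o * R^o)%type :=
  closure S `\` interior S.

Definition unlinked A B : Prop := hull A `&` hull B = set0.

Implicit Type r : circle R -> circle R -> Prop.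

Definition eq_class r x : set (circle R) := [set y | r x y].

Record lamination r : Prop := Lamination {
  lam_refl : forall x, r x x;
  lam_sym : forall x y, r x y -> r y x;
  lam_trans : forall x y z, r x y -> r y z -> r x z;
  lam_closed : closed [set p : (circle R * circle R)%type | r p.1 p.2];
  lam_nowhere_dense : forall x, interior (closure (eq_class r x)) = set0;
  lam_unlinked : forall x y, ~ r x y -> unlinked (eq_class r x) (eq_class r y)
}.

Definition degenerate r : Prop := forall x y, r x y.

Definition invariant_lamination r : Prop :=
  forall x, exists y, doubling @` eq_class r x = eq_class r y.

(** * General and traveling horseshoes *)

(* Throughout, [I = closed_arc a b] and [I'] is the arc between the points
   opposite to [a] and [b]. *)

Definition arc_pair (a b : circle R) : set (circle R) :=
  closed_arc a b `|` closed_arc (opposite a) (opposite b).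

Definition main_holes (a b : circle R) : set (circle R) :=
  open_arc (opposite b) a `|` open_arc b (opposite a).

Definition horseshoe_arcs k (a b : circle R) : Prop :=
  let I := closed_arc a b in
  let I' := closed_arc (opposite a) (opposite b) in
  [/\ I `&` I' = set0,
      ~ (I `|` I') 0,
      ~ (I `|` I') half &
      has_period k b /\ has_period k (opposite a) \/
      has_period k (opposite b) /\ has_period k a].

(* [e] and [e'] are the two endpoints of one of the two arcs. *)
Definition mates (a b e e' : circle R) : Prop :=
  [\/ (e, e') = (a, b), (e, e') = (b, a),
      (e, e') = (opposite a, opposite b) | (e, e') = (opposite b, opposite a)].

(* The arc [H_e] where [e = x] is the initial endpoint of [closed_arc x y],
   which is one of the two arcs; [z] is the preimage of the mate of the image
   of [e] which is closest to [e]. *)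
Definition initial_piece k (a b x y : circle R) : set (circle R) :=
  [set w | exists e' z,
    [/\ mates a b (iter k doubling x) e',
        closed_arc x y z /\ iter k doubling z = e',
        forall v, closed_arc x y v -> iter k doubling v = e' ->
          ccw x z <= ccw x v &
        closed_arc x z w]].

(* The same for the terminal endpoint [e = y] of [closed_arc x y]. *)
Definition terminal_piece k (a b x y : circle R) : set (circle R) :=
  [set w | exists e' z,
    [/\ mates a b (iter k doubling y) e',
        closed_arc x y z /\ iter k doubling z = e',
        forall v, closed_arc x y v -> iter k doubling v = e' ->
          ccw z y <= ccw v y &
        closed_arc z y w]].

Definition horseshoe_pieces k (a b : circle R) : set (circle R) :=
  let a' := opposite a in let b' := opposite b in
  initial_piece k a b a b `|` terminal_piece k a b a b `|`
  initial_piece k a b a' b' `|` terminal_piece k a b a' b'.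

Definition survivors k A : set (circle R) :=
  [set x | forall i, A (iter (k * i) doubling x)].

Definition horseshoe k (a b : circle R) : set (circle R) :=
  survivors k (horseshoe_pieces k a b).

Definition traveling k (a b : circle R) : Prop :=
  let H := horseshoe_pieces k a b in
  forall i, (0 < i < k)%N ->
    let Hi := iter i doubling @` H in
    hull Hi `&` hull H `<=` boundary (hull Hi) `&` boundary (hull H).

Definition generates_traveling_horseshoe k (a b : circle R) : Prop :=
  horseshoe_arcs k a b /\ traveling k a b.

(** * Rotational orbits *)

(* Orientation preserving monotone maps of degree one, through their lifts. *)
Definition monotone_map (f : circle R -> circle R) : Prop :=
  exists F : R -> R,
    [/\ continuous F, {homo F : s t / s <= t},
        forall t, F (t + 1) = F t + 1 &
        forall t, to_circle (F t) = f (to_circle t)].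

Definition orientation_preserving_homeo (h : circle R -> circle R) : Prop :=
  [/\ continuous h,
      exists g, [/\ continuous g, cancel h g & cancel g h] &
      monotone_map h].

Definition rotational E : Prop :=
  (exists2 x, periodic_point x & E = forward_orbit doubling x) /\
  exists (h : circle R -> circle R) (rho : circle R),
    [/\ orientation_preserving_homeo h,
        h @` E = forward_orbit (fun y => y + rho) 0 &
        forall x, E x -> h (doubling x) = h x + rho].

(* [A] is the rotational orbit [A_theta]. *)
Definition rotational_orbit (theta : circle R) A : Prop :=
  rotational A /\ A `<=` closed_arc theta (opposite theta).

(** * Critical diameters *)

(* The critical diameter with endpoints [theta] and [opposite theta]; any
   critical diameter has exactly one endpoint with angle in [0, 1/2[. *)
Definition diameter (theta : circle R) : set (circle R) :=
  [set theta; opposite theta].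

Definition periodic_diameter (theta : circle R) : Prop :=
  angle theta < 2^-1 /\ periodic_point (doubling theta).

Definition basic_rotational (theta : circle R) : Prop :=
  periodic_diameter theta /\
  exists A, rotational_orbit theta A /\ diameter theta `&` A !=set0.

(* [A] is the orbit [A_theta], [k] its period, and [(a', b)] the component of
   length greater than [1/2] of its complement. *)
Definition canonic_arcs (theta : circle R) A k (a b : circle R) : Prop :=
  [/\ periodic_diameter theta /\ 0 < angle theta,
      rotational_orbit theta A,
      forall x, A x -> has_period k x,
      exists2 x, ~ A x &
        connected_component (~` A) x = open_arc (opposite a) b &
      2^-1 < ccw (opposite a) b].

Definition canonic_horseshoe k (a b : circle R) : set (circle R) :=
  survivors k (arc_pair a b).

Definition canonic_pruning k (a b : circle R) (phi : circle R -> circle R) :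
    Prop :=
  let K := canonic_horseshoe k a b in
  [/\ monotone_map phi,
      forall x, ~ K x ->
        exists c, forall y, closure (connected_component (~` K) x) y ->
          phi y = c,
      phi @` K = setT,
      forall x, K x -> phi (iter k doubling x) = doubling (phi x) &
      [/\ phi b = 0, phi (opposite a) = 0,
          phi a = half & phi (opposite b) = half]].

Definition basic_non_rotational (theta : circle R) : Prop :=
  exists A k a b, canonic_arcs theta A k a b /\
    diameter theta `&` canonic_horseshoe k a b = set0.

Definition rotational_renormalization (theta theta1 : circle R) : Prop :=
  exists A k a b phi,
    [/\ canonic_arcs theta A k a b, canonic_pruning k a b phi,
        angle theta1 < 2^-1 &
        diameter theta1 = [set phi theta; phi (opposite theta)]].

Inductive rotational_depth : nat -> circle R -> Prop :=
| depth_base theta : basic_non_rotational theta -> rotational_depth 1 theta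
| depth_step m theta theta1 :
    periodic_diameter theta ->
    ~ basic_rotational theta -> ~ basic_non_rotational theta ->
    rotational_renormalization theta theta1 ->
    rotational_depth m theta1 -> rotational_depth m.+1 theta.

End Circle.

(* Main.v *)
(* The horseshoe is found by induction on the depth. In the base case the canonic
   horseshoe works: all gaps of the rotational orbit except the longest double
   in length, so the lengths are explicit and the first k - 1 images of D lie in
   the short arc spanned by the orbit. In the inductive step the arcs are pulled
   back by the pruning, which is invertible over the points whose orbit avoids
   0; the pulled back arcs still have their images in the closed main holes.

   For the lamination, let f be the operator sending a pseudometric d on the
   circle to (x, y) |-> d(2x, 2y) when x, y are on the same side of the diameter
   of theta, and to d(2x, 2 theta) + d(2 theta, 2y) otherwise. It preserves the
   1-periodic pseudometrics satisfying the four-point inequality of planar trees.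
   The horseshoe forces the iterates of f to grow exponentially, hence the
   normalized resolvents of f accumulate, at the critical parameter rho < 1, on a
   nonzero d with d = rho f(d). Such a d is continuous because the orbit of
   2 theta is finite, and the relation d(x, y) = 0 is the lamination. *)
Require Import Defs.
From mathcomp Require Import all_boot all_order all_algebra generic_quotient.
From mathcomp Require Import all_classical all_reals all_analysis.
From mathcomp Require Import ring lra zify.

Set Implicit Arguments.
Unset Strict Implicit.
Unset Printing Implicit Defensive.

Import Order.TTheory GRing.Theory Num.Theory.
Import numFieldNormedType.Exports.

Local Open Scope classical_set_scope.
Local Open Scope ring_scope.

(** * The circle *)

Section CircleBasics.
Context {R : realType}.
Implicit Types (s t u v : R) (x y z : circle R).

Local Open Scope quotient_scope.

(** The difficulty of the lamination is non-degeneracy: identifying the ends of the diameter and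
    taking preimages could collapse the whole circle. The equation [d = rho f(d)] says that doubling
    stretches a tree metric by [1 / rho] on each side of the diameter, so [rho < 1] is a form of
    positive entropy. It acts twice: [1 / (1 - rho)] bounds the normalized resolvents, and [rho]
    contracts distances at small scales. The growth behind [rho < 1] comes from gluing. The
    traveling condition gives the end pieces of the arcs a common itinerary with respect to the
    diameter, so certain pairs of their endpoints stay at distance zero. Such pairs act as cuts: the
    paths from [s] to theta and from theta to [t] each have to cross one, and each crossing contains
    a copy of an earlier distance from [s] to [t]. Horseshoes are handled through real lifts and
    weak inequalities modulo half-integers, because these survive the pull-back by a map that is
    only monotone. *)

Lemma to_circle_eqP s t :
  to_circle s = to_circle t <-> exists n : int, s = t + n%:~R.
Proof.
have E := Quotient.idealrBE (integers R) s t.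
split=> [st|[n nE]].
  have /intrP[n nE] : s - t \in Num.int.
    by have : s - t \in integers R by rewrite E; apply/eqP; exact: st.
  by exists n; rewrite -nE; ring.
have : s - t \in integers R.
  suff : s - t \in Num.int by [].
  by apply/intrP; exists n; rewrite nE; ring.
by rewrite E => /eqP.
Qed.

Lemma to_circle_surj x : exists t, x = to_circle t.
Proof. by exists (repr x); rewrite /to_circle reprK. Qed.

Lemma to_circleB s t : to_circle (s - t) = to_circle s - to_circle t.
Proof. exact: (raddfB (\pi_(Quotient.quot (integers R)))). Qed.

Lemma to_circle0 : to_circle 0 = 0 :> circle R.
Proof. by rewrite -(subrr (0 : R)) to_circleB subrr. Qed.

Lemma to_circleD s t : to_circle (s + t) = to_circle s + to_circle t.
Proof.
have -> : s + t = s - (0 - t) by ring.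
by rewrite !to_circleB to_circle0 sub0r opprK.
Qed.

Lemma to_circleDint s (n : int) : to_circle (s + n%:~R) = to_circle s.
Proof. by apply/to_circle_eqP; exists n. Qed.

Lemma opposite_to_circle s : opposite (to_circle s) = to_circle (s + 2^-1).
Proof. by rewrite to_circleD. Qed.

Lemma doubling_to_circle s : doubling (to_circle s) = to_circle (2 * s).
Proof. by rewrite /doubling mulr2n -to_circleD; congr to_circle; ring. Qed.

Lemma iter_doubling n s :
  iter n doubling (to_circle s) = to_circle (2 ^+ n * s).
Proof.
elim: n => [|n IH] /=; first by rewrite mul1r.
by rewrite IH doubling_to_circle exprS mulrA.
Qed.

Lemma angle_to_circle t :
  exists2 n : int, angle (to_circle t) = t + n%:~R &
    0 <= angle (to_circle t) < 1.
Proof.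
have [n nE] : exists n : int, repr (to_circle t) = t + n%:~R.
  by apply/to_circle_eqP; rewrite /to_circle reprK.
exists (n - Num.floor (repr (to_circle t))).
  by rewrite /angle intrB {1}nE; ring.
rewrite /angle.
have := floor_itv (repr (to_circle t)) => /andP[]; rewrite intrD1.
by lra.
Qed.

Lemma angleK x : to_circle (angle x) = x.
Proof.
have [t ->] := to_circle_surj x; have [n -> _] := angle_to_circle t.
by rewrite to_circleDint.
Qed.

Lemma angle_bounds x : 0 <= angle x < 1.
Proof. by have [t ->] := to_circle_surj x; have [] := angle_to_circle t. Qed.

Lemma int_lt1 (n : int) : -1 < n%:~R :> R -> n%:~R < 1 :> R -> n = 0.
Proof.
move=> h1 h2; have : (-1 < n)%R by rewrite -(ltr_int R).
by have : (n < 1)%R; [rewrite -(ltr_int R) | lia].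
Qed.

Lemma angle_eq t u (n : int) :
  0 <= u < 1 -> t = u + n%:~R -> angle (to_circle t) = u.
Proof.
move=> u01 ->; rewrite to_circleDint.
have [m mE] := angle_to_circle u; rewrite mE => h.
by rewrite (@int_lt1 m) ?addr0//; lra.
Qed.

Lemma ccw_eq s t u (n : int) :
  0 <= u < 1 -> t = s + u + n%:~R -> ccw (to_circle s) (to_circle t) = u.
Proof.
move=> u01 ->; rewrite /ccw -to_circleB; apply: (@angle_eq _ _ n) => //; ring.
Qed.

Lemma ccw_bounds x y : 0 <= ccw x y < 1.
Proof. exact: angle_bounds. Qed.

Lemma ccwE s x : x = to_circle (s + ccw (to_circle s) x).
Proof. by rewrite to_circleD /ccw angleK addrC subrK. Qed.

Lemma closed_arcP s t x : s <= t < s + 1 ->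
  closed_arc (to_circle s) (to_circle t) x <->
  exists2 u, x = to_circle u & s <= u <= t.
Proof.
move=> st; rewrite /closed_arc /= (@ccw_eq s t (t - s) 0); [|lra|by rewrite addr0; ring].
split=> [h|[u -> h]].
  have xE := ccwE s x; have b := ccw_bounds (to_circle s) x.
  exists (s + ccw (to_circle s) x) => //.
  lra.
by rewrite (@ccw_eq s u (u - s) 0); [lra|lra|rewrite addr0; ring].
Qed.

Lemma open_arcP s t x : s <= t < s + 1 ->
  open_arc (to_circle s) (to_circle t) x <->
  exists2 u, x = to_circle u & s < u < t.
Proof.
move=> st; rewrite /open_arc /= (@ccw_eq s t (t - s) 0); [|lra|by rewrite addr0; ring].
split=> [h|[u -> h]].
  have xE := ccwE s x; have b := ccw_bounds (to_circle s) x.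
  exists (s + ccw (to_circle s) x) => //.
  lra.
by rewrite (@ccw_eq s u (u - s) 0); [lra|lra|rewrite addr0; ring].
Qed.

Lemma to_circle_continuous : continuous (to_circle : R -> circle R).
Proof. exact: (@pi_continuous R (Quotient.quot (integers R))). Qed.

(** Definitionally the quotient topology, whence the empty proof. *)
Lemma open_preimage_to_circle (U : set (circle R)) :
  open (to_circle @^-1` U) -> open U.
Proof. by []. Qed.

Lemma nbhs_to_circle t (e : R) : 0 < e ->
  nbhs (to_circle t) [set x | exists2 u, x = to_circle u & `|u - t| < e].
Proof.
move=> e0; rewrite nbhsE /=.
exists [set x | exists2 u, x = to_circle u & `|u - t| < e] => //.
split; last by exists t => //; rewrite subrr normr0.
apply: open_preimage_to_circle; rewrite openE => v /= [u /to_circle_eqP[n ->] h].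
apply/nbhs_ballP; exists (e - `|u - t|) => /=; first by rewrite subr_gt0.
move=> w; rewrite /ball /= => hw; exists (w - n%:~R).
  by rewrite -[w in LHS](subrK n%:~R) to_circleDint.
have -> : w - n%:~R - t = (w - (u + n%:~R)) + (u - t) by ring.
apply: (le_lt_trans (ler_normD _ _)).
by rewrite -ltrBrDr distrC.
Qed.

End CircleBasics.

(** * Convex hulls of arcs *)

Section Hulls.
Context {R : realType}.
Implicit Types (m p q u : R) (A B : set (circle R)).

Lemma cosDint (x : R) (n : int) : cos (x + 2 * pi * n%:~R) = cos x.
Proof.
have nat_case (y : R) (k : nat) : cos (y + 2 * pi * k%:R) = cos y.
  rewrite -[RHS](periodicn (@cosD2pi R) k); congr cos.
  by rewrite -[in RHS]mulr_natr -[pi *+ 2]mulr_natr; ring.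
case: n => k; first exact: nat_case.
rewrite -[LHS](nat_case _ k.+1); congr cos.
by rewrite NegzE mulrNz -pmulrn; ring.
Qed.

(** The linear functional whose gradient is the unit vector at angle [m]. The chord from [p] to [q]
    is its level line for [m = (p + q) / 2], at the level [cos (2 * pi * ((q - p) / 2))], so
    comparing heights separates hulls by that chord. *)
Definition height m (v : (R^o * R^o)%type) : R :=
  v.1 * cos (2 * pi * m) + v.2 * sin (2 * pi * m).

Lemma height_embed m u :
  height m (embed (to_circle u)) = cos (2 * pi * (u - m)).
Proof.
rewrite /height /embed /=; have [n -> _] := angle_to_circle u.
rewrite -cosB -[RHS](cosDint _ n); congr cos; ring.
Qed.

Lemma cos_turn_mono p q : 0 <= p <= 2^-1 -> 0 <= q <= 2^-1 ->
  (cos (2 * pi * p) < cos (2 * pi * q)) = (q < p).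
Proof.
move=> p01 q01; have pi0 := @pi_gt0 R.
have itv r : 0 <= r <= 2^-1 -> 2 * pi * r \in `[0, pi : R].
  move=> r01; rewrite in_itv /=; apply/andP; split.
    by apply: mulr_ge0; lra.
  have -> : 2 * pi * r = pi * (2 * r) by ring.
  by rewrite ler_piMr; lra.
by rewrite ltr_cos ?itv// ltr_pM2l//; lra.
Qed.

Lemma cos_turn_le p q : 0 <= p <= 2^-1 -> p <= q <= 1 - p ->
  cos (2 * pi * q) <= cos (2 * pi * p).
Proof.
move=> p01 q01; have [qh|qh] := leP q 2^-1.
  by rewrite leNgt cos_turn_mono; lra.
have -> : cos (2 * pi * q) = cos (2 * pi * (1 - q)).
  rewrite -[RHS]cosN -[RHS](cosDint _ 1); congr cos; ring.
by rewrite leNgt cos_turn_mono; lra.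
Qed.

Lemma cos_turn_lt p q : 0 <= p <= 2^-1 -> p < q < 1 - p ->
  cos (2 * pi * q) < cos (2 * pi * p).
Proof.
move=> p01 q01; have [qh|qh] := leP q 2^-1; first by rewrite cos_turn_mono; lra.
have -> : cos (2 * pi * q) = cos (2 * pi * (1 - q)).
  rewrite -[RHS]cosN -[RHS](cosDint _ 1); congr cos; ring.
by rewrite cos_turn_mono; lra.
Qed.

Lemma height_conv m (v w : convex_lmodType (R^o * R^o)%type) (l : {i01 R}) :
  height m (conv l v w) = l%:num * height m v + (1 - l%:num) * height m w.
Proof.
rewrite /height.
have -> : (conv l v w).1 = l%:num * v.1 + (1 - l%:num) * w.1 by [].
have -> : (conv l v w).2 = l%:num * v.2 + (1 - l%:num) * w.2 by [].
ring.
Qed.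

Lemma convex_height_ge m (c : R) :
  convex_set [set v : (R^o * R^o)%type | c <= height m v].
Proof.
move=> v w l; rewrite !inE /= => hv hw.
rewrite height_conv.
have l0 : 0 <= l%:num by [].
have l1 : l%:num <= 1 by [].
have : l%:num * c <= l%:num * height m v by apply: ler_wpM2l.
have : (1 - l%:num) * c <= (1 - l%:num) * height m w.
  by apply: ler_wpM2l => //; lra.
lra.
Qed.

Lemma convex_height_le m (c : R) :
  convex_set [set v : (R^o * R^o)%type | height m v <= c].
Proof.
move=> v w l; rewrite !inE /= => hv hw.
rewrite height_conv.
have l0 : 0 <= l%:num by [].
have l1 : l%:num <= 1 by [].
have : l%:num * height m v <= l%:num * c by apply: ler_wpM2l.
have : (1 - l%:num) * height m w <= (1 - l%:num) * c.
  by apply: ler_wpM2l => //; lra.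
lra.
Qed.

Lemma convex_height_lt m (c : R) :
  convex_set [set v : (R^o * R^o)%type | height m v < c].
Proof.
move=> v w l; rewrite !inE /= => hv hw.
rewrite height_conv.
have l0 : 0 <= l%:num by [].
have l1 : l%:num <= 1 by [].
have : l%:num * (height m v) <= l%:num * (Num.max (height m v) (height m w)).
  by apply: ler_wpM2l => //; rewrite le_max lexx.
have : (1 - l%:num) * height m w <= (1 - l%:num) * (Num.max (height m v) (height m w)).
  by apply: ler_wpM2l => //; rewrite ?le_max ?lexx ?orbT//; lra.
have : Num.max (height m v) (height m w) < c by rewrite gt_max hv hw.
lra.
Qed.

Lemma hull_sub A (C : set (R^o * R^o)%type) :
  convex_set C -> (forall x, A x -> C (embed x)) -> hull A `<=` C.
Proof. by move=> cC sub v; apply; split => // _ [x Ax <-]; exact: sub. Qed.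

Lemma hull_height_ge A p q : p <= q < p + 1 ->
  (forall x, A x -> exists2 u, x = to_circle u & p <= u <= q) ->
  hull A `<=` [set v | cos (2 * pi * ((q - p) / 2)) <= height ((p + q) / 2) v].
Proof.
move=> pq Apq; apply: hull_sub; first exact: convex_height_ge.
move=> _ /Apq[u -> pu] /=; rewrite height_embed.
have [um|um] := leP ((p + q) / 2) u.
  by rewrite leNgt cos_turn_mono; lra.
have -> : cos (2 * pi * (u - (p + q) / 2)) = cos (2 * pi * ((p + q) / 2 - u)).
  by rewrite -cosN; congr cos; ring.
by rewrite leNgt cos_turn_mono; lra.
Qed.

Lemma hull_height_le A p q : p <= q < p + 1 ->
  (forall x, A x -> exists2 u, x = to_circle u & q <= u <= p + 1) ->
  hull A `<=` [set v | height ((p + q) / 2) v <= cos (2 * pi * ((q - p) / 2))].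
Proof.
move=> pq Apq; apply: hull_sub; first exact: convex_height_le.
move=> _ /Apq[u -> pu] /=; rewrite height_embed; apply: cos_turn_le; lra.
Qed.

Lemma hull_height_lt A p q : p <= q < p + 1 ->
  (forall x, A x -> exists2 u, x = to_circle u & q < u < p + 1) ->
  hull A `<=` [set v | height ((p + q) / 2) v < cos (2 * pi * ((q - p) / 2))].
Proof.
move=> pq Apq; apply: hull_sub; first exact: convex_height_lt.
move=> _ /Apq[u -> pu] /=; rewrite height_embed; apply: cos_turn_lt; lra.
Qed.

Lemma unlinked_arcs A B p q : p <= q < p + 1 ->
  (forall x, A x -> exists2 u, x = to_circle u & p <= u <= q) ->
  (forall x, B x -> exists2 u, x = to_circle u & q < u < p + 1) ->
  unlinked A B.
Proof.
move=> pq Apq Bqp; apply/seteqP; split => // v [/(hull_height_ge pq Apq) /= hA].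
by move=> /(hull_height_lt pq Bqp) /=; rewrite ltNge hA.
Qed.

Lemma height_shift m (a b e : R) :
  height m (a + e * cos (2 * pi * m), b + e * sin (2 * pi * m)) =
  height m (a, b) + e.
Proof.
rewrite /height /=; set c := cos _; set d := sin _.
have cd : c ^+ 2 + d ^+ 2 = 1 by exact: cos2Dsin2.
transitivity (a * c + b * d + e * (c ^+ 2 + d ^+ 2)); first by ring.
by rewrite cd mulr1.
Qed.

(** Used with the unit normal of a chord: by [height_shift] the two displaced points lie strictly on
    either side of the level line through [v]. *)
Lemma interior_shift (S : set (R^o * R^o)%type) v (x y : R) : interior S v ->
  exists2 e, 0 < e & S (v.1 + e * x, v.2 + e * y) /\
                     S (v.1 - e * x, v.2 - e * y).
Proof.
rewrite /interior /= => /nbhs_ballP[e /= e0 sub].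
pose M := `|x| + `|y| + 1.
have M1 : 1 <= M by rewrite /M -addrA ler_wpDl// lerDr.
have M0 : 0 < M by lra.
have e'0 : 0 < e / (2 * M) by rewrite divr_gt0// mulr_gt0.
have small z : `|z| <= M -> `|e / (2 * M) * z| < e.
  move=> zM; rewrite normrM gtr0_norm//.
  have -> : e / (2 * M) * `|z| = e * (`|z| / (2 * M)) by ring.
  by rewrite gtr_pMr// ltr_pdivrMr ?mul1r; [lra|rewrite mulr_gt0].
have xM : `|x| <= M by rewrite /M -addrA lerDl; apply: addr_ge0.
have yM : `|y| <= M by rewrite /M addrAC lerDr; apply: addr_ge0.
exists (e / (2 * M)) => //; split; apply: sub; split; rewrite /ball /=.
- by rewrite opprD addNKr normrN small.
- by rewrite opprD addNKr normrN small.
- by rewrite opprB addrC subrK small.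
- by rewrite opprB addrC subrK small.
Qed.

(** The chord from [p] to [q] has the two hulls in its opposite closed half-planes, so a common
    point lies on the chord. An interior point of one hull could be pushed across it. *)
Lemma hulls_meet_boundary A B p q : p <= q < p + 1 ->
  (forall x, A x -> exists2 u, x = to_circle u & p <= u <= q) ->
  (forall x, B x -> exists2 u, x = to_circle u & q <= u <= p + 1) ->
  hull A `&` hull B `<=` boundary (hull A) `&` boundary (hull B).
Proof.
move=> pq Apq Bqp v [vA vB].
have hA := hull_height_ge pq Apq; have hB := hull_height_le pq Bqp.
have /= vA' := hA _ vA; have /= vB' := hB _ vB.
have vE : v = (v.1, v.2) by case: (v).
split; split; try exact: subset_closure.
- move=> /(@interior_shift _ _ (cos (2 * pi * ((p + q) / 2)))
    (sin (2 * pi * ((p + q) / 2))))[e e0 [_]] /hA /=.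
  rewrite -!mulNr height_shift -vE => h; lra.
- move=> /(@interior_shift _ _ (cos (2 * pi * ((p + q) / 2)))
    (sin (2 * pi * ((p + q) / 2))))[e e0 [/hB /= + _]].
  rewrite height_shift -vE => h; lra.
Qed.

End Hulls.

(** * Horseshoes in real coordinates *)

Section HorseshoeData.
Context {R : realType}.
Implicit Types (s t u v : R) (x y z : circle R) (k : nat) (j n m : int).

Lemma int_between n m : n%:~R - 1 < m%:~R :> R -> m%:~R < n%:~R + 1 :> R -> m = n.
Proof.
move=> h1 h2; have : m - n = 0; last by lia.
by apply: (@int_lt1 R); rewrite intrB; lra.
Qed.

(** Contradictions on the circle are brought to this form: two lifts of one point differ by an
    integer, and the bounds squeeze a half-integer strictly between two consecutive ones. *)
Lemma no_half_int j n :
  j%:~R / 2 < n%:~R / 2 :> R -> n%:~R / 2 < j%:~R / 2 + 2^-1 :> R -> False.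
Proof.
move=> h1 h2; have h : (j < n)%R by rewrite -(ltr_int R); lra.
have : (n < j + 1)%R by rewrite -(ltr_int R) intrD; lra.
lia.
Qed.

Lemma int_parity n :
  exists m, n%:~R = 2 * m%:~R :> R \/ n%:~R = 2 * m%:~R + 1 :> R.
Proof.
have [m [->|->]] : exists m : int, n = 2 * m \/ n = 2 * m + 1.
- by exists (n %/ 2)%Z; have := divz_eq n 2; lia.
- by exists m; left; rewrite intrM.
- by exists m; right; rewrite intrD intrM.
Qed.

Lemma exp2_half k : (0 < k)%N -> exists n, 2 ^+ k / 2 = n%:~R :> R.
Proof.
case: k => // k _; exists (2 ^+ k); rewrite exprSr mulfK ?pnatr_eq0//.
by rewrite rmorphXn.
Qed.

Lemma exp2_int k m : exists n, 2 ^+ k * m%:~R = n%:~R :> R.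
Proof. by exists (2 ^+ k * m); rewrite intrM rmorphXn. Qed.

Lemma exp2_half_int k m : (0 < k)%N -> exists n, 2 ^+ k * (m%:~R / 2) = n%:~R :> R.
Proof.
move=> /exp2_half[n nE]; exists (n * m); rewrite intrM -nE; ring.
Qed.

Lemma exp2_gt0 k : 0 < 2 ^+ k :> R. Proof. exact: exprn_gt0. Qed.

Lemma exp2_ge2 k : (0 < k)%N -> 2 <= 2 ^+ k :> R.
Proof.
case: k => // k _; rewrite exprS ler_peMr//.
by apply: exprn_ege1; rewrite ler1n.
Qed.

Lemma has_periodE k s : has_period k (to_circle s) ->
  exists n, 2 ^+ k * s = s + n%:~R.
Proof. by case=> _ + _; rewrite iter_doubling => /to_circle_eqP. Qed.

(* Lifts [s < t] of the endpoints of [I], chosen inside the cell [j/2, (j+1)/2]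
   so that [I] and [I'] avoid [0] and [1/2], with [b] and [a'] periodic; the
   other alternative of [horseshoe_arcs] is reached by exchanging [I] and [I'].
   [hd_travel]: both end pieces of [I] are sent by the [i]-th iterate into the
   closure of the same main hole, the parity of [n] telling which one. *)
Record horseshoe_data k j s t : Prop := HorseshoeData {
  hd_lt : s < t;
  hd_lo : j%:~R / 2 < s;
  hd_hi : t < j%:~R / 2 + 2^-1;
  hd_per_t : has_period k (to_circle t);
  hd_per_s : has_period k (to_circle (s + 2^-1));
  hd_travel : forall i, (0 < i < k)%N -> exists n m : int,
    [/\ t + n%:~R / 2 <= 2 ^+ i * s,
        2 ^+ i * (s + (t - s) / 2 ^+ k) <= s + n%:~R / 2 + 2^-1,
        t + n%:~R / 2 + m%:~R <= 2 ^+ i * (t - (t - s) / 2 ^+ k) &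
        2 ^+ i * t <= s + n%:~R / 2 + 2^-1 + m%:~R] }.

(* Orientation is preserved, so that [H_e] is the subarc of length
   [(t - s) / 2 ^ k] ending at [e]; the term [n / 2] covers both [I] and [I']. *)
Definition end_pieces k s t : set (circle R) :=
  [set x | exists u n, x = to_circle (u + n%:~R / 2) /\
     (s <= u <= s + (t - s) / 2 ^+ k \/ t - (t - s) / 2 ^+ k <= u <= t)].

Definition hole_points s t : set (circle R) :=
  [set x | exists u n, x = to_circle (u + n%:~R / 2) /\ t < u < s + 2^-1].

Section Data.
Context k j s t (hd : horseshoe_data k j s t).
Let mu := (t - s) / 2 ^+ k.

Lemma hd_k : (0 < k)%N. Proof. by case: (hd_per_t hd). Qed.

Lemma hd_width : 0 < t - s < 2^-1.
Proof. by have := hd_lt hd; have := hd_lo hd; have := hd_hi hd; lra. Qed.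

Lemma hd_mu : 0 < mu /\ 2 * mu <= t - s.
Proof.
have k2 := exp2_ge2 hd_k; have w := hd_width.
split; first by rewrite divr_gt0 ?exp2_gt0//; lra.
rewrite /mu mulrA ler_pdivrMr ?exp2_gt0// mulrC.
by apply: ler_wpM2l => //; lra.
Qed.

Lemma exp2_mu : 2 ^+ k * mu = t - s.
Proof. by rewrite /mu mulrC divfK// gt_eqF// exp2_gt0. Qed.

Lemma hd_exp_t : exists n, 2 ^+ k * t = t + n%:~R.
Proof. exact: has_periodE (hd_per_t hd). Qed.

Lemma hd_exp_s : exists n, 2 ^+ k * s = s + 2^-1 + n%:~R.
Proof.
have [n nE] := has_periodE (hd_per_s hd); have [m mE] := exp2_half hd_k.
exists (n - m); rewrite intrB -mE; lra.
Qed.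

Let a := to_circle s.
Let b := to_circle t.

Lemma data_arcs : horseshoe_arcs k a b.
Proof.
have st := hd_lt hd; have lo := hd_lo hd; have hi := hd_hi hd.
have arc x : closed_arc a b x <-> exists2 u, x = to_circle u & s <= u <= t.
  by apply: closed_arcP; lra.
have arc' x : closed_arc (opposite a) (opposite b) x <->
    exists2 u, x = to_circle u & s + 2^-1 <= u <= t + 2^-1.
  by rewrite !opposite_to_circle; apply: closed_arcP; lra.
split.
- apply/seteqP; split => // _ [/arc[u -> hu] /arc'[v /to_circle_eqP[n uE] hv]].
  apply: (@no_half_int (-1) n); rewrite ?intrN; lra.
- case=> [/arc|/arc'] [u]; rewrite -to_circle0 => /to_circle_eqP[n nE] hu.
    by apply: (@no_half_int j (- (2 * n))); rewrite ?intrN ?intrM; lra.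
  by apply: (@no_half_int (j + 1) (- (2 * n))); rewrite ?intrN ?intrM ?intrD; lra.
- case=> [/arc|/arc'] [u] => /to_circle_eqP[n nE] hu.
    by apply: (@no_half_int j (1 - 2 * n)); rewrite ?intrB ?intrM; lra.
  by apply: (@no_half_int (j + 1) (1 - 2 * n)); rewrite ?intrB ?intrM ?intrD; lra.
- by left; rewrite opposite_to_circle; split; [exact: hd_per_t hd|exact: hd_per_s hd].
Qed.

Lemma mates_opposite_a e : mates a b (opposite a) e -> e = opposite b.
Proof.
have w := hd_width; rewrite /mates /a /b !opposite_to_circle.
case=> E; have /to_circle_eqP[n nE] := congr1 fst E;
  have /= -> := congr1 snd E => //; exfalso; rewrite /= in nE.
- by apply: (@no_half_int 0 n); lra.
- by apply: (@no_half_int 0 (2 * n)); rewrite ?intrM; lra.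
- by apply: (@no_half_int (-1) (2 * n)); rewrite ?intrM ?intrN; lra.
Qed.

Lemma mates_b e : mates a b b e -> e = a.
Proof.
have w := hd_width; rewrite /mates /a /b !opposite_to_circle.
case=> E; have /to_circle_eqP[n nE] := congr1 fst E;
  have /= -> := congr1 snd E => //; exfalso; rewrite /= in nE.
- by apply: (@no_half_int 0 (2 * n)); rewrite ?intrM; lra.
- by apply: (@no_half_int (-1) (2 * n)); rewrite ?intrM ?intrN; lra.
- by apply: (@no_half_int (-1) n); rewrite ?intrN; lra.
Qed.

(** The point [s + n / 2 + mu] is one preimage of the mate, so the closest preimage is at distance
    at most [mu]. Inclusion is the useful direction: separation by a chord and escape both pass to
    subsets. *)
Lemma initial_piece_sub n :
  initial_piece k a b (to_circle (s + n%:~R / 2)) (to_circle (t + n%:~R / 2))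
    `<=` end_pieces k s t.
Proof.
have w := hd_width; have [mu0 mu2] := hd_mu; have [p pE] := hd_exp_s.
have [q qE] := exp2_half_int n hd_k.
move=> x [e [z [ea [_ ze] zmin xz]]].
have eE : e = opposite b.
  apply: mates_opposite_a; rewrite opposite_to_circle; move: ea.
  rewrite iter_doubling mulrDr pE qE -addrA -intrD to_circleDint.
  exact.
have zmu : ccw (to_circle (s + n%:~R / 2)) z <= mu.
  rewrite -(@ccw_eq _ (s + n%:~R / 2) (s + n%:~R / 2 + mu) mu 0) ?addr0//; last by lra.
  apply: zmin.
    by apply/closed_arcP; [lra|exists (s + n%:~R / 2 + mu) => //; lra].
  rewrite eE iter_doubling !mulrDr pE qE exp2_mu opposite_to_circle.
  by apply/to_circle_eqP; exists (p + q); rewrite intrD; ring.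
move: xz; rewrite /closed_arc /= => xz.
have xE := ccwE (s + n%:~R / 2) x.
have xb := ccw_bounds (to_circle (s + n%:~R / 2)) x.
exists (s + ccw (to_circle (s + n%:~R / 2)) x), n; split.
  by rewrite {1}xE; congr to_circle; ring.
left; rewrite -/mu; lra.
Qed.

Lemma terminal_piece_sub n :
  terminal_piece k a b (to_circle (s + n%:~R / 2)) (to_circle (t + n%:~R / 2))
    `<=` end_pieces k s t.
Proof.
have w := hd_width; have [mu0 mu2] := hd_mu; have [p pE] := hd_exp_t.
have [q qE] := exp2_half_int n hd_k.
move=> x [e [z [ea [_ ze] zmin xz]]].
have eE : e = a.
  apply: mates_b; move: ea.
  rewrite iter_doubling mulrDr pE qE -addrA -intrD to_circleDint.
  exact.
have zmu : ccw z (to_circle (t + n%:~R / 2)) <= mu.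
  rewrite -(@ccw_eq _ (t + n%:~R / 2 - mu) (t + n%:~R / 2) mu 0) ?addr0 ?subrK//; last by lra.
  apply: zmin.
    by apply/closed_arcP; [lra|exists (t + n%:~R / 2 - mu) => //; lra].
  rewrite eE iter_doubling mulrBr !mulrDr pE qE exp2_mu.
  by apply/to_circle_eqP; exists (p + q); rewrite intrD; ring.
move: xz; rewrite /closed_arc /= => xz.
have zE : z = to_circle (t + n%:~R / 2 - ccw z (to_circle (t + n%:~R / 2))).
  by rewrite to_circleB /ccw angleK opprB addrC subrK.
have xE : x = to_circle (t + n%:~R / 2 - ccw z (to_circle (t + n%:~R / 2))
                         + ccw z x).
  by rewrite [in X in _ + X]zE; exact: ccwE.
have xb := ccw_bounds z x.
exists (t - ccw z (to_circle (t + n%:~R / 2)) + ccw z x), n; split.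
  by rewrite {1}xE; congr to_circle; ring.
right; rewrite -/mu; lra.
Qed.

Lemma horseshoe_pieces_sub : horseshoe_pieces k a b `<=` end_pieces k s t.
Proof.
have a0 : a = to_circle (s + 0%:~R / 2) by rewrite mul0r addr0.
have b0 : b = to_circle (t + 0%:~R / 2) by rewrite mul0r addr0.
have a1 : opposite a = to_circle (s + 1%:~R / 2) by rewrite opposite_to_circle div1r.
have b1 : opposite b = to_circle (t + 1%:~R / 2) by rewrite opposite_to_circle div1r.
rewrite /horseshoe_pieces /= => x [[[]|]|].
- by rewrite [X in initial_piece _ _ _ X]a0 [X in initial_piece _ _ _ _ X]b0
    => /initial_piece_sub.
- by rewrite [X in terminal_piece _ _ _ X]a0 [X in terminal_piece _ _ _ _ X]b0
    => /terminal_piece_sub.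
- by rewrite a1 b1 => /initial_piece_sub.
- by rewrite a1 b1 => /terminal_piece_sub.
Qed.

Lemma data_traveling : traveling k a b.
Proof.
move=> i ik; have [n [m [h1 h2 h3 h4]]] := hd_travel hd ik.
have w := hd_width; have [mu0 mu2] := hd_mu.
have i0 : (0 < i)%N by case/andP: ik.
have ipos := exp2_gt0 i.
apply: (@hulls_meet_boundary _ _ _ (t + n%:~R / 2) (s + n%:~R / 2 + 2^-1)).
- lra.
- move=> _ [x /horseshoe_pieces_sub[u [p [-> hu]]] <-].
  have [q qE] := exp2_half_int p i0.
  rewrite iter_doubling mulrDr qE to_circleDint.
  case: hu => /andP[hu1 hu2].
    exists (2 ^+ i * u) => //; apply/andP; split.
      by apply: le_trans h1 _; rewrite ler_pM2l.
    by apply: le_trans _ h2; rewrite ler_pM2l.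
  exists (2 ^+ i * u - m%:~R).
    by rewrite -[2 ^+ i * u in LHS](subrK m%:~R) to_circleDint.
  have : 2 ^+ i * (t - (t - s) / 2 ^+ k) <= 2 ^+ i * u by rewrite ler_pM2l.
  have : 2 ^+ i * u <= 2 ^+ i * t by rewrite ler_pM2l.
  lra.
- move=> _ /horseshoe_pieces_sub[u [p [-> hu]]].
  have hu' : s <= u <= t by rewrite -/mu in hu; case: hu; lra.
  (* The closed arc complementary to the hole contains one lift of [I] and one of [I'], at the
     offsets [n / 2 + 1] and [n / 2 + 1 / 2] up to order; the parity of [p - n] selects the
     offset. *)
  have [q] := int_parity (p - n); rewrite intrB => -[pE|pE].
    exists (u + n%:~R / 2 + 1); last by lra.
    apply/to_circle_eqP; exists (q - 1); rewrite intrB; lra.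
  exists (u + n%:~R / 2 + 2^-1); last by lra.
  apply/to_circle_eqP; exists q; lra.
Qed.

Lemma main_holes_sub : main_holes a b `<=` hole_points s t.
Proof.
have w := hd_width; move=> x [].
  have -> : a = to_circle (s + 1) by rewrite (to_circleDint s 1).
  rewrite opposite_to_circle => /open_arcP[|u -> hu]; first by lra.
  by exists (u - 2^-1), 1; split; [congr to_circle; lra|lra].
rewrite opposite_to_circle => /open_arcP[|u -> hu]; first by lra.
by exists u, 0; split; [congr to_circle; lra|lra].
Qed.

Lemma horseshoe_sub : horseshoe k a b `<=` survivors k (end_pieces k s t).
Proof. by move=> x hx i; apply: horseshoe_pieces_sub; exact: hx. Qed.

(** Multiplication by [2 ^+ k] sends [s] and [t] to themselves up to half turns, and endpoints
    belong to the pieces. *)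
Lemma data_survivors u n : u = s \/ u = t ->
  survivors k (end_pieces k s t) (to_circle (u + n%:~R / 2)).
Proof.
move=> uE i; have [mu0 mu2] := hd_mu; rewrite iter_doubling.
suff [v [m [vE e]]] : exists v m, (v = s \/ v = t) /\
    2 ^+ (k * i) * (u + n%:~R / 2) = v + m%:~R / 2.
  rewrite e; exists v, m; split => //; rewrite -/mu.
  by case: vE => ->; [left|right]; lra.
elim: i => [|i [v [m [vE IH]]]]; first by exists u, n; rewrite muln0 mul1r.
have [p pE] := hd_exp_s; have [q qE] := hd_exp_t.
have [l lE] := exp2_int k m.
rewrite mulnS exprD -mulrA IH mulrDr mulrA lE.
case: vE => ->.
  exists s, (2 * p + l + 1); split; first by left.
  by rewrite pE !intrD intrM; field.
exists t, (2 * q + l); split; first by right.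
by rewrite qE !intrD intrM; field.
Qed.

End Data.
End HorseshoeData.

(** * Rotational orbits *)

Section CanonicData.
Context {R : realType}.
Implicit Types (s t u v : R) (x y z : circle R) (A : set (circle R)) (k : nat).
Implicit Types (f h : circle R -> circle R).

Lemma ccwxx x : ccw x x = 0.
Proof.
have [t ->] := to_circle_surj x; apply: (@ccw_eq _ _ _ _ 0); first by lra.
by rewrite !addr0.
Qed.

Lemma ccw0_eq x y : ccw x y = 0 -> y = x.
Proof.
have [t ->] := to_circle_surj x => xy.
by have := ccwE t y; rewrite xy addr0.
Qed.

Lemma ccw_inj x y z : ccw x y = ccw x z -> y = z.
Proof.
have [t ->] := to_circle_surj x => yz.
by rewrite (ccwE t y) (ccwE t z) yz.
Qed.

Lemma monotone_ccw h x y z : monotone_map h -> injective h ->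
  ccw x y <= ccw x z -> ccw (h x) (h y) <= ccw (h x) (h z).
Proof.
move=> [F [_ Fhomo F1 Fh]] hinj.
have [t ->] := to_circle_surj x.
have [] := (ccwE t y, ccwE t z).
have := ccw_bounds (to_circle t) y; have := ccw_bounds (to_circle t) z.
move: (ccw _ y) (ccw _ z) => u v v01 u01 -> zE uv.
have Ftu : F t <= F (t + u) by apply: Fhomo; lra.
have Fuv : F (t + u) <= F (t + v) by apply: Fhomo; lra.
have : F (t + v) <= F t + 1 by rewrite -F1; apply: Fhomo; lra.
rewrite le_eqVlt => /orP[/eqP FtE|Fv1].
  have : to_circle t = to_circle (t + v).
    by apply: hinj; rewrite -!Fh FtE (to_circleDint _ 1).
  move=> /to_circle_eqP[n nE]; have n0 : n = 0.
    by apply: (@int_lt1 R); lra.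
  have v0 : v = 0 by rewrite n0 in nE; lra.
  by move: FtE; rewrite v0 addr0; lra.
rewrite zE -!Fh (@ccw_eq _ _ _ (F (t + u) - F t) 0); [|lra|ring].
by rewrite (@ccw_eq _ _ _ (F (t + v) - F t) 0); [lra|lra|ring].
Qed.

Lemma monotone_ccwE h x y z : monotone_map h -> injective h ->
  (ccw (h x) (h y) <= ccw (h x) (h z)) = (ccw x y <= ccw x z).
Proof.
move=> mh hinj; apply/idP/idP => [hyz|]; last exact: monotone_ccw.
rewrite leNgt; apply/negP => zy.
have hzy := monotone_ccw mh hinj (ltW zy).
have /hinj yz : h y = h z by apply: (@ccw_inj (h x)); apply/eqP; rewrite eq_le hyz.
by rewrite yz ltxx in zy.
Qed.

Lemma ccw_add x y z : ccw (x + z) (y + z) = ccw x y.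
Proof. by rewrite /ccw opprD addrACA subrr addr0. Qed.

Lemma ccw_doubling x y : ccw (doubling x) (doubling y) = 2 * ccw x y \/
  2^-1 <= ccw x y /\ ccw (doubling x) (doubling y) = 2 * ccw x y - 1.
Proof.
have [t ->] := to_circle_surj x.
have := ccw_bounds (to_circle t) y; have := ccwE t y.
move: (ccw _ y) => u -> u01; rewrite !doubling_to_circle.
have [u2|u2] := ltP u 2^-1; [left|right].
  by apply: (@ccw_eq _ _ _ _ 0); [lra|ring].
by split => //; apply: (@ccw_eq _ _ _ _ 1); [lra|ring].
Qed.

(** If an end were outside [A], the part of the arc from [x] to that end, end included, would be a
    connected subset of the complement reaching outside the component. *)
Lemma component_arc_ends A x al be :
  al < be < al + 1 -> connected_component (~` A) x =
    open_arc (to_circle al) (to_circle be) -> ~ A x ->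
  A (to_circle al) /\ A (to_circle be).
Proof.
move=> ab cE Ax.
have arc := @open_arcP R al be; have {}arc z := arc z ltac:(lra).
have sub : open_arc (to_circle al) (to_circle be) `<=` ~` A.
  by rewrite -cE; exact: connected_component_sub.
have /arc[w xE w01] : open_arc (to_circle al) (to_circle be) x.
  by rewrite -cE; exact: connected_component_refl.
have conn (i : interval R) : connected (to_circle @` [set` i]).
  apply: connected_continuous_connected.
    by apply/connected_intervalP; exact: interval_is_interval.
  by apply: continuous_subspaceT; exact: to_circle_continuous.
have not_end c : c = al \/ c = be -> ~ open_arc (to_circle al) (to_circle be) (to_circle c).
  move=> [->|->] /arc[u /to_circle_eqP[n nE] hu].
    by apply: (@no_half_int R (-1) n); rewrite ?intrN; lra.
  by apply: (@no_half_int R 0 n); lra.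
split; apply: contrapT => Aend.
- suff : connected_component (~` A) x (to_circle al).
    by rewrite cE; apply: not_end; left.
  apply: (@connected_component_max _ _ (to_circle @` [set` `[al, w]])).
  + by exists w => //=; rewrite in_itv /= lexx; lra.
  + move=> z [u /=]; rewrite in_itv /= => /andP[]; rewrite le_eqVlt.
    move=> /predU1P[<- _|alu uw] <-//.
    by apply: sub; apply/arc; exists u => //; lra.
  + exact: conn.
  + by exists al => //=; rewrite in_itv /= lexx; lra.
- suff : connected_component (~` A) x (to_circle be).
    by rewrite cE; apply: not_end; right.
  apply: (@connected_component_max _ _ (to_circle @` [set` `[w, be]])).
  + by exists w => //=; rewrite in_itv /= lexx; lra.
  + move=> z [u /=]; rewrite in_itv /= => /andP[wu]; rewrite le_eqVlt.
    move=> /predU1P[->|ube] <-//.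
    by apply: sub; apply/arc; exists u => //; lra.
  + exact: conn.
  + by exists be => //=; rewrite in_itv /= lexx; lra.
Qed.

(* [cd_len]: the long gap of the rotational orbit, of length [be + 1 - al], is
   wrapped onto a gap of length [2 * (be + 1 - al) - 1], which doubles [k - 1]
   times before coming back. *)
Record canonic_data k (al be : R) : Prop := CanonicData {
  cd_per_al : has_period k (to_circle al);
  cd_per_be : has_period k (to_circle be);
  cd_be : 0 < be < 2^-1;
  cd_al : 2^-1 < al < 1;
  cd_len : 2 ^+ k * (be + 1 - al) = 2 ^+ k / 2 + (be + 1 - al);
  cd_travel : forall r, (0 < r < k)%N -> exists n : int,
    be + n%:~R <= 2 ^+ r * al /\ 2 ^+ r * (be + 2^-1) <= al + n%:~R }.

(** * Gap lengths of a rotational orbit *)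

Section RotationalOrbit.
Context (A : set (circle R)) (k : nat) (al be tau : R).
Hypotheses (A_rot : rotational A) (A_per : forall x, A x -> has_period k x).
Hypotheses (A_bounds : forall x, A x -> tau <= angle x <= tau + 2^-1).
Hypotheses (tau0 : 0 < tau) (al01 : 0 <= al < 1) (be01 : 0 <= be < 1).
Hypotheses (A_al : A (to_circle al)) (A_be : A (to_circle be)).
Hypothesis A_gap : forall x, A x -> ~ open_arc (to_circle al) (to_circle be) x.
Hypothesis gap_long : 2^-1 < ccw (to_circle al) (to_circle be).

Let angleE t : 0 <= t < 1 -> angle (to_circle t) = t.
Proof. by move=> t01; apply: (@angle_eq _ _ _ 0) => //; rewrite addr0. Qed.

Lemma rotational_gap_order : be < al /\
  ccw (to_circle al) (to_circle be) = be + 1 - al.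
Proof.
have bal := A_bounds A_al; have bbe := A_bounds A_be.
rewrite angleE// in bal; rewrite angleE// in bbe.
have [abe|bea] := leP al be.
  move: gap_long; rewrite (@ccw_eq _ _ _ (be - al) 0); [lra|lra|ring].
by split => //; apply: (@ccw_eq _ _ _ _ (-1)); [lra|ring].
Qed.

Lemma rotational_within x : A x -> be <= angle x <= al.
Proof.
have [bea _] := rotational_gap_order; have al1 := al01; have be1 := be01.
move=> Ax; have xb := angle_bounds x; apply: contrapT => nx.
apply: (A_gap Ax).
have -> : to_circle be = to_circle (be + 1) by rewrite (to_circleDint _ 1).
apply/open_arcP; first by lra.
have [xbe|xbe] := ltP (angle x) be.
  by exists (angle x + 1); [rewrite (to_circleDint _ 1) angleK|lra].
exists (angle x); [by rewrite angleK|].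
by apply/andP; split; [rewrite ltNge; apply/negP => xal; apply: nx; apply/andP|lra].
Qed.

Lemma rotational_doubling x : A x -> A (doubling x).
Proof.
have [[x0 _ ->] _] := A_rot => -[n _ <-].
by exists n.+1.
Qed.

Lemma rotational_iter n x : A x -> A (iter n doubling x).
Proof. by move=> Ax; elim: n => //= n; exact: rotational_doubling. Qed.

(** Were [be] at least 1/2, its double would have angle [2 * be - 1], before [be]; were [al] below
    1/2, its double would lie past [al]. The value [al = 1/2] is sent to 0, excluded by
    [tau > 0]. *)
Lemma rotational_straddles_half : be < 2^-1 < al.
Proof.
have t0 := tau0; have al1 := al01; have be1 := be01.
have bal := rotational_within (rotational_doubling A_al).
have bbe := rotational_within (rotational_doubling A_be).
have tal := A_bounds (rotational_doubling A_al).
have tbe := A_bounds (rotational_doubling A_be).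
rewrite !doubling_to_circle in bal bbe tal tbe.
apply/andP; split; rewrite ltNge; apply/negP => h.
  by rewrite (@angle_eq _ _ (2 * be - 1) 1) in bbe; [lra|lra|ring].
move: h; rewrite le_eqVlt => /predU1P[h|h].
  by rewrite (@angle_eq _ _ 0 1) in tal; lra.
by rewrite (@angle_eq _ _ (2 * al) 0) in bal tal; [|lra|ring]; lra.
Qed.

(** A rotation preserves counterclockwise lengths, and the conjugating homeomorphism preserves their
    order; hence doubling preserves the cyclic order of the orbit. *)
Lemma rotational_ccw x y z : A x -> A y -> A z ->
  ccw x y <= ccw x z ->
  ccw (doubling x) (doubling y) <= ccw (doubling x) (doubling z).
Proof.
have [_ [h [rho [[_ [g [_ hK _]] mh] _ hrho]]]] := A_rot.
have hinj := can_inj hK.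
move=> Ax Ay Az; rewrite -(monotone_ccwE _ _ _ mh hinj) => xyz.
by rewrite -(monotone_ccwE _ _ _ mh hinj) !hrho// !ccw_add.
Qed.

Definition adjacent x y :=
  [/\ A x, A y, x <> y & forall z, A z -> z <> x -> ccw x y <= ccw x z].

Lemma rotational_predecessor x : A x -> exists2 y, A y & doubling y = x.
Proof.
move=> Ax; have [k0 xk _] := A_per Ax.
exists (iter k.-1 doubling x); first exact: rotational_iter.
by rewrite -iterS prednK.
Qed.

Lemma rotational_doubling_inj x y : A x -> A y -> doubling x = doubling y -> x = y.
Proof.
move=> Ax Ay xy; have [k0 xk _] := A_per Ax; have [_ yk _] := A_per Ay.
by rewrite -xk -yk -(prednK k0) !iterSr xy.
Qed.

Lemma adjacent_doubling x y : adjacent x y -> adjacent (doubling x) (doubling y).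
Proof.
move=> [Ax Ay xy xmin]; split; try exact: rotational_doubling.
  by move=> /(rotational_doubling_inj Ax Ay).
move=> _ /rotational_predecessor[w Aw <-] wx.
by apply: rotational_ccw => //; apply: xmin => // wE; apply: wx; rewrite wE.
Qed.

Lemma adjacent_ends : adjacent (to_circle al) (to_circle be).
Proof.
split=> // [abe|z Az zal].
  by move: gap_long; rewrite abe ccwxx; lra.
rewrite leNgt; apply/negP => zbe; apply: (A_gap Az).
rewrite /open_arc /= zbe andbT lt_neqAle eq_sym; apply/andP; split.
  by apply/eqP => /ccw0_eq.
by have /andP[] := ccw_bounds (to_circle al) z.
Qed.

Let gap r := ccw (iter r doubling (to_circle al)) (iter r doubling (to_circle be)).

Lemma adjacent_iter r :
  adjacent (iter r doubling (to_circle al)) (iter r doubling (to_circle be)).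
Proof. by elim: r => [|r IH]; [exact: adjacent_ends|exact: adjacent_doubling]. Qed.

(** For such [r] the image gap does not start at [al], and no orbit point lies strictly inside it,
    so it ends no later than [al]. *)
Lemma gap_short r : (0 < r < k)%N ->
  gap r <= al - angle (iter r doubling (to_circle al)).
Proof.
move=> rk; have [_ _ alk] := A_per A_al.
have [Ax Ay _ xmin] := adjacent_iter r.
have /= := xmin _ A_al (fun E => alk _ rk (esym E)).
have xb := rotational_within Ax; have be1 := be01; have al1 := al01.
rewrite (_ : ccw _ (to_circle al) = al - angle (iter r doubling (to_circle al))) //.
rewrite -{1}[iter r _ _]angleK; apply: (@ccw_eq _ _ _ _ 0); [lra|ring].
Qed.

(** The first doubling wraps the gap, longer than 1/2, once around and leaves [2 * gap 0 - 1]. Later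
    gaps fit in the arc from [be] to [al], shorter than 1/2, so they double exactly. *)
Lemma gap_formula r : (0 < r <= k)%N ->
  gap r = 2 ^+ r * (be + 1 - al) - 2 ^+ r / 2.
Proof.
have [bea gapE] := rotational_gap_order; have straddle := rotational_straddles_half.
have al1 := al01; have be1 := be01; have t0 := tau0.
case: r => // r; elim: r => [|r IH] rk.
  have : gap 1 = 2 * gap 0 \/ 2^-1 <= gap 0 /\ gap 1 = 2 * gap 0 - 1.
    exact: ccw_doubling.
  have := ccw_bounds (iter 1 doubling (to_circle al)) (iter 1 doubling (to_circle be)).
  by rewrite -/(gap 1) /(gap 0) /= gapE expr1; move: gap_long; rewrite gapE; lra.
have rk' : (0 < r.+1 < k)%N by rewrite /= in rk *; exact: rk.
have : gap r.+2 = 2 * gap r.+1 \/ 2^-1 <= gap r.+1 /\ gap r.+2 = 2 * gap r.+1 - 1.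
  exact: ccw_doubling.
have := gap_short rk'; have [Ax _ _ _] := adjacent_iter r.+1.
have := rotational_within Ax.
rewrite [2 ^+ r.+2]exprS -!mulrA => xb sh.
have -> : 2 * (2 ^+ r.+1 * (be + 1 - al)) - 2 * (2 ^+ r.+1 / 2)
   = 2 * (2 ^+ r.+1 * (be + 1 - al) - 2 ^+ r.+1 / 2) by ring.
rewrite -IH; last by case/andP: rk' => _ /ltnW.
by move: gap_long; rewrite gapE; lra.
Qed.

Lemma rotational_canonic_data : canonic_data k al be.
Proof.
have [bea gapE] := rotational_gap_order; have straddle := rotational_straddles_half.
have al1 := al01; have be1 := be01; have t0 := tau0.
have bbe := A_bounds A_be; rewrite angleE// in bbe.
have [k0 alk _] := A_per A_al; have [_ bek _] := A_per A_be.
split; try exact: A_per; try lra.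
  (* After [k] doublings the gap is back at its start, which turns the formula into an equation for
     its length. *)
  have := @gap_formula k; rewrite k0 leqnn => /(_ isT).
  rewrite /gap alk bek gapE; lra.
(* The image of [al] has angle at least [be], and by [gap_short] adding the explicit length [gap r]
   to it does not pass [al]; these are the two inequalities, [n] absorbing the integer part. *)
move=> r rk; have [Ax _ _ _] := adjacent_iter r; have := rotational_within Ax.
have := gap_short rk; rewrite gap_formula; last by case/andP: rk => -> /ltnW.
rewrite iter_doubling; have [n -> _] := angle_to_circle (2 ^+ r * al).
move=> h1 h2; exists (- n); rewrite intrN; split; lra.
Qed.

End RotationalOrbit.

Lemma canonic_arcs_data theta A k a b : canonic_arcs theta A k a b ->
  exists al be, [/\ canonic_data k al be, opposite a = to_circle al,
    b = to_circle be & al - 2^-1 <= angle theta <= be].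
Proof.
move=> [[[theta2 _] theta0] [Arot Asub] Aper [x Ax cE] long].
have Abounds z : A z -> angle theta <= angle z <= angle theta + 2^-1.
  move=> /Asub; rewrite -{1 2}(angleK theta) opposite_to_circle.
  move=> /closed_arcP[|u -> hu]; first by lra.
  by rewrite (@angle_eq _ _ u 0)//; [lra|rewrite addr0].
exists (angle (opposite a)), (angle b).
have al01 := angle_bounds (opposite a); have be01 := angle_bounds b.
have [Aal Abe] : A (opposite a) /\ A b.
  have xE := ccwE (angle (opposite a)) b; rewrite angleK in xE.
  have ab1 := ccw_bounds (opposite a) b.
  rewrite -{1}(angleK (opposite a)) {1}xE; apply: (@component_arc_ends A x) => //.
    by lra.
  by rewrite cE angleK -xE.
have gap z : A z -> ~ open_arc (to_circle (angle (opposite a))) (to_circle (angle b)) z.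
  by rewrite !angleK -cE => Az /connected_component_sub.
have lng : 2^-1 < ccw (to_circle (angle (opposite a))) (to_circle (angle b)).
  by rewrite !angleK.
have Aal' : A (to_circle (angle (opposite a))) by rewrite angleK.
have Abe' : A (to_circle (angle b)) by rewrite angleK.
split; rewrite ?angleK//.
  exact: (rotational_canonic_data Arot Aper Abounds).
by have := Abounds _ Aal; have := Abounds _ Abe; lra.
Qed.

End CanonicData.

(** * Inverting the pruning *)

Section Tuning.
Context {R : realType}.
Implicit Types (s t u v w x y : R) (k : nat) (j n m : int).

Lemma exp2_bounded_eq0 (e c : R) : (forall i : nat, 2 ^+ i * `|e| <= c) -> e = 0.
Proof.
move=> bound; apply/eqP; rewrite -normr_eq0; apply: contrapT => /negP e0.
have {}e0 : 0 < `|e| by rewrite lt_neqAle eq_sym e0 normr_ge0.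
have c0 : 0 <= c by have := bound 0; rewrite mul1r; apply: le_trans.
have := archi_boundP (divr_ge0 c0 (ltW e0)).
set i := Num.bound _; rewrite ltr_pdivrMr// => h.
have : i%:R <= 2 ^+ i :> R.
  by rewrite -natrX ler_nat ltnW// ltn_expl.
move=> /(ler_wpM2r (ltW e0)); have := bound i; lra.
Qed.

Lemma lift_addint (F : R -> R) : (forall t, F (t + 1) = F t + 1) ->
  forall t n, F (t + n%:~R) = F t + n%:~R.
Proof.
move=> F1; have nat_case t (i : nat) : F (t + i%:R) = F t + i%:R.
  elim: i => [|i IH]; first by rewrite !addr0.
  by rewrite -natr1 !addrA F1 IH.
move=> t [i|i]; first exact: nat_case.
have := nat_case (t + (Negz i)%:~R) i.+1.
by rewrite NegzE mulrNz -pmulrn subrK => ->; rewrite addrK.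
Qed.

(** The pruning sends [be] and [al] to the same point 0, so it cannot be inverted over points that
    are eventually mapped to 0; these are the lifts excluded here. *)
Definition nondyadic x := forall (i : nat) m, 2 ^+ i * x <> m%:~R.

Lemma nondyadic_shift x n : nondyadic x -> nondyadic (x + n%:~R / 2).
Proof.
move=> nd i m h; have [p pE] := exp2_int (R:=R) i n.
apply: (nd i.+1 (2 * m - p)).
by rewrite exprS intrB intrM -pE -h; field.
Qed.

Lemma nondyadic_exp x i : nondyadic x -> nondyadic (2 ^+ i * x).
Proof. by move=> nd l m; rewrite mulrA -exprD; exact: nd. Qed.

Lemma nondyadic_of_exp x i : nondyadic (2 ^+ i * x) -> nondyadic x.
Proof.
move=> nd l m h; have [p pE] := exp2_int (R:=R) i m.
by apply: (nd l p); rewrite mulrCA h.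
Qed.

Lemma nondyadic_floor x : nondyadic x ->
  exists j, j%:~R / 2 < x < j%:~R / 2 + 2^-1.
Proof.
move=> nd; exists (Num.floor (2 * x)).
have /andP[] := floor_itv (2 * x); rewrite intrD1 le_eqVlt => /predU1P[h|h1 h2].
  by have := nd 1 (Num.floor (2 * x)); rewrite expr1 h.
lra.
Qed.

(** If [2 ^+ i * x] were an integer, so would be [2 ^+ (k * i) * x], which is [x] up to a
    half-integer; but [x] is strictly between two consecutive half-integers. *)
Lemma nondyadic_eventually_fixed k x j n : (0 < k)%N ->
  j%:~R / 2 < x < j%:~R / 2 + 2^-1 -> 2 ^+ k * x = x + n%:~R / 2 -> nondyadic x.
Proof.
move=> k0 xj xk i m xm.
have iter q : exists p : int, 2 ^+ (k * q) * x = x + p%:~R / 2.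
  elim: q => [|q [p pE]]; first by exists 0; rewrite muln0 mul1r mul0r addr0.
  have [r rE] := exp2_int (R:=R) k p.
  exists (n + r); rewrite mulnS exprD -mulrA pE mulrDr xk intrD -rE; ring.
have [p pE] := iter i.
have ik : (i <= k * i)%N by rewrite leq_pmull.
have [r rE] := exp2_int (R:=R) (k * i - i) m.
move: pE; rewrite -(subnK ik) exprD -mulrA xm rE => pE.
by apply: (@no_half_int R j (2 * r - p)); rewrite ?intrB ?intrM; lra.
Qed.

Lemma divn_split (k k1 i : nat) : (0 < k)%N -> (i < k * k1)%N ->
  exists q r, [/\ i = (k * q + r)%N, (r < k)%N & (q < k1)%N].
Proof.
move=> k0 ik; exists (i %/ k)%N, (i %% k)%N.
by rewrite mulnC -divn_eq ltn_mod k0 ltn_divLR// mulnC.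
Qed.

Section Pruning.
Context (k : nat) (al be : R) (cd : canonic_data k al be).
Context (a b : circle R) (aE : opposite a = to_circle al) (bE : b = to_circle be).
Context (phi : circle R -> circle R) (F : R -> R).
Let K := canonic_horseshoe k a b.
Hypotheses (F_homo : {homo F : s t / s <= t}) (F1 : forall t, F (t + 1) = F t + 1).
Hypothesis Fphi : forall t, to_circle (F t) = phi (to_circle t).
Hypothesis phi_onto : phi @` K = setT.
Hypothesis phi_conj : forall x : circle R, K x -> phi (iter k doubling x) = doubling (phi x).
Hypotheses (phi_b : phi b = 0) (phi_a : phi a = Defs.half) (phi_b' : phi (opposite b) = Defs.half).
Hypothesis F_al : F al = 0.

Let N : R := 2 ^+ k.
Let k0 : (0 < k)%N. Proof. by case: (cd_per_al cd). Qed.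
Let N2 : 2 <= N. Proof. exact: exp2_ge2. Qed.
Let ell := be + 1 - al.
Let cd' : [/\ 0 < be < 2^-1, 2^-1 < al < 1, N * ell = N / 2 + ell & 2^-1 < ell].
Proof.
have b1 := cd_be cd; have a1 := cd_al cd; have len := cd_len cd.
split => //; rewrite -subr_gt0 -(pmulr_rgt0 _ (_ : 0 < N)); last exact: exp2_gt0.
rewrite mulrBr; move: len; rewrite -/N -/ell => ->.
by rewrite addrAC subrr add0r /ell; lra.
Qed.

Let aE' : a = to_circle (al - 2^-1).
Proof.
have [t tE] := to_circle_surj a.
move: aE; rewrite tE opposite_to_circle => /to_circle_eqP[n nE].
by apply/to_circle_eqP; exists n; lra.
Qed.

Lemma arc_pairE (x : circle R) :
  arc_pair a b x <-> exists u n, x = to_circle (u + n%:~R / 2) /\ al <= u <= be + 2^-1.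
Proof.
have [b1 a1 _ l1] := cd'; rewrite /ell in l1.
have arc (y : circle R) : closed_arc a b y <-> exists2 u, y = to_circle u & al - 2^-1 <= u <= be.
  by rewrite aE' bE; apply: closed_arcP; lra.
have arc' (y : circle R) : closed_arc (opposite a) (opposite b) y <->
    exists2 u, y = to_circle u & al <= u <= be + 2^-1.
  by rewrite aE bE opposite_to_circle; apply: closed_arcP; lra.
split=> [[/arc|/arc'] [u -> hu]|[u [n [-> hu]]]].
- by exists (u + 2^-1), (-1); split; [congr to_circle; rewrite intrN; lra|lra].
- by exists u, 0; split; [congr to_circle; lra|lra].
have [m [->|->]] := int_parity (R:=R) n.
  by right; apply/arc'; exists u => //; apply/to_circle_eqP; exists m; lra.
left; apply/arc; exists (u - 2^-1); last by lra.
by apply/to_circle_eqP; exists (m + 1); rewrite intrD; lra.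
Qed.

Lemma horseshoe_half u n : K (to_circle u) -> K (to_circle (u + n%:~R / 2)).
Proof.
move=> Ku [|i]; last first.
  have [m mE] := exp2_half_int (R:=R) n (ltac:(by rewrite muln_gt0 k0) : (0 < k * i.+1)%N).
  have := Ku i.+1; rewrite !iter_doubling mulrDr mE to_circleDint.
  exact.
have := Ku 0; rewrite muln0 /= => /arc_pairE[v [m [/to_circle_eqP[p uE] hv]]].
apply/arc_pairE; exists v, (m + n + 2 * p); split => //.
by congr to_circle; rewrite !intrD intrM uE; field.
Qed.

Lemma horseshoe_iter u : K (to_circle u) -> K (to_circle (N * u)).
Proof.
move=> Ku i; have := Ku i.+1.
by rewrite !iter_doubling mulnS exprD -mulrA (mulrCA N) /N mulrCA.
Qed.

Let Fint t n : F (t + n%:~R) = F t + n%:~R. Proof. exact: lift_addint. Qed.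

(** Each value is known modulo 1 from [phi]; the integer is fixed by monotonicity on the turn
    starting at [al], where [F] goes from 0 to 1. *)
Lemma F_ends n : F (al + n%:~R / 2) = n%:~R / 2 /\
  F (be + 2^-1 + n%:~R / 2) = n%:~R / 2 + 2^-1.
Proof.
have [b1 a1 _ l1] := cd'; rewrite /ell in l1.
have al1 : F (al + 1) = 1 by rewrite F1 F_al add0r.
have bounds u : al <= u <= al + 1 -> 0 <= F u <= 1.
  by move=> hu; rewrite -{1}F_al -al1; apply/andP; split; apply: F_homo; lra.
have a_half : F (al + 2^-1) = 2^-1.
  have : to_circle (F (al + 2^-1)) = Defs.half.
    rewrite Fphi -phi_a aE'; congr phi; apply/to_circle_eqP; exists 1; lra.
  move=> /to_circle_eqP[m mE]; have := bounds (al + 2^-1); rewrite mE => h.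
  by rewrite (@int_lt1 R m) ?addr0//; lra.
have b_half : F (be + 2^-1) = 2^-1.
  have : to_circle (F (be + 2^-1)) = Defs.half by rewrite Fphi -phi_b' bE opposite_to_circle.
  move=> /to_circle_eqP[m mE]; have := bounds (be + 2^-1); rewrite mE => h.
  by rewrite (@int_lt1 R m) ?addr0//; lra.
have b_one : F (be + 1) = 1.
  have : to_circle (F (be + 1)) = to_circle 0.
    rewrite Fphi to_circle0 -phi_b bE; congr phi; apply/to_circle_eqP; exists 1; lra.
  move=> /to_circle_eqP[m]; rewrite add0r => mE.
  have := bounds (be + 1); have : F (al + 2^-1) <= F (be + 1) by apply: F_homo; lra.
  rewrite a_half mE => h1 h2.
  by rewrite (@int_between R 1 m)//; lra.
have [m [nE|nE]] := int_parity (R:=R) n.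
  have -> : n%:~R / 2 = m%:~R :> R by rewrite nE; field.
  by rewrite !Fint F_al b_half; split; ring.
have -> : n%:~R / 2 = 2^-1 + m%:~R :> R by rewrite nE; field.
rewrite !addrA !Fint a_half (_ : be + 2^-1 + 2^-1 = be + 1) ?b_one; last by field.
by split; field.
Qed.

Lemma F_mem u j : K (to_circle u) -> j%:~R / 2 < F u < j%:~R / 2 + 2^-1 ->
  al + j%:~R / 2 < u < be + 2^-1 + j%:~R / 2.
Proof.
move=> Ku Fu; have := Ku 0; rewrite muln0 /= => /arc_pairE[v [m [/to_circle_eqP[p uE] hv]]].
have [F_a F_b] := F_ends (m + 2 * p).
have e : (m + 2 * p)%:~R / 2 = m%:~R / 2 + p%:~R :> R by rewrite intrD intrM; field.
have h1 : F (al + (m + 2 * p)%:~R / 2) <= F u by apply: F_homo; rewrite e; lra.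
have h2 : F u <= F (be + 2^-1 + (m + 2 * p)%:~R / 2) by apply: F_homo; rewrite e; lra.
rewrite F_a in h1; rewrite F_b in h2.
have jE : j = m + 2 * p by apply: (@int_between R); lra.
have [F_a' F_b'] := F_ends j.
have n1 : u != al + j%:~R / 2 by apply: contraTneq (proj1 (andP Fu)) => ->; rewrite F_a' ltxx.
have n2 : u != be + 2^-1 + j%:~R / 2.
  by apply: contraTneq (proj2 (andP Fu)) => ->; rewrite F_b' ltxx.
rewrite !lt_neqAle n2 eq_sym n1 /=; rewrite jE e; lra.
Qed.

(** The integer for which [u |-> N * u - tuned_offset j] takes [al + j / 2], where [F] is [j / 2],
    to [al + j], where [F] is [j]. With it the conjugacy with doubling holds for lifts, not only
    modulo 1. *)
Definition tuned_offset j : R := N * (al + j%:~R / 2) - al - j%:~R.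

Lemma tuned_offset_int j : exists n, tuned_offset j = n%:~R.
Proof.
have [p pE] := has_periodE (cd_per_al cd); have [q qE] := exp2_half_int (R:=R) j k0.
exists (p + q - j); rewrite /tuned_offset /N mulrDr pE qE intrB intrD; ring.
Qed.

Lemma F_double u j : K (to_circle u) -> j%:~R / 2 < F u < j%:~R / 2 + 2^-1 ->
  K (to_circle (N * u - tuned_offset j)) /\ F (N * u - tuned_offset j) = 2 * F u.
Proof.
move=> Ku Fu; have [n nE] := tuned_offset_int j; have [b1 a1 len l1] := cd'.
have /andP[u1 u2] := F_mem Ku Fu.
have vE : to_circle (N * u - tuned_offset j) = to_circle (N * u).
  by rewrite nE -intrN to_circleDint.
split; first by rewrite vE; exact: horseshoe_iter.
have N0 : 0 < N by exact: exp2_gt0.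
have [F_a _] := F_ends (2 * j); have [_ F_b] := F_ends (2 * j + 1).
have e : (2 * j)%:~R / 2 = j%:~R :> R by rewrite intrM; field.
have e' : (2 * j + 1)%:~R / 2 = j%:~R + 2^-1 :> R by rewrite intrD intrM; field.
have h1 : F (al + (2 * j)%:~R / 2) <= F (N * u - tuned_offset j).
  apply: F_homo; rewrite e /tuned_offset.
  have : N * (al + j%:~R / 2) <= N * u by rewrite ler_pM2l//; lra.
  lra.
have h2 : F (N * u - tuned_offset j) <= F (be + 2^-1 + (2 * j + 1)%:~R / 2).
  apply: F_homo; rewrite e' /tuned_offset.
  have : N * u <= N * (be + 2^-1 + j%:~R / 2) by rewrite ler_pM2l//; lra.
  (* By [cd_len] this equals [ell]: the branch stretches an arc of length [ell - 1 / 2] from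
     [al + j] exactly up to [be + 1 + j]. *)
  have : N * (be + 2^-1 + j%:~R / 2) - N * (al + j%:~R / 2) = N * ell - N / 2.
    by rewrite /ell; field.
  by rewrite len /ell; lra.
rewrite F_a e in h1; rewrite F_b e' in h2.
have : to_circle (F (N * u - tuned_offset j)) = to_circle (2 * F u).
  by rewrite Fphi vE -doubling_to_circle Fphi -phi_conj// iter_doubling.
move=> /to_circle_eqP[p pE].
by rewrite pE (@int_lt1 R p) ?addr0//; lra.
Qed.

(** The common image decides which branch applies, so the two points follow the same affine branches
    and stay within distance 1 while their difference is multiplied by [N] at each stage. *)
Lemma F_inj u v : K (to_circle u) -> K (to_circle v) -> F u = F v ->
  nondyadic (F u) -> u = v.
Proof.
move=> Ku Kv Fuv nd; apply/eqP; rewrite -subr_eq0; apply/eqP.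
apply: (@exp2_bounded_eq0 _ 1) => i.
have : N ^+ i * `|u - v| <= 1; last first.
  apply: le_trans; apply: ler_wpM2r => //.
  by apply: lerXn2r; rewrite ?nnegrE//; exact: (le_trans _ N2).
elim: i u v Ku Kv Fuv nd => [|i IH] u v Ku Kv Fuv nd.
  have [j hj] := nondyadic_floor nd.
  have := F_mem Ku hj; rewrite Fuv in hj; have := F_mem Kv hj.
  have [b1 a1 _ _] := cd'; rewrite mul1r ler_norml; lra.
have [j hj] := nondyadic_floor nd.
have [Ku' Fu'] := F_double Ku hj; rewrite Fuv in hj.
have [Kv' Fv'] := F_double Kv hj.
have := IH _ _ Ku' Kv'; rewrite Fu' Fv' Fuv => /(_ erefl).
have -> : N * u - tuned_offset j - (N * v - tuned_offset j) = N * (u - v) by ring.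
rewrite normrM (gtr0_norm (exp2_gt0 k)) mulrA -exprSr; apply.
by rewrite -[2 * _]/(2 ^+ 1 * _) -Fuv; exact: nondyadic_exp.
Qed.

(* The inverse of the pruning on lifts; by [tune_uniq] its value is the only
   point of the horseshoe above [x] as soon as the orbit of [x] avoids [0]. *)
Definition tune x : R := xget 0 [set u | K (to_circle u) /\ F u = x].

Lemma tuneP x : K (to_circle (tune x)) /\ F (tune x) = x.
Proof.
rewrite /tune; case: xgetP => // /(_ _) none; exfalso.
have : setT (to_circle x) by [].
rewrite -phi_onto => -[X KX]; have [u XE] := to_circle_surj X.
rewrite XE in KX *; rewrite -Fphi => /to_circle_eqP[n nE].
apply: (none (u - n%:~R)); split; first by rewrite -intrN to_circleDint.
by rewrite -intrN Fint intrN nE addrK.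
Qed.

Lemma tune_uniq u : K (to_circle u) -> nondyadic (F u) -> tune (F u) = u.
Proof.
move=> Ku nd; have [KL FL] := tuneP (F u).
by apply: F_inj => //; rewrite FL.
Qed.

Lemma tune_lt x y : x < y -> tune x < tune y.
Proof.
move=> xy; rewrite ltNge; apply/negP => /F_homo.
by rewrite !(proj2 (tuneP _)) leNgt xy.
Qed.

Lemma tune_le x y : x <= y -> tune x <= tune y.
Proof. by rewrite le_eqVlt => /predU1P[->//|/tune_lt/ltW]. Qed.

Lemma tune_mem x j : j%:~R / 2 < x < j%:~R / 2 + 2^-1 ->
  al + j%:~R / 2 < tune x < be + 2^-1 + j%:~R / 2.
Proof. by have [KL FL] := tuneP x; rewrite -{1 2}FL; exact: F_mem. Qed.

Lemma tune_double x j : nondyadic x -> j%:~R / 2 < x < j%:~R / 2 + 2^-1 ->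
  tune (2 * x) = N * tune x - tuned_offset j.
Proof.
have [KL FL] := tuneP x; rewrite -{1 2 3 4}FL => nd xj.
have [K' F'] := F_double KL xj.
by rewrite -F' tune_uniq// F' -[2 * _]/(2 ^+ 1 * _); exact: nondyadic_exp.
Qed.

Lemma tune_int x n : nondyadic x -> tune (x + n%:~R) = tune x + n%:~R.
Proof.
have [KL FL] := tuneP x => nd; have e : x + n%:~R = F (tune x + n%:~R).
  by rewrite Fint FL.
rewrite e tune_uniq// ?to_circleDint// -e.
have -> : n%:~R = (2 * n)%:~R / 2 :> R by rewrite intrM; field.
exact: nondyadic_shift.
Qed.

(** The conjugacy with doubling determines the image of [tune x + 1 / 2] only up to a half turn; the
    arc numbered [j + 1] in which that point falls decides. *)
Lemma tune_half x : nondyadic x -> tune (x + 2^-1) = tune x + 2^-1.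
Proof.
have [KL FL] := tuneP x => nd; have [j xj] := nondyadic_floor nd.
have K' : K (to_circle (tune x + 2^-1)).
  by have := horseshoe_half 1 KL; rewrite div1r.
suff e : x + 2^-1 = F (tune x + 2^-1).
  by rewrite {1}e tune_uniq// -e; have := @nondyadic_shift x 1 nd; rewrite div1r.
have [m mE] := exp2_half (R:=R) k0.
have : doubling (to_circle (F (tune x + 2^-1))) = doubling (to_circle x).
  rewrite Fphi -phi_conj// -{2}FL Fphi -phi_conj// !iter_doubling mulrDr mE.
  by rewrite to_circleDint.
rewrite !doubling_to_circle => /to_circle_eqP[p pE].
have [F_a _] := F_ends (j + 1); have [_ F_b] := F_ends (j + 1).
have /andP[u1 u2] := tune_mem xj.
have e : (j + 1)%:~R / 2 = j%:~R / 2 + 2^-1 :> R by rewrite intrD; field.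
have h1 : F (al + (j + 1)%:~R / 2) <= F (tune x + 2^-1).
  by apply: F_homo; rewrite e; lra.
have h2 : F (tune x + 2^-1) <= F (be + 2^-1 + (j + 1)%:~R / 2).
  by apply: F_homo; rewrite e; lra.
rewrite F_a e in h1; rewrite F_b e in h2.
have p1 : p = 1 by apply: (@int_between R); lra.
by rewrite p1 in pE; lra.
Qed.

Lemma tune_shift x n : nondyadic x -> tune (x + n%:~R / 2) = tune x + n%:~R / 2.
Proof.
move=> nd; have [m [nE|nE]] := int_parity (R:=R) n.
  by have -> : n%:~R / 2 = m%:~R :> R; [rewrite nE; field|exact: tune_int].
have -> : n%:~R / 2 = 2^-1 + m%:~R :> R by rewrite nE; field.
rewrite !addrA tune_int ?tune_half//.
by have := @nondyadic_shift x 1 nd; rewrite div1r.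
Qed.

Lemma half_cell_of_exp x y (n : nat) j : nondyadic x ->
  x <= y -> j%:~R / 2 < 2 ^+ n * x -> 2 ^+ n * y < j%:~R / 2 + 2^-1 ->
  exists j', j'%:~R / 2 < x /\ y < j'%:~R / 2 + 2^-1.
Proof.
move=> nd xy h1 h2; have [j' hj'] := nondyadic_floor nd.
exists j'; split; first by lra.
rewrite ltNge; apply/negP => h; have [p pE] := exp2_int (R:=R) n (j' + 1).
have e : p%:~R / 2 = 2 ^+ n * (j'%:~R / 2 + 2^-1) :> R.
  by rewrite -pE intrD; field.
apply: (@no_half_int R j p); rewrite e.
  by apply: (lt_trans h1); rewrite ltr_pM2l ?exp2_gt0//; lra.
by apply: le_lt_trans h2; rewrite ler_pM2l ?exp2_gt0.
Qed.

(** The images of [x] and [y] up to time [l] share a half cell, so the same branches apply to both;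
    this is why one integer [m] serves for both. *)
Lemma tune_exp x y (q l : nat) j : nondyadic x -> nondyadic y -> x <= y ->
  (q <= l)%N -> j%:~R / 2 < 2 ^+ l * x -> 2 ^+ l * y < j%:~R / 2 + 2^-1 ->
  exists m, tune (2 ^+ q * x) = N ^+ q * tune x + m%:~R /\
            tune (2 ^+ q * y) = N ^+ q * tune y + m%:~R.
Proof.
move=> ndx ndy xy ql h1 h2; elim: q ql => [|q IH] ql.
  by exists 0; rewrite !mul1r !addr0.
have [m [mx my]] := IH (ltnW ql).
have [||||j' [j1 j2]] := @half_cell_of_exp (2 ^+ q * x) (2 ^+ q * y) (l - q) j.
- exact: nondyadic_exp.
- by rewrite ler_pM2l ?exp2_gt0.
- by rewrite mulrA -exprD subnK// ltnW.
- by rewrite mulrA -exprD subnK// ltnW.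
have xyq : 2 ^+ q * x <= 2 ^+ q * y by rewrite ler_pM2l ?exp2_gt0.
have [p pE] := tuned_offset_int j'.
have [r rE] : exists r, N * m%:~R = r%:~R by exact: exp2_int.
exists (r - p); rewrite !exprS -!mulrA.
rewrite (@tune_double _ j'); [|exact: nondyadic_exp|lra].
rewrite (@tune_double _ j'); [|exact: nondyadic_exp|lra].
rewrite mx my !mulrDr pE intrB -rE; split; ring.
Qed.

Lemma tune_half_cell x y (q l : nat) j : nondyadic x -> x <= y ->
  (q <= l)%N -> j%:~R / 2 < 2 ^+ l * x -> 2 ^+ l * y < j%:~R / 2 + 2^-1 ->
  exists j', j'%:~R / 2 < 2 ^+ q * x /\ 2 ^+ q * y < j'%:~R / 2 + 2^-1.
Proof.
move=> ndx xy ql h1 h2; apply: (@half_cell_of_exp _ _ (l - q) j).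
- exact: nondyadic_exp.
- by rewrite ler_pM2l ?exp2_gt0.
- by rewrite mulrA -exprD subnK.
- by rewrite mulrA -exprD subnK.
Qed.

(* Away from multiples of the period the tuned itinerary lies in [be, al],
   the closed short arc spanned by the rotational orbit. *)
Lemma tune_travel x y (q r l : nat) j : nondyadic x -> nondyadic y -> x <= y ->
  (q <= l)%N -> j%:~R / 2 < 2 ^+ l * x -> 2 ^+ l * y < j%:~R / 2 + 2^-1 ->
  (0 < r < k)%N -> exists n, be + n%:~R <= 2 ^+ (k * q + r) * tune x /\
                             2 ^+ (k * q + r) * tune y <= al + n%:~R.
Proof.
move=> ndx ndy xy ql h1 h2 rk.
have [m [mx my]] := tune_exp ndx ndy xy ql h1 h2.
have [j' [j1 j2]] := tune_half_cell ndx xy ql h1 h2.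
have xyq : 2 ^+ q * x <= 2 ^+ q * y by rewrite ler_pM2l ?exp2_gt0.
have /andP[x1 _] := @tune_mem (2 ^+ q * x) j' ltac:(lra).
have /andP[_ y2] := @tune_mem (2 ^+ q * y) j' ltac:(lra).
have [n [n1 n2]] := cd_travel cd rk.
have r0 : (0 < r)%N by case/andP: rk.
have [p pE] := exp2_half_int (R:=R) (j' - 2 * m) r0.
have e : (j' - 2 * m)%:~R / 2 = j'%:~R / 2 - m%:~R :> R by rewrite intrB intrM; field.
rewrite e in pE; exists (n + p); rewrite intrD -pE addnC exprD exprM -!mulrA.
rewrite mx in x1; rewrite my in y2.
have : 2 ^+ r * (al + (j'%:~R / 2 - m%:~R)) <= 2 ^+ r * (N ^+ q * tune x).
  by rewrite ler_pM2l ?exp2_gt0//; lra.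
have : 2 ^+ r * (N ^+ q * tune y) <= 2 ^+ r * (be + 2^-1 + (j'%:~R / 2 - m%:~R)).
  by rewrite ler_pM2l ?exp2_gt0//; lra.
rewrite /N ![2 ^+ r * (_ + (_ - _))]mulrDr => u1 u2; split; lra.
Qed.

(** For minimality write a return time as [k * q + r]. If [r = 0], applying [F] gives the return
    time [q] for [x]. If [r > 0], [tune_travel] puts the image in the closed arc from [be] to [al],
    away from the open arc around [tune x]. *)
Lemma tune_period k1 x : has_period k1 (to_circle x) -> nondyadic x ->
  has_period (k * k1) (to_circle (tune x)).
Proof.
move=> per nd; have [k10 _ xk] := per; have [n nE] := has_periodE per.
have ev q : exists m, tune (2 ^+ q * x) = 2 ^+ (k * q) * tune x + m%:~R.
  have [j hj] := nondyadic_floor (@nondyadic_exp x q nd).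
  have [m [mE _]] := @tune_exp x x q q j nd nd (lexx _) (leqnn _) ltac:(lra) ltac:(lra).
  by exists m; rewrite exprM.
split.
- by rewrite muln_gt0 k0.
- rewrite iter_doubling; have [m mE] := ev k1; apply/to_circle_eqP.
  exists (n - m); rewrite intrB addrA; apply/eqP; rewrite eq_sym subr_eq -mE nE.
  by rewrite tune_int.
move=> i /andP[i0 ik]; rewrite iter_doubling => /to_circle_eqP[p pE].
have [q [r [iE rk qk]]] := divn_split k0 ik.
have [r0|r0] := posnP r.
  have [m mE] := ev q; rewrite r0 addn0 in iE.
  rewrite -iE pE in mE.
  apply: (xk q).
    by rewrite qk andbT lt0n; apply: contraTneq i0 => q0; rewrite iE q0 muln0.
  rewrite iter_doubling -(proj2 (tuneP (2 ^+ q * x))) mE -addrA -intrD Fint.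
  by rewrite to_circleDint (proj2 (tuneP x)).
have [j hj] := nondyadic_floor (@nondyadic_exp x q nd).
have rk' : (0 < r < k)%N by rewrite r0.
have [m [m1 m2]] := @tune_travel x x q r q j nd nd (lexx _)
  (leqnn _) ltac:(lra) ltac:(lra) rk'.
rewrite -iE pE in m1 m2.
have [j' hj'] := nondyadic_floor nd; have := tune_mem hj'.
by move=> h; apply: (@no_half_int R 0 (2 * m - 2 * p - j'));
  rewrite !intrB !intrM; lra.
Qed.

(** * Pulling a horseshoe back through the pruning *)

Section TunedData.
Context k1 j1 s1 t1 (hd : horseshoe_data k1 j1 s1 t1).
Let mu := (t1 - s1) / 2 ^+ k1.
Let s2 := tune s1.
Let t2 := tune t1.
Let mu2 := (t2 - s2) / 2 ^+ (k * k1).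

Lemma data_nondyadic :
  [/\ nondyadic s1, nondyadic t1, nondyadic (s1 + mu) & nondyadic (t1 - mu)].
Proof.
have k10 := hd_k hd; have w := hd_width hd; have lo := hd_lo hd; have hi := hd_hi hd.
have [p pE] := hd_exp_s hd; have [q qE] := hd_exp_t hd; have muE := exp2_mu k1 s1 t1.
rewrite -/mu in muE.
have nds : nondyadic s1.
  apply: (@nondyadic_eventually_fixed k1 _ j1 (2 * p + 1)) => //; first by lra.
  by rewrite pE intrD intrM; field.
have ndt : nondyadic t1.
  apply: (@nondyadic_eventually_fixed k1 _ j1 (2 * q)) => //; first by lra.
  by rewrite qE intrM; field.
split => //; apply: (@nondyadic_of_exp _ k1).
  rewrite mulrDr muE pE.
  have -> : s1 + 2^-1 + p%:~R + (t1 - s1) = t1 + (2 * p + 1)%:~R / 2.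
    by rewrite intrD intrM; field.
  exact: nondyadic_shift.
rewrite mulrBr muE qE.
have -> : t1 + q%:~R - (t1 - s1) = s1 + (2 * q)%:~R / 2 by rewrite intrM; field.
exact: nondyadic_shift.
Qed.

Lemma tune_initial (q : nat) : (q <= k1)%N ->
  (exists m, tune (2 ^+ q * s1) = N ^+ q * s2 + m%:~R /\
             tune (2 ^+ q * (s1 + mu)) = N ^+ q * tune (s1 + mu) + m%:~R) /\
  (forall r, (0 < r < k)%N -> exists n, be + n%:~R <= 2 ^+ (k * q + r) * s2 /\
             2 ^+ (k * q + r) * tune (s1 + mu) <= al + n%:~R).
Proof.
move=> qk; have [nds _ ndz _] := data_nondyadic; have [mu0 _] := hd_mu hd.
have lo := hd_lo hd; have hi := hd_hi hd; have lt := hd_lt hd.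
have [p pE] := hd_exp_s hd; have muE := exp2_mu k1 s1 t1; rewrite -/mu in mu0 muE.
have sz : s1 <= s1 + mu by lra.
(* At time [k1] the initial piece becomes the interval from [s1 + 1 / 2 + p] to [t1 + 1 / 2 + p], a
   lift of [I'], and this is the half cell containing it. *)
have h1 : (j1 + 1 + 2 * p)%:~R / 2 < 2 ^+ k1 * s1.
  by rewrite pE !intrD intrM; lra.
have h2 : 2 ^+ k1 * (s1 + mu) < (j1 + 1 + 2 * p)%:~R / 2 + 2^-1.
  by rewrite mulrDr muE pE !intrD intrM; lra.
split; first exact: tune_exp nds ndz sz qk h1 h2.
by move=> r rk; exact: tune_travel nds ndz sz qk h1 h2 rk.
Qed.

Lemma tune_terminal (q : nat) : (q <= k1)%N ->
  (exists m, tune (2 ^+ q * (t1 - mu)) = N ^+ q * tune (t1 - mu) + m%:~R /\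
             tune (2 ^+ q * t1) = N ^+ q * t2 + m%:~R) /\
  (forall r, (0 < r < k)%N -> exists n, be + n%:~R <= 2 ^+ (k * q + r) * tune (t1 - mu) /\
             2 ^+ (k * q + r) * t2 <= al + n%:~R).
Proof.
move=> qk; have [_ ndt _ ndw] := data_nondyadic; have [mu0 _] := hd_mu hd.
have lo := hd_lo hd; have hi := hd_hi hd; have lt := hd_lt hd.
have [p pE] := hd_exp_t hd; have muE := exp2_mu k1 s1 t1; rewrite -/mu in mu0 muE.
have wt : t1 - mu <= t1 by lra.
have h1 : (j1 + 2 * p)%:~R / 2 < 2 ^+ k1 * (t1 - mu).
  by rewrite mulrBr muE pE !intrD intrM; lra.
have h2 : 2 ^+ k1 * t1 < (j1 + 2 * p)%:~R / 2 + 2^-1.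
  by rewrite pE !intrD intrM; lra.
split; first exact: tune_exp ndw ndt wt qk h1 h2.
by move=> r rk; exact: tune_travel ndw ndt wt qk h1 h2 rk.
Qed.

(** At time [k1] the two ends of a piece become the two ends of an arc, up to a common shift; [tune]
    respects this, and dividing by [N ^+ k1] recovers the length of the tuned piece. *)
Lemma tune_ends : tune (s1 + mu) = s2 + mu2 /\ tune (t1 - mu) = t2 - mu2.
Proof.
have [nds ndt _ _] := data_nondyadic; have muE := exp2_mu k1 s1 t1; rewrite -/mu in muE.
have [p pE] := hd_exp_s hd; have [q qE] := hd_exp_t hd.
have [[m [m1 m2]] _] := tune_initial (leqnn k1).
have [[m' [m1' m2']] _] := tune_terminal (leqnn k1).
have NE : N ^+ k1 = 2 ^+ (k * k1) by rewrite exprM.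
have N0 : N ^+ k1 != 0 by rewrite NE gt_eqF// exp2_gt0.
have ndu : nondyadic (s1 + 2^-1) by have := @nondyadic_shift s1 1 nds; rewrite div1r.
have ndv : nondyadic (t1 + 2^-1) by have := @nondyadic_shift t1 1 ndt; rewrite div1r.
rewrite pE tune_int// tune_half// -/s2 in m1.
move: m2; rewrite mulrDr pE muE.
have -> : s1 + 2^-1 + p%:~R + (t1 - s1) = t1 + 2^-1 + p%:~R by ring.
rewrite tune_int// tune_half// -/t2 => m2.
rewrite qE tune_int// -/t2 in m2'.
move: m1'; rewrite mulrBr qE muE.
have -> : t1 + q%:~R - (t1 - s1) = s1 + q%:~R by ring.
rewrite tune_int// -/s2 => m1'.
split; apply: (mulfI N0); rewrite /mu2 -NE.
  by rewrite mulrDr [N ^+ k1 * (_ / _)]mulrC divfK//; lra.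
by rewrite mulrBr [N ^+ k1 * (_ / _)]mulrC divfK//; lra.
Qed.

(** At times that are multiples of [k] the travel inequalities are the images of the old ones under
    the monotone [tune]. At other times the tuned pieces lie in the closed arc from [be] to [al],
    which is inside a main hole since [s2] and [t2] lie strictly between [al + j1 / 2] and
    [be + 1 / 2 + j1 / 2]. *)
Lemma tuned_data : horseshoe_data (k * k1) (j1 + 1) s2 t2.
Proof.
have [nds ndt ndz ndw] := data_nondyadic; have [zE wE] := tune_ends.
have lo := hd_lo hd; have hi := hd_hi hd; have lt := hd_lt hd.
have [b1 a1 _ _] := cd'.
have sm := @tune_mem s1 j1 ltac:(lra); have tm := @tune_mem t1 j1 ltac:(lra).
rewrite -/s2 in sm; rewrite -/t2 in tm.
split.
- exact: tune_lt.
- by rewrite intrD; lra.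
- by rewrite intrD; lra.
- exact: tune_period (hd_per_t hd) ndt.
- rewrite /s2 -tune_half//; apply: tune_period (hd_per_s hd) _.
  by have := @nondyadic_shift s1 1 nds; rewrite div1r.
move=> i /andP[i0 ik]; have [q [r [iE rk qk]]] := divn_split k0 ik.
rewrite -/mu2 -zE -wE.
have [[m [m1 m2]] ini] := tune_initial (ltnW qk).
have [[m' [m1' m2']] ter] := tune_terminal (ltnW qk).
have [r0|r0] := posnP r.
  have q0 : (0 < q < k1)%N.
    by rewrite qk andbT lt0n; apply: contraTneq i0 => q0; rewrite iE q0 r0 muln0.
  have [n [p [h1 h2 h3 h4]]] := hd_travel hd q0.
  move: h2 h3; rewrite -/mu => h2 h3.
  have ndu : nondyadic (s1 + 2^-1) by have := @nondyadic_shift s1 1 nds; rewrite div1r.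
  have hole_s : tune (s1 + n%:~R / 2 + 2^-1) = s2 + n%:~R / 2 + 2^-1.
    by rewrite addrAC tune_shift// tune_half// -/s2 addrAC.
  have hole_t : tune (t1 + n%:~R / 2) = t2 + n%:~R / 2 by rewrite tune_shift.
  have ndn : nondyadic (s1 + n%:~R / 2 + 2^-1).
    by rewrite addrAC; exact: nondyadic_shift.
  have ndn' : nondyadic (t1 + n%:~R / 2) by exact: nondyadic_shift.
  move: h1 h2 h3 h4 => /tune_le h1 /tune_le h2 /tune_le h3 /tune_le h4.
  rewrite hole_t m1 in h1; rewrite hole_s m2 in h2.
  rewrite tune_int// hole_t m1' in h3; rewrite tune_int// hole_s m2' in h4.
  rewrite iE r0 addn0 exprM -/N.
  exists (n - 2 * m), (p - m' + m); rewrite [(p - m' + m)%:~R]intrD !intrB intrM.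
  by split; lra.
have rk' : (0 < r < k)%N by rewrite r0.
have [n [h1 h2]] := ini r rk'; have [n' [h3 h4]] := ter r rk'.
rewrite iE; exists (2 * n - (j1 + 1)), (n' - n); rewrite !intrB intrM intrD.
by split; lra.
Qed.

Lemma phi_iter (x : circle R) (i : nat) : K x -> phi (iter (k * i) doubling x) = iter i doubling (phi x).
Proof.
move=> Kx; elim: i => [|i IH]; first by rewrite muln0.
rewrite mulnS iterD phi_conj ?IH//.
move=> l; rewrite -iterD -mulnDr; exact: Kx.
Qed.

Lemma tuned_escape (x : circle R) : K x ->
  ~ survivors k1 (end_pieces k1 s1 t1) (phi x) -> ~ hole_points s1 t1 (phi x) ->
  ~ survivors (k * k1) (end_pieces (k * k1) s2 t2) x /\ ~ hole_points s2 t2 x.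
Proof.
have [nds ndt ndz ndw] := data_nondyadic; have [zE wE] := tune_ends.
move=> Kx nsurv nhole; split.
  move=> surv; apply: nsurv => i; rewrite -phi_iter//.
  have := surv i; rewrite mulnA => -[u [n [uE hu]]].
  rewrite uE -Fphi; exists (F (u + n%:~R / 2) - n%:~R / 2), n.
  split; first by rewrite subrK.
  rewrite -/mu2 -zE -wE in hu; rewrite -/mu.
  have end_F v : nondyadic v -> F (tune v + n%:~R / 2) = v + n%:~R / 2.
    by move=> nd; rewrite -tune_shift// (proj2 (tuneP _)).
  case: hu => /andP[hu1 hu2]; [left|right].
    have : F (tune s1 + n%:~R / 2) <= F (u + n%:~R / 2) by apply: F_homo; rewrite lerD2r.
    have : F (u + n%:~R / 2) <= F (tune (s1 + mu) + n%:~R / 2).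
      by apply: F_homo; rewrite lerD2r.
    by rewrite !end_F//; lra.
  have : F (tune (t1 - mu) + n%:~R / 2) <= F (u + n%:~R / 2).
    by apply: F_homo; rewrite lerD2r.
  have : F (u + n%:~R / 2) <= F (tune t1 + n%:~R / 2) by apply: F_homo; rewrite lerD2r.
  by rewrite !end_F//; lra.
move=> [u [n [uE /andP[hu1 hu2]]]].
have ndu : nondyadic (s1 + 2^-1) by have := @nondyadic_shift s1 1 nds; rewrite div1r.
have f1 : t1 + n%:~R / 2 <= F (u + n%:~R / 2).
  by rewrite -(proj2 (tuneP (t1 + _))) tune_shift//; apply: F_homo; rewrite lerD2r ltW.
have f2 : F (u + n%:~R / 2) <= s1 + 2^-1 + n%:~R / 2.
  rewrite -(proj2 (tuneP (s1 + _ + _))) tune_shift// tune_half//.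
  by apply: F_homo; rewrite lerD2r ltW.
(* [F] is only weakly monotone, so so far the point is known to land in the closed hole; the ends of
   that hole are survivors, excluded by [nsurv]. *)
have [e1|e1] := eqVneq (F (u + n%:~R / 2)) (t1 + n%:~R / 2).
  by apply: nsurv; rewrite uE -Fphi e1; apply: (data_survivors hd); right.
have [e2|e2] := eqVneq (F (u + n%:~R / 2)) (s1 + 2^-1 + n%:~R / 2).
  apply: nsurv; rewrite uE -Fphi e2.
  have -> : s1 + 2^-1 + n%:~R / 2 = s1 + (n + 1)%:~R / 2 by rewrite intrD; field.
  by apply: (data_survivors hd); left.
apply: nhole; exists (F (u + n%:~R / 2) - n%:~R / 2), n.
rewrite uE subrK Fphi; split => //.
have {}f1 : t1 + n%:~R / 2 < F (u + n%:~R / 2) by rewrite lt_neqAle eq_sym e1.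
have {}f2 : F (u + n%:~R / 2) < s1 + 2^-1 + n%:~R / 2 by rewrite lt_neqAle e2.
lra.
Qed.

End TunedData.

End Pruning.
End Tuning.

(** * Induction on the depth *)

Section Depth.
Context {R : realType}.
Implicit Types (theta x : circle R) (k m : nat) (j n : int).

Lemma canonic_horseshoe_data k (al be : R) : canonic_data k al be ->
  horseshoe_data k 0 (al - 2^-1) be.
Proof.
move=> cd; have b1 := cd_be cd; have a1 := cd_al cd; have len := cd_len cd.
have k0 : (0 < k)%N by case: (cd_per_al cd).
have N0 := exp2_gt0 (R:=R) k.
have l1 : 2^-1 < be + 1 - al.
  rewrite -subr_gt0 -(pmulr_rgt0 _ N0) mulrBr len addrAC subrr add0r; lra.
split; rewrite ?mul0r; try lra.
- exact: cd_per_be cd.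
- by rewrite subrK; exact: cd_per_al cd.
move=> i ik; have [n [h1 h2]] := cd_travel cd ik.
have [p pE] := exp2_half (R:=R) (proj1 (andP ik)).
have i0 := exp2_gt0 (R:=R) i.
have mu0 : 0 < (be - (al - 2^-1)) / 2 ^+ k by rewrite divr_gt0//; lra.
have mu1 : (be - (al - 2^-1)) / 2 ^+ k <= be - (al - 2^-1).
  rewrite ler_pdivrMr// ler_peMr//; first by lra.
  by apply: exprn_ege1; rewrite ler1n.
(* [cd_travel] starts at [al]; passing to [s = al - 1 / 2] subtracts [2 ^+ i / 2 = p]. The second
   index is 0 because the whole arc goes into one hole, not just its end pieces. *)
exists (2 * (n - p)), 0; rewrite !intrM !intrB -pE.
have e1 : 2 ^+ i * (al - 2^-1) <= 2 ^+ i * (be - (be - (al - 2^-1)) / 2 ^+ k).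
  by rewrite ler_pM2l//; lra.
have e2 : 2 ^+ i * (al - 2^-1 + (be - (al - 2^-1)) / 2 ^+ k) <= 2 ^+ i * be.
  by rewrite ler_pM2l//; lra.
split.
- rewrite [2 ^+ i * (_ - _)]mulrBr; lra.
- by apply: (le_trans e2); move: h2; rewrite mulrDr; lra.
- by apply: le_trans e1; rewrite [leRHS]mulrBr; lra.
- move: h2; rewrite mulrDr; lra.
Qed.

Lemma half_add_half (t : R) n :
  to_circle (t + n%:~R / 2 + 2^-1) = to_circle (t + (n + 1)%:~R / 2).
Proof. by congr to_circle; rewrite intrD; field. Qed.

Lemma opposite_opposite x : opposite (opposite x) = x.
Proof.
have [t ->] := to_circle_surj x; rewrite !opposite_to_circle.
by apply/to_circle_eqP; exists 1; lra.
Qed.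

Lemma hole_points_opposite (s t : R) x :
  hole_points s t x -> hole_points s t (opposite x).
Proof.
move=> [u [n [-> h]]]; exists u, (n + 1); split => //.
by rewrite opposite_to_circle half_add_half.
Qed.

Lemma survivors_opposite k (A : set (circle R)) x : (0 < k)%N ->
  (forall y, A y -> A (opposite y)) ->
  survivors k A x -> survivors k A (opposite x).
Proof.
move=> k0 Aopp Ax [|i]; first by have := Ax 0; rewrite !muln0 /=; exact: Aopp.
have [t xE] := to_circle_surj x.
have [p pE] : exists p : int, 2 ^+ (k * i.+1) / 2 = p%:~R :> R.
  by apply: exp2_half; rewrite muln_gt0 k0.
have := Ax i.+1; rewrite xE opposite_to_circle !iter_doubling mulrDr pE.
by rewrite to_circleDint.
Qed.

Lemma end_pieces_opposite k (s t : R) x :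
  end_pieces k s t x -> end_pieces k s t (opposite x).
Proof.
move=> [u [n [-> h]]]; exists u, (n + 1); split => //.
by rewrite opposite_to_circle half_add_half.
Qed.

Definition escapes theta k (s t : R) :=
  ~ survivors k (end_pieces k s t) theta /\ ~ hole_points s t theta.

Lemma escapes_opposite theta k (s t : R) : (0 < k)%N ->
  escapes theta k s t -> escapes (opposite theta) k s t.
Proof.
move=> k0 [nsurv nhole]; split=> [h|/hole_points_opposite].
  apply: nsurv; rewrite -(opposite_opposite theta).
  by apply: survivors_opposite => // y; exact: end_pieces_opposite.
by rewrite opposite_opposite.
Qed.

Lemma basic_non_rotational_escapes theta : basic_non_rotational theta ->
  exists k j s t, horseshoe_data k j s t /\ escapes theta k s t.
Proof.
move=> [A [k [a [b [canon disj]]]]].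
have [al [be [cd aE bE thetaE]]] := canonic_arcs_data canon.
have hd := canonic_horseshoe_data cd.
exists k, 0, (al - 2^-1), be; split => //; split.
  move=> surv; suff : (diameter theta `&` canonic_horseshoe k a b) theta.
    by rewrite disj.
  split; first by left.
  move=> i; have [u [n [-> hu]]] := surv i.
  have [mu0 mu1] := hd_mu hd.
  apply/(arc_pairE cd aE bE); exists (u + 2^-1), (n - 1); split.
    by congr to_circle; rewrite intrB; field.
  by case: hu; lra.
have b1 := cd_be cd; have a1 := cd_al cd.
move=> [u [n [+ hu]]]; rewrite -{1}(angleK theta) => /to_circle_eqP[p pE].
have [n0|n0] : (n + 2 * p <= -1 \/ 0 <= n + 2 * p)%R by lia.
  have : ((n + 2 * p)%:~R : R) <= (-1)%:~R by rewrite ler_int.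
  rewrite intrD intrM intrN; lra.
have : (0%:~R : R) <= (n + 2 * p)%:~R by rewrite ler_int.
rewrite intrD intrM; lra.
Qed.

Lemma canonic_horseshoe_opposite k (a b : circle R) x : (0 < k)%N ->
  canonic_horseshoe k a b x -> canonic_horseshoe k a b (opposite x).
Proof.
move=> k0; apply: survivors_opposite => // y.
have [s aE] := to_circle_surj a; have [t bE] := to_circle_surj b.
have cc (u v : circle R) : ccw (opposite u) (opposite v) = ccw u v.
  exact: ccw_add.
rewrite /arc_pair /closed_arc /= => -[h|h]; [right|left]; rewrite /= !cc in h *.
  exact: h.
by rewrite -{1}(opposite_opposite a) cc.
Qed.

(** The canonic horseshoe is symmetric under the half turn, so a diameter that is not basic
    non-rotational has both ends in it; there the conjugacy of [phi] with doubling is available. *)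
Lemma renormalization_escapes theta theta1 :
  ~ basic_non_rotational theta -> rotational_renormalization theta theta1 ->
  (exists k j s t, horseshoe_data k j s t /\ escapes theta1 k s t) ->
  exists k j s t, horseshoe_data k j s t /\ escapes theta k s t.
Proof.
move=> nbasic [A [k [a [b [phi [canon pruning _ diam]]]]]] [k1 [j1 [s1 [t1 [hd esc]]]]].
have [al [be [cd aE bE _]]] := canonic_arcs_data canon.
have k0 : (0 < k)%N by case: (cd_per_al cd).
have Ktheta : canonic_horseshoe k a b theta.
  apply: contrapT => nK; apply: nbasic; exists A, k, a, b; split => //.
  apply/seteqP; split => // x [[->//|/= ->] Kx]; apply: nK.
  by rewrite -(opposite_opposite theta); exact: canonic_horseshoe_opposite.
have [nsurv nhole] : escapes (phi theta) k1 s1 t1.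
  have : (diameter theta1) (phi theta) by rewrite diam; left.
  by case=> /= ->//; apply: escapes_opposite => //; exact: hd_k hd.
have [[F0 [_ F0homo F01 F0phi]] _ onto conj [phib phia' phia phib']] := pruning.
have /to_circle_eqP[c cE] : to_circle (F0 al) = to_circle 0.
  by rewrite F0phi -aE phia' to_circle0.
rewrite add0r in cE; pose F t := F0 t - c%:~R.
have Fhomo : {homo F : s t / s <= t} by move=> s t /F0homo; rewrite lerD2r.
have F1 t : F (t + 1) = F t + 1 by rewrite /F F01 addrAC.
have Fphi t : to_circle (F t) = phi (to_circle t).
  by rewrite -F0phi /F -intrN to_circleDint.
have Fal : F al = 0 by rewrite /F cE subrr.
exists (k * k1)%N, (j1 + 1), (tune k a b F s1), (tune k a b F t1); split.
  exact: (tuned_data cd aE bE Fhomo F1 Fphi onto conj phib phia phib' Fal hd).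
exact: (tuned_escape cd aE bE Fhomo F1 Fphi onto conj phib phia phib' Fal hd Ktheta).
Qed.

Lemma depth_escapes theta m : rotational_depth m theta ->
  exists k j s t, horseshoe_data k j s t /\ escapes theta k s t.
Proof.
elim=> {m theta} [theta|m theta theta1 _ _ nbasic renorm _].
  exact: basic_non_rotational_escapes.
exact: renormalization_escapes.
Qed.

Lemma escapes_horseshoe theta k j (s t : R) :
  horseshoe_data k j s t -> escapes theta k s t ->
  generates_traveling_horseshoe k (to_circle s) (to_circle t) /\
  ~ (horseshoe k (to_circle s) (to_circle t) `|`
     main_holes (to_circle s) (to_circle t)) theta.
Proof.
move=> hd [nsurv nhole]; split.
  by split; [exact: data_arcs hd|exact: data_traveling hd].
by case=> [/(horseshoe_sub hd)|/(main_holes_sub hd)].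
Qed.

End Depth.

(** * Planar tree pseudometrics *)

Section Pseudometrics.
Context {R : realType}.
Implicit Types (x y z u v w : R) (d e : R -> R -> R) (n m : int).

(* Pseudometrics of planar trees: [pm_cross] says that among the three ways of
   pairing four cyclically ordered points, the crossing one is the longest. *)
Record pmetric d : Prop := Pmetric {
  pm_per : forall x y, d (x + 1) y = d x y;
  pm_sym : forall x y, d x y = d y x;
  pm_refl : forall x, d x x = 0;
  pm_tri : forall x y z, d x z <= d x y + d y z;
  pm_cross : forall v1 v2 v3 v4, v1 <= v2 -> v2 <= v3 -> v3 <= v4 -> v4 <= v1 + 1 ->
    d v1 v2 + d v3 v4 <= d v1 v3 + d v2 v4 /\
    d v2 v3 + d v1 v4 <= d v1 v3 + d v2 v4 }.

Lemma pm_ge0 d : pmetric d -> forall x y, 0 <= d x y.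
Proof.
move=> pd x y; have := pm_tri pd x y x.
by rewrite (pm_refl pd) (pm_sym pd y x); lra.
Qed.

Lemma periodic_int (f : R -> R) : (forall t, f (t + 1) = f t) ->
  forall t n, f (t + n%:~R) = f t.
Proof.
move=> f1; have nat_case t (i : nat) : f (t + i%:R) = f t.
  elim: i => [|i IH]; first by rewrite addr0.
  by rewrite -natr1 addrA f1.
move=> t [i|i]; first exact: nat_case.
have := nat_case (t + (Negz i)%:~R) i.+1.
by rewrite NegzE mulrNz -pmulrn subrK.
Qed.

Lemma pm_int d : pmetric d -> forall x y n m, d (x + n%:~R) (y + m%:~R) = d x y.
Proof.
move=> pd x y n m.
have dl u v p : d (u + p%:~R) v = d u v.
  by apply: (@periodic_int (d ^~ v)) => t; exact: pm_per.
by rewrite dl (pm_sym pd) dl (pm_sym pd).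
Qed.

Lemma pm_circle d : pmetric d -> forall x x' y y',
  to_circle x = to_circle x' -> to_circle y = to_circle y' -> d x y = d x' y'.
Proof.
by move=> pd x x' y y' /to_circle_eqP[n ->] /to_circle_eqP[m ->]; exact: pm_int.
Qed.

(** A cyclic rotation of the four points exchanges the two non-crossing pairings and fixes the
    crossing one, so a quadruple straddling the end of the window can be rotated into it. *)
Lemma cross_window (c : R) d : (forall x y, d (x + 1) y = d x y) ->
  (forall x y, d x y = d y x) ->
  (forall v1 v2 v3 v4, c <= v1 -> v1 <= v2 -> v2 <= v3 -> v3 <= v4 -> v4 < c + 1 ->
    d v1 v2 + d v3 v4 <= d v1 v3 + d v2 v4 /\
    d v2 v3 + d v1 v4 <= d v1 v3 + d v2 v4) ->
  forall v1 v2 v3 v4, v1 <= v2 -> v2 <= v3 -> v3 <= v4 -> v4 <= v1 + 1 ->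
    d v1 v2 + d v3 v4 <= d v1 v3 + d v2 v4 /\
    d v2 v3 + d v1 v4 <= d v1 v3 + d v2 v4.
Proof.
move=> per sym win.
have rot u v : d (u - 1) v = d u v by rewrite -(per (u - 1)) subrK.
have rotr u v : d u (v - 1) = d u v by rewrite sym rot sym.
have shifted v1 v2 v3 v4 : c <= v1 < c + 1 ->
    v1 <= v2 -> v2 <= v3 -> v3 <= v4 -> v4 <= v1 + 1 ->
    d v1 v2 + d v3 v4 <= d v1 v3 + d v2 v4 /\
    d v2 v3 + d v1 v4 <= d v1 v3 + d v2 v4.
  move=> c1 h12 h23 h34 h41.
  have [l4|l4] := ltP v4 (c + 1); first by apply: win => //; lra.
  have s12 := sym v1 v2; have s13 := sym v1 v3; have s14 := sym v1 v4.
  have s23 := sym v2 v3; have s24 := sym v2 v4; have s34 := sym v3 v4.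
  have [l3|l3] := ltP v3 (c + 1).
    by have := win (v4 - 1) v1 v2 v3; rewrite ?rot ?rotr; case; lra.
  have [l2|l2] := ltP v2 (c + 1).
    by have := win (v3 - 1) (v4 - 1) v1 v2; rewrite ?rot ?rotr; case; lra.
  by have := win (v2 - 1) (v3 - 1) (v4 - 1) v1; rewrite ?rot ?rotr; case; lra.
move=> v1 v2 v3 v4 h12 h23 h34 h41.
pose q := - Num.floor (v1 - c).
have cq : c <= v1 + q%:~R < c + 1.
  have /andP[] := floor_itv (v1 - c); rewrite intrD1 /q intrN; lra.
have dq u v : d (u + q%:~R) (v + q%:~R) = d u v.
  have dl u' v' : d (u' + q%:~R) v' = d u' v'.
    by apply: (@periodic_int (d ^~ v')) => t; exact: per.
  by rewrite dl sym dl sym.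
have := @shifted (v1 + q%:~R) (v2 + q%:~R) (v3 + q%:~R) (v4 + q%:~R) cq.
rewrite !lerD2r !dq; apply => //; lra.
Qed.

(** The metric of a star with one leg of length 1/2 for each point of the circle. Up to a factor it
    dominates every bounded pseudometric, which gives submultiplicativity later. *)
Definition disc x y : R := (to_circle x != to_circle y)%:R.

Lemma pmetric_disc : pmetric disc.
Proof.
have per x y : disc (x + 1) y = disc x y by rewrite /disc (to_circleDint x 1).
have sym x y : disc x y = disc y x by rewrite /disc eq_sym.
split=> //.
- by move=> x; rewrite /disc eqxx.
- move=> x y z; rewrite /disc.
  have [<-|_] := eqVneq (to_circle x) (to_circle y); first by rewrite add0r.
  by case: (_ != _); case: (_ != _); rewrite /=; lra.
apply: (@cross_window 0) => // v1 v2 v3 v4 h1 h12 h23 h34 h4.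
have win u v : 0 <= u -> u <= v -> v < 0 + 1 -> disc u v = (u != v)%:R.
  move=> u0 uv v1'; rewrite /disc; congr (_%:R); congr (nat_of_bool (~~ _)).
  apply/eqP/eqP => [/to_circle_eqP[n nE]|->//].
  by rewrite nE (@int_lt1 R n) ?addr0//; lra.
rewrite !win; try lra.
have [<-|e2] := eqVneq v2 v3.
  split; first by rewrite lexx.
  have [->|_] := eqVneq v1 v2; first by rewrite lexx.
  by case: (v1 != v4); case: (v2 != v4) => /=; lra.
have lt23 : v2 < v3 by rewrite lt_neqAle e2.
have -> : v1 != v3 by rewrite lt_eqF//; lra.
have -> : v2 != v4 by rewrite lt_eqF//; lra.
by case: (v1 != v2); case: (v3 != v4); case: (v1 != v4) => /=; lra.
Qed.

(** * The folding operator *)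

Section Fold.
Context (th : R).

(* [side x] tells on which side of the diameter through [th] the point of
   angle [x] lies; the two ends of the diameter are split between the sides. *)
Definition side x : bool := x - th - (Num.floor (x - th))%:~R < 2^-1.

Lemma side_true x n : th + n%:~R <= x < th + n%:~R + 2^-1 -> side x = true.
Proof.
move=> h; rewrite /side; have /andP[] := floor_itv (x - th).
rewrite intrD1 => h1 h2.
by rewrite (@int_between R n (Num.floor (x - th))); lra.
Qed.

Lemma side_false x n : th + n%:~R + 2^-1 <= x < th + n%:~R + 1 -> side x = false.
Proof.
move=> h; rewrite /side; have /andP[] := floor_itv (x - th).
rewrite intrD1 => h1 h2; apply/negbTE; rewrite -leNgt.
by rewrite (@int_between R n (Num.floor (x - th))); lra.
Qed.

Lemma side_int x n : side (x + n%:~R) = side x.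
Proof.
have /andP[] := floor_itv (x - th); rewrite intrD1.
set q := Num.floor _ => h1 h2.
have [l|l] := ltP (x - th - q%:~R) 2^-1.
  rewrite (@side_true x q); last by lra.
  by rewrite (@side_true _ (q + n)) ?intrD//; lra.
rewrite (@side_false x q); last by lra.
by rewrite (@side_false _ (q + n)) ?intrD//; lra.
Qed.

Lemma side_half x : side (x + 2^-1) = ~~ side x.
Proof.
have /andP[] := floor_itv (x - th); rewrite intrD1.
set q := Num.floor _ => h1 h2.
have [l|l] := ltP (x - th - q%:~R) 2^-1.
  rewrite (@side_true x q); last by lra.
  by rewrite (@side_false _ q)//; lra.
rewrite (@side_false x q); last by lra.
by rewrite (@side_true _ (q + 1)) ?intrD//; lra.
Qed.

Lemma side_cell x y n m : th + n%:~R / 2 <= x < th + n%:~R / 2 + 2^-1 ->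
  th + n%:~R / 2 <= y + m%:~R < th + n%:~R / 2 + 2^-1 -> side x = side y.
Proof.
rewrite -(side_int y m); move: (y + _) => {}y.
have [q [->|->]] := int_parity (R:=R) n => hx hy.
  by rewrite (@side_true x q) ?(@side_true y q)//; lra.
by rewrite (@side_false x q) ?(@side_false y q)//; lra.
Qed.

Lemma side_circle x y : to_circle x = to_circle y -> side x = side y.
Proof. by move=> /to_circle_eqP[n ->]; rewrite side_int. Qed.

Definition cut x y : R := (side x != side y)%:R.

(* The length of the image under doubling of the path from [x] to [y] in a tree
   where both ends of the diameter through [th] are one and the same point. *)
Definition fold_step d x y : R :=
  if side x == side y then d (2 * x) (2 * y)
  else d (2 * x) (2 * th) + d (2 * th) (2 * y).

Lemma window_side x : th <= x < th + 1 -> side x = (x < th + 2^-1).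
Proof.
have [l|l] := ltP x (th + 2^-1) => h.
  by rewrite (@side_true x 0)//; lra.
by rewrite (@side_false x 0)//; lra.
Qed.

Lemma pmetric_cut : pmetric cut.
Proof.
have per x y : cut (x + 1) y = cut x y by rewrite /cut (side_int x 1).
have sym x y : cut x y = cut y x by rewrite /cut eq_sym.
split=> //.
- by move=> x; rewrite /cut eqxx.
- by move=> x y z; rewrite /cut; case: (side x) (side y) (side z) => -[] [] /=; lra.
apply: (@cross_window th) => // v1 v2 v3 v4 h1 h12 h23 h34 h4.
rewrite /cut !window_side; try lra.
have [l1|l1] := ltP v1 (th + 2^-1); have [l2|l2] := ltP v2 (th + 2^-1);
  have [l3|l3] := ltP v3 (th + 2^-1); have [l4|l4] := ltP v4 (th + 2^-1) => /=; lra.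
Qed.

(** Doubling spreads each side of the diameter over one full turn based at [2 * th]. With three
    points on one side the fourth is replaced by [2 * th], suitably lifted, and the old inequality
    applies; with two on each side the triangle inequality suffices. *)
Lemma pmetric_fold d : pmetric d -> pmetric (fold_step d).
Proof.
move=> pd; have sy := pm_sym pd.
have per x y : fold_step d (x + 1) y = fold_step d x y.
  rewrite /fold_step (side_int x 1) mulrDr mulr1.
  have e v : d (2 * x + 2) v = d (2 * x) v.
    by rewrite -[RHS](pm_int pd _ _ 2 0) addr0.
  by rewrite !e.
have sym x y : fold_step d x y = fold_step d y x.
  rewrite /fold_step eq_sym; case: ifP => _; first exact: sy.
  by rewrite addrC sy (sy _ (2 * x)).
split=> //.
- by move=> x; rewrite /fold_step eqxx (pm_refl pd).
- move=> x y z; rewrite /fold_step.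
  have tri := pm_tri pd.
  have t1 := tri (2 * x) (2 * y) (2 * z); have t2 := tri (2 * x) (2 * y) (2 * th).
  have t3 := tri (2 * th) (2 * y) (2 * z); have t4 := tri (2 * x) (2 * th) (2 * z).
  have := pm_ge0 pd (2 * y) (2 * th); have := sy (2 * y) (2 * th).
  by case: (side x) (side y) (side z) => -[] [] /=; lra.
apply: (@cross_window th) => // v1 v2 v3 v4 h1 h12 h23 h34 h4.
rewrite /fold_step !window_side; try lra.
have ce v : d (2 * th + 1) v = d (2 * th) v by exact: pm_per.
have tri := pm_tri pd.
have X := pm_cross pd.
have [l1|l1] := ltP v1 (th + 2^-1); have [l2|l2] := ltP v2 (th + 2^-1);
  have [l3|l3] := ltP v3 (th + 2^-1); have [l4|l4] := ltP v4 (th + 2^-1) => /=;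
  try (by exfalso; lra).
- by apply: X; lra.
- have [] := X (2 * v1) (2 * v2) (2 * v3) (2 * th + 1); try lra.
  by rewrite !(sy _ (2 * th + 1)) !ce !(sy _ (2 * th)); lra.
- have := tri (2 * v1) (2 * th) (2 * v2); have := tri (2 * v3) (2 * th) (2 * v4).
  by rewrite !(sy _ (2 * th)); lra.
- have [] := X (2 * th + 1) (2 * v2) (2 * v3) (2 * v4); try lra.
  by rewrite !ce; lra.
- by apply: X; lra.
Qed.

Lemma fold_le d e : (forall x y, d x y <= e x y) ->
  forall x y, fold_step d x y <= fold_step e x y.
Proof.
by move=> de x y; rewrite /fold_step; case: ifP => _; rewrite ?lerD.
Qed.

Lemma fold_ge d x y : pmetric d -> d (2 * x) (2 * y) <= fold_step d x y.
Proof.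
by move=> pd; rewrite /fold_step; case: ifP => _ //; exact: pm_tri.
Qed.

Lemma fold_center d x : pmetric d -> fold_step d x th = d (2 * x) (2 * th).
Proof.
by move=> pd; rewrite /fold_step (pm_refl pd) addr0; case: ifP.
Qed.

Lemma pmetric_iter_fold d (i : nat) : pmetric d -> pmetric (iter i fold_step d).
Proof. by move=> pd; elim: i => //= i; exact: pmetric_fold. Qed.

Lemma cut_disc x y : cut x y <= disc x y.
Proof.
rewrite /cut /disc; have [e|_] := eqVneq (to_circle x) (to_circle y).
  by rewrite (side_circle e) eqxx.
by case: (_ != _).
Qed.

Lemma iter_fold_le (i : nat) d e : (forall x y, d x y <= e x y) ->
  forall x y, iter i fold_step d x y <= iter i fold_step e x y.
Proof. by move=> de; elim: i => //= i; exact: fold_le. Qed.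

End Fold.
End Pseudometrics.

(** * Exponential growth *)

Section Growth.
Context {R : realType} (k : nat) (j : int) (s t : R) (hd : horseshoe_data k j s t).
Context (th : R) (th_lo : s < th) (th_hi : th < t).
Hypothesis th_esc : ~ survivors k (end_pieces k s t) (to_circle th).
Implicit Types (x y u v : R) (i l m n : nat).

Let mu := (t - s) / 2 ^+ k.
Let z := s + mu.
Let w := t - mu.
Let side := side th.
Let C m : R -> R -> R := iter m (fold_step th) (cut th).

Let facts : [/\ s < th < t, 0 < t - s < 2^-1, 0 < mu & 2 * mu <= t - s].
Proof. by have [] := hd_mu hd; split => //; [rewrite th_lo|exact: hd_width hd]. Qed.

Let pC m : pmetric (C m). Proof. exact/pmetric_iter_fold/pmetric_cut. Qed.

Lemma iter_fold_ge d l x y : pmetric d ->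
  d (2 ^+ l * x) (2 ^+ l * y) <= iter l (fold_step th) d x y.
Proof.
move=> pd; elim: l x y => [|l IH] x y; first by rewrite !mul1r.
rewrite iterS !exprSr -!mulrA; apply: le_trans (IH _ _) _.
by apply: fold_ge; exact: pmetric_iter_fold.
Qed.

Definition same_sides x y := forall i, side (2 ^+ i * x) = side (2 ^+ i * y).

Lemma cut_same m x y : same_sides x y -> C m x y = 0.
Proof.
elim: m x y => [|m IH] x y xy.
  by have := xy 0; rewrite !mul1r /C /= /cut /side => ->; rewrite eqxx.
rewrite /C iterS /fold_step; have := xy 0; rewrite !mul1r => e.
rewrite -/side e eqxx; apply: IH => i; have := xy i.+1.
by rewrite exprSr -!mulrA.
Qed.

Lemma exp2_congr i x y : to_circle x = to_circle y ->
  to_circle (2 ^+ i * x) = to_circle (2 ^+ i * y).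
Proof. by move=> e; rewrite -!iter_doubling e. Qed.

Lemma same_congr x x' y y' : to_circle x = to_circle x' -> to_circle y = to_circle y' ->
  same_sides x' y' -> same_sides x y.
Proof.
move=> ex ey xy i; rewrite /side (side_circle th (exp2_congr i ex)).
by rewrite (side_circle th (exp2_congr i ey)); exact: xy.
Qed.

Lemma same_double x y : side x = side y -> same_sides (2 * x) (2 * y) -> same_sides x y.
Proof.
move=> e xy [|i]; first by rewrite !mul1r.
by rewrite exprSr -!mulrA; exact: xy.
Qed.

Lemma circle_double_half x (e : R) : e = 2^-1 \/ e = - 2^-1 ->
  to_circle (2 * (x + e)) = to_circle (2 * x).
Proof.
by case=> ->; apply/to_circle_eqP; [exists 1|exists (-1)]; rewrite ?intrN; field.
Qed.

Lemma circle_exp_t n : to_circle (2 ^+ (k * n) * t) = to_circle t.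
Proof.
elim: n => [|n IH]; first by rewrite muln0 mul1r.
have [q qE] := hd_exp_t hd.
by rewrite mulnS exprD -mulrA (exp2_congr k IH) qE to_circleDint.
Qed.

Lemma circle_exp_s n : (0 < n)%N -> to_circle (2 ^+ (k * n) * s) = to_circle (s + 2^-1).
Proof.
have [p pE] := hd_exp_s hd; have [h hE] := exp2_half (R:=R) (hd_k hd).
case: n => // n _; elim: n => [|n IH]; first by rewrite muln1 pE to_circleDint.
rewrite mulnS exprD -mulrA (exp2_congr k IH) mulrDr hE pE.
by rewrite !to_circleDint.
Qed.

Lemma circle_exp_z : to_circle (2 ^+ k * z) = to_circle (t + 2^-1).
Proof.
have [p pE] := hd_exp_s hd; have muE := exp2_mu k s t; rewrite -/mu in muE.
by apply/to_circle_eqP; exists p; rewrite /z mulrDr muE pE; ring.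
Qed.

Lemma circle_exp_w : to_circle (2 ^+ k * w) = to_circle s.
Proof.
have [p pE] := hd_exp_t hd; have muE := exp2_mu k s t; rewrite -/mu in muE.
by apply/to_circle_eqP; exists p; rewrite /w mulrBr muE pE; ring.
Qed.

(** As [s < th < t], the closed hole from [t + n / 2] to [s + n / 2 + 1 / 2] lies strictly on one
    side of the diameter, and [hd_travel] puts the images of both pieces there modulo 1. *)
Lemma pieces_side i x y : (0 < i < k)%N ->
  s <= x <= z \/ w <= x <= t -> s <= y <= z \/ w <= y <= t ->
  side (2 ^+ i * x) = side (2 ^+ i * y).
Proof.
move=> ik; have [n [m]] := hd_travel hd ik; rewrite -/mu -/z -/w => -[h1 h2 h3 h4].
have i0 := exp2_gt0 (R:=R) i; have [thb w0 _ _] := facts.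
have cell u : s <= u <= z \/ w <= u <= t -> exists q : int,
    th + n%:~R / 2 <= 2 ^+ i * u + q%:~R < th + n%:~R / 2 + 2^-1.
  case=> /andP[u1 u2].
    exists 0; have : 2 ^+ i * s <= 2 ^+ i * u by rewrite ler_pM2l.
    have : 2 ^+ i * u <= 2 ^+ i * z by rewrite ler_pM2l.
    lra.
  exists (- m); rewrite intrN; have : 2 ^+ i * w <= 2 ^+ i * u by rewrite ler_pM2l.
  have : 2 ^+ i * u <= 2 ^+ i * t by rewrite ler_pM2l.
  lra.
move=> /cell[p hp] /cell[q hq]; rewrite -[LHS](side_int th _ p).
exact: side_cell hp hq.
Qed.

Lemma same_from_period x y : (forall i, (i < k)%N -> side (2 ^+ i * x) = side (2 ^+ i * y)) ->
  same_sides (2 ^+ k * x) (2 ^+ k * y) -> same_sides x y.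
Proof.
move=> low high i; have [/low//|ki] := ltnP i k.
by rewrite -(subnK ki) exprD -!mulrA; exact: high.
Qed.

Lemma ends_in_pieces : [/\ s <= s <= z \/ w <= s <= t, s <= z <= z \/ w <= z <= t,
  s <= w <= z \/ w <= w <= t & s <= t <= z \/ w <= t <= t].
Proof. by have [f1 f2 f3 f4] := facts; rewrite /z /w; split; [left|left|right|right]; lra. Qed.

(** Both points return after [k] doublings. At intermediate times the half turn disappears and
    [pieces_side] applies; at time 0 both are ends of one closed hole, which avoids the diameter. *)
Lemma same_t_s' : same_sides t (s + 2^-1).
Proof.
have [pin_s _ _ pin_t] := ends_in_pieces; have [thb w0 _ _] := facts.
have k0 := hd_k hd; move=> i; have [n] := ubnP i; elim: n i => // n IH i.
rewrite ltnS => ni; have [ik|ki] := ltnP i k; last first.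
  have [h hE] := exp2_half (R:=R) k0; have [p pE] := hd_exp_s hd.
  have et := circle_exp_t 1; rewrite !muln1 in et.
  have es' : to_circle (2 ^+ k * (s + 2^-1)) = to_circle (s + 2^-1).
    by rewrite mulrDr hE pE !to_circleDint.
  have iE := subnK ki; move: (i - k)%N iE => i' iE.
  rewrite -iE exprD -!mulrA /side (side_circle th (exp2_congr i' et)).
  rewrite (side_circle th (exp2_congr i' es')); apply: IH.
  by apply: leq_trans ni; rewrite -iE -addn1 leq_add2l.
have [->|i0] := posnP i.
  by rewrite !mul1r; apply: (@side_cell _ _ _ _ 0 0); lra.
have [h hE] := exp2_half (R:=R) i0.
rewrite [in RHS]mulrDr hE [RHS]side_int; apply: pieces_side => //; exact/andP.
Qed.

Lemma same_t'_s : same_sides (t + 2^-1) s.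
Proof.
apply: same_double.
  have := same_t_s' 0; rewrite !mul1r /side !side_half => ->.
  exact: negbK.
have h := circle_double_half t (or_introl erefl).
apply: (same_congr h (esym (circle_double_half s (or_introl erefl)))) => i.
by have := same_t_s' i.+1; rewrite exprSr -!mulrA.
Qed.

(** After [k] doublings [z] and [w] become [t + 1 / 2] and [s], which share an itinerary.
    Prescribing the doubles of [x] and [y] lets the statement cover opposite points as well. *)
Lemma same_z_w x y : to_circle (2 * x) = to_circle (2 * z) ->
  to_circle (2 * y) = to_circle (2 * w) -> side x = side y -> same_sides x y.
Proof.
move=> xz yw xy; have [_ pin_z pin_w _] := ends_in_pieces; have k0 := hd_k hd.
have double i : (0 < i)%N -> to_circle (2 ^+ i * x) = to_circle (2 ^+ i * z) /\
    to_circle (2 ^+ i * y) = to_circle (2 ^+ i * w).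
  case: i => // i _; rewrite exprSr -!mulrA.
  by split; exact: exp2_congr.
apply: same_from_period.
  move=> i ik; have [->|i0] := posnP i; first by rewrite !mul1r.
  have [ex ey] := double i i0; rewrite /side (side_circle th ex) (side_circle th ey).
  by apply: pieces_side => //; apply/andP.
have [ex ey] := double k k0.
rewrite circle_exp_z in ex; rewrite circle_exp_w in ey.
exact: same_congr ex ey same_t'_s.
Qed.

Let V m := C m s t.

(** [t] is glued to [s + 1 / 2] and [s] to [t + 1 / 2], so both right-hand distances are [V m] in
    disguise. *)
Lemma V_le m : V m <= C m (t + 2^-1) t /\ V m <= C m (t + 2^-1) (s + 2^-1).
Proof.
have e1 := cut_same m same_t_s'; have e2 := cut_same m same_t'_s.
have tri := pm_tri (pC m); have sy := pm_sym (pC m).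
have h1 := tri s (t + 2^-1) t; have h2 := tri (t + 2^-1) (s + 2^-1) t.
have := sy s (t + 2^-1); have := sy t (s + 2^-1); rewrite /V; lra.
Qed.

Lemma V_split m : (0 < m)%N -> V m = C m s th + C m th t.
Proof.
case: m => // m _; rewrite /V /C iterS.
have [thb w0 _ _] := facts.
have -> : fold_step th (iter m (fold_step th) (cut th)) s th = C m (2 * s) (2 * th).
  exact: (fold_center th _ (pC m)).
rewrite (pm_sym (pmetric_fold th (pC m)) th t).
have -> : fold_step th (iter m (fold_step th) (cut th)) t th = C m (2 * t) (2 * th).
  exact: (fold_center th _ (pC m)).
rewrite (pm_sym (pC m) (2 * t)) /fold_step.
rewrite (@side_true _ th t 0) ?addr0; last by lra.
rewrite (@side_false _ th s (-1)) ?intrN//; lra.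
Qed.

Lemma C_exp_ge l m x y x' y' :
  to_circle (2 ^+ l * x) = to_circle x' -> to_circle (2 ^+ l * y) = to_circle y' ->
  C m x' y' <= C (l + m) x y.
Proof.
move=> ex ey; rewrite -(pm_circle (pC m) ex ey) /C iterD; exact: (@iter_fold_ge (C m) l x y (pC m)).
Qed.

(** Here [w] is glued to [z + 1 / 2], and [z] to [w - 1 / 2]. The first pair cuts [th] from [t], the
    second cuts it from [s]: [pm_cross] bounds the distance from [th] to [t] below by that from [w]
    to [t], which becomes the distance from [s] to [t] after [k] doublings. *)
Lemma growth_middle m : z < th < w -> 2 * V m <= V (k + m).
Proof.
move=> zw; have k0 := hd_k hd; have [thb w0 mu0 mu2] := facts.
have [V1 V2] := V_le m.
have e1 : C (k + m) w (z + 2^-1) = 0.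
  rewrite (pm_sym (pC _)); apply: cut_same; apply: same_z_w => //.
    exact: circle_double_half (or_introl erefl).
  by apply: (@side_cell _ _ _ _ 0 0); move: zw; rewrite /z /w; lra.
have e2 : C (k + m) z (w - 2^-1) = 0.
  apply: cut_same; apply: same_z_w => //.
    exact: circle_double_half (or_intror erefl).
  by apply: (@side_cell _ _ _ _ (-1) 0); move: zw; rewrite /z /w intrN; lra.
have g1 : C m s t <= C (k + m) w t.
  by apply: C_exp_ge; [exact: circle_exp_w|have := circle_exp_t 1; rewrite muln1].
have g2 : C m (s + 2^-1) (t + 2^-1) <= C (k + m) s z.
  by apply: C_exp_ge; [have := @circle_exp_s 1 isT; rewrite muln1|exact: circle_exp_z].
have ge := pm_ge0 (pC (k + m)); have sy := pm_sym (pC (k + m)).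
rewrite (V_split (m := k + m)) ?addn_gt0 ?k0//.
have [] := @pm_cross _ _ (pC (k + m)) th w t (z + 2^-1).
1-4: move: zw; rewrite /z /w; lra.
have [] := @pm_cross _ _ (pC (k + m)) (w - 2^-1) s z th.
1-4: move: zw; rewrite /z /w; lra.
have := ge th (z + 2^-1); have := ge (w - 2^-1) th; have := ge th w.
have := sy z (w - 2^-1); have := pm_sym (pC m) (s + 2^-1) (t + 2^-1).
rewrite /V in V1 V2 *; lra.
Qed.

(** Now [z] and [w] are on one side of the diameter, hence glued, and up to a half turn the orbit of
    [th] falls between them at time [k * n]. The glued pair cuts this point from [t] and from
    [s + 1 / 2], the images of the ends, so both terms of [V_split] are at least [V m]. *)
Lemma growth_exit n m y v q : (0 < n)%N -> side z = side w ->
  y = 2 ^+ (k * n) * th -> z < v < w -> y = v + q%:~R / 2 ->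
  2 * V m <= V (k * n + (k + m)).
Proof.
move=> n0 zw yE vzw yv; have k0 := hd_k hd; have [thb w0 mu0 mu2] := facts.
have [V1 V2] := V_le m.
have kn0 : (0 < k * n + (k + m))%N by rewrite addn_gt0 muln_gt0 k0 n0.
rewrite (V_split kn0); set d := C (k + m).
have pd : pmetric d by exact: pC.
have g1 : d (s + 2^-1) y <= C (k * n + (k + m)) s th.
  by apply: C_exp_ge; rewrite ?yE//; exact: circle_exp_s.
have g2 : d y t <= C (k * n + (k + m)) th t.
  by apply: C_exp_ge; rewrite ?yE//; exact: circle_exp_t.
have et := circle_exp_t 1; have es := @circle_exp_s 1 isT; rewrite !muln1 in et es.
have [h hE] := exp2_half (R:=R) k0.
have es' : to_circle (2 ^+ k * (s + 2^-1)) = to_circle (s + 2^-1).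
  rewrite mulrDr hE; have [p pE] := hd_exp_s hd.
  by rewrite pE !to_circleDint.
have ez' : to_circle (2 ^+ k * (z + 2^-1)) = to_circle (t + 2^-1).
  by rewrite mulrDr hE to_circleDint circle_exp_z.
have ge := pm_ge0 pd; have sy := pm_sym pd.
have [p [qE|qE]] := int_parity (R:=R) q.
  have e : d z w = 0 by apply: cut_same; exact: same_z_w.
  have yvE : to_circle y = to_circle v.
    by rewrite yv; apply/to_circle_eqP; exists p; rewrite qE; field.
  rewrite (pm_circle pd erefl yvE) in g1; rewrite (pm_circle pd yvE erefl) in g2.
  have f1 : C m (t + 2^-1) t <= d z t by apply: C_exp_ge => //; exact: circle_exp_z.
  have f2 : C m (t + 2^-1) (s + 2^-1) <= d z (s + 2^-1).
    by apply: C_exp_ge => //; exact: circle_exp_z.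
  have [] := @pm_cross _ _ pd z v w t.
  1-4: move: vzw; rewrite /z /w; lra.
  have [] := @pm_cross _ _ pd z v w (s + 2^-1).
  1-4: move: vzw; rewrite /z /w; lra.
  by have := ge v w; have := sy v (s + 2^-1); lra.
have e : d (z + 2^-1) (w + 2^-1) = 0.
  apply: cut_same; apply: same_z_w.
  - exact: circle_double_half (or_introl erefl).
  - exact: circle_double_half (or_introl erefl).
  - by rewrite /side !side_half -/side zw.
have yvE : to_circle y = to_circle (v + 2^-1).
  by rewrite yv; apply/to_circle_eqP; exists p; rewrite qE; field.
rewrite (pm_circle pd erefl yvE) in g1; rewrite (pm_circle pd yvE erefl) in g2.
have f1 : C m (t + 2^-1) t <= d (z + 2^-1) t by apply: C_exp_ge.
have f2 : C m (t + 2^-1) (s + 2^-1) <= d (z + 2^-1) (s + 2^-1) by apply: C_exp_ge.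
have per x y' : d x (y' + 1) = d x y' by rewrite sy (pm_per pd) sy.
have [] := @pm_cross _ _ pd (z + 2^-1) (v + 2^-1) (w + 2^-1) (t + 1).
1-4: move: vzw; rewrite /z /w; lra.
have [] := @pm_cross _ _ pd (z + 2^-1) (v + 2^-1) (w + 2^-1) (s + 2^-1 + 1).
1-4: move: vzw; rewrite /z /w; lra.
rewrite !per.
by have := ge (v + 2^-1) (w + 2^-1); have := sy (v + 2^-1) (s + 2^-1); lra.
Qed.

Lemma first_exit : exists n,
  ~ end_pieces k s t (to_circle (2 ^+ (k * n) * th)) /\
  forall i, (i < n)%N -> end_pieces k s t (to_circle (2 ^+ (k * i) * th)).
Proof.
pose out n := `[< ~ end_pieces k s t (to_circle (2 ^+ (k * n) * th)) >].
have ex : exists n, out n.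
  apply: contrapT => none; apply: th_esc => i; rewrite iter_doubling.
  by apply: contrapT => hi; apply: none; exists i; exact/asboolP.
case: (ex_minnP ex) => n /asboolP outn nmin; exists n; split => // i ni.
by apply: contrapT => hi; have := nmin i (introT (asboolP _) hi); rewrite leqNgt ni.
Qed.

Lemma growth : exists2 l, (0 < l)%N & forall m, 2 * V m <= V (l + m).
Proof.
have k0 := hd_k hd; have [thb w0 mu0 mu2] := facts.
have [n [outn before]] := first_exit.
have pieceE u q : u = th + q%:~R / 2 -> s <= u <= z \/ w <= u <= t -> u = th.
  move=> uE hu; have h : - 2^-1 < q%:~R / 2 :> R /\ q%:~R / 2 < 2^-1 :> R.
    by move: hu; rewrite /z /w; case; lra.
  by rewrite uE (@int_lt1 R q) ?mul0r ?addr0//; lra.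
have [n0|n0] := posnP n.
  rewrite n0 muln0 mul1r in outn; exists k => // m; apply: growth_middle.
  apply/andP; split; rewrite ltNge; apply/negP => h; apply: outn;
    exists th, 0; rewrite mul0r addr0; (split; first by []); rewrite -/mu -/z -/w; [left|right]; lra.
have th_in : s <= th <= z \/ w <= th <= t.
  have := before 0 n0; rewrite muln0 mul1r => -[u [q [/to_circle_eqP[p pE] hu]]].
  rewrite -/mu -/z -/w in hu; rewrite -(pieceE u (- (q + 2 * p)) _ hu)//.
  by rewrite intrN intrD intrM pE; field.
have nE : (k * n = k + k * n.-1)%N by rewrite -mulnS prednK.
(* [w] goes to [s] after [k] doublings and then never leaves the pieces. A strict inequality is
   wanted because [side] counts [th] itself with the points just after it. *)
have th_w : th != w.
  apply/eqP => thE; apply: outn; rewrite nE addnC exprD -mulrA thE.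
  rewrite (exp2_congr _ circle_exp_w).
  have [->|n1] := posnP n.-1.
    by exists s, 0; rewrite muln0 mul1r mul0r addr0 -/mu; split => //; left; lra.
  rewrite circle_exp_s//; exists s, 1; rewrite div1r -/mu; split => //; left; lra.
have zw_side : side z = side w.
  case: th_in => /andP[h1 h2]; first by apply: (@side_cell _ _ _ _ 0 0); rewrite /z /w in h2 *; lra.
  have {}h1 : w < th by rewrite lt_neqAle eq_sym th_w.
  by apply: (@side_cell _ _ _ _ (-1) 0); rewrite ?intrN /z /w in h1 *; lra.
(* One period before the exit the orbit is in an end piece, of length [mu], which [k] doublings
   stretch onto a copy of the whole arc up to half turns. *)
have [v [q [yE vst]]] : exists v (q : int),
    2 ^+ (k * n) * th = v + q%:~R / 2 /\ s <= v <= t.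
  have lt_n : (n.-1 < n)%N by rewrite ltn_predL.
  have [u [q [/to_circle_eqP[c cE] hu]]] := before _ lt_n.
  have [p pE] := hd_exp_s hd; have [p' pE'] := hd_exp_t hd.
  have muE := exp2_mu k s t; have [l lE] := exp2_int (R:=R) k (q + 2 * c).
  have N0 := exp2_gt0 (R:=R) k; rewrite -/mu in muE hu.
  have yE : 2 ^+ (k * n) * th = 2 ^+ k * u + l%:~R / 2.
    by rewrite nE exprD -mulrA cE -lE intrD intrM; field.
  case: hu => /andP[u1 u2].
    exists (s + 2 ^+ k * (u - s)), (2 * p + 1 + l); split.
      by rewrite yE !intrD intrM mulrBr pE; field.
    have : 0 <= 2 ^+ k * (u - s) by rewrite pmulr_rge0//; lra.
    have : 2 ^+ k * (u - s) <= 2 ^+ k * mu by rewrite ler_pM2l//; lra.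
    by rewrite muE; lra.
  exists (s + 2 ^+ k * (u - (t - mu))), (2 * p' + l); split.
    by rewrite yE intrD intrM !mulrBr muE pE'; field.
  have : 0 <= 2 ^+ k * (u - (t - mu)) by rewrite pmulr_rge0//; lra.
  have : 2 ^+ k * (u - (t - mu)) <= 2 ^+ k * mu by rewrite ler_pM2l//; lra.
  by rewrite muE; lra.
have vzw : z < v < w.
  apply/andP; split; rewrite ltNge; apply/negP => h; apply: outn; rewrite yE;
    exists v, q; (split; first by []); rewrite -/mu -/z -/w; [left|right]; lra.
exists (k * n + k)%N; first by rewrite addn_gt0 k0 orbT.
by move=> m; rewrite -addnA; exact: growth_exit zw_side erefl vzw yE.
Qed.

Lemma growth_exp2 : exists2 l, (0 < l)%N & forall i,
  2 ^+ i <= iter (l * i) (fold_step th) (@disc R) s t.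
Proof.
have [l l0 lV] := growth; exists l => // i.
apply: le_trans (@iter_fold_le _ th (l * i) _ _ (cut_disc th) s t).
elim: i => [|i IH].
  have [thb w0 _ _] := facts; rewrite muln0 /= /cut.
  by rewrite (@side_true _ th t 0) ?(@side_false _ th s (-1)) ?intrN//; lra.
rewrite mulnS exprS; apply: le_trans (lV _).
by rewrite ler_pM2l.
Qed.

End Growth.

(** * The eigenmetric *)

Section Ultralimit.
Context {R : realType} {I : Type}.

(** A limit along a free ultrafilter, stated as the preservation of finite linear inequalities: the
    axioms of a pseudometric, the eigenvalue equation and the normalization all pass to the limit in
    this form. *)
Lemma bounded_ultralimit (f : nat -> I -> R) (K : R) :
  (forall n i, 0 <= f n i <= K) ->
  exists F : I -> R, forall (s : seq (R * I)) (c : R),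
    (forall e, 0 < e -> exists n0, forall n, (n0 <= n)%N ->
       \sum_(p <- s) p.1 * f n p.2 <= c + e) ->
    \sum_(p <- s) p.1 * F p.2 <= c.
Proof.
move=> fK; have [U [UU subU]] := ultraFilterLemma (@eventually_filter).
have lim i : exists p : R, forall e, 0 < e -> U [set n | `|f n i - p| < e].
  have co := @segment_compact R 0 K.
  have FU : ProperFilter (fmap (f^~ i) U) by exact: fmap_proper_filter.
  have [|p [_ cp]] := co (fmap (f^~ i) U) FU.
    apply: (@filterS _ U _ setT) => [n _|]; last exact: filterT.
    by rewrite /= in_itv /=; exact: fK.
  exists p => e e0.
  have [//|nU] := in_ultra_setVsetC [set n | `|f n i - p| < e] UU.
  have [x [/= hx hb]] : [set x | ~ (`|x - p| < e)] `&` ball p e !=set0.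
    by apply: cp; [exact: nU|exact: nbhsx_ballx].
  by exfalso; apply: hx; rewrite distrC; exact: hb.
have [F FP] : exists F : I -> R, forall i e, 0 < e -> U [set n | `|f n i - F i| < e].
  by have [F FP] := choice lim; exists F.
exists F => s c hs; apply/ler_addgt0Pr => e e0.
have sumU (t : seq (R * I)) (e' : R) : 0 < e' -> U [set n |
    \sum_(p <- t) p.1 * F p.2 <= \sum_(p <- t) p.1 * f n p.2 + e'].
  elim: t e' => [|p t IH] e' e'0.
    apply: (@filterS _ U _ setT) => [n _|]; last exact: filterT.
    by rewrite /= !big_nil add0r ltW.
  have a0 : 0 < `|p.1| + 1 by rewrite ltr_wpDl.
  have h1 := FP p.2 (e' / 2 / (`|p.1| + 1)).
  have h2 := IH (e' / 2).
  have {}h1 := h1 ltac:(by rewrite !divr_gt0).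
  have {}h2 := h2 ltac:(by rewrite divr_gt0).
  apply: filterS (filterI h1 h2) => n [/= k1 k2]; rewrite !big_cons.
  have : p.1 * F p.2 <= p.1 * f n p.2 + e' / 2.
    rewrite -lerBlDl -mulrBr; apply: le_trans (ler_norm _) _; rewrite normrM distrC.
    apply: le_trans (_ : (`|p.1| + 1) * (e' / 2 / (`|p.1| + 1)) <= _).
      by apply: ler_pM => //; [rewrite lerDl|exact: ltW].
    by rewrite mulrC divfK// gt_eqF.
  lra.
have [n0 hn0] := hs (e / 2) ltac:(by rewrite divr_gt0).
have Un : U [set n | (n0 <= n)%N] by apply: subU; exists n0.
have Usn : U ([set n | \sum_(p <- s) p.1 * F p.2 <= \sum_(p <- s) p.1 * f n p.2 + e / 2] `&`
  [set n | (n0 <= n)%N]) by apply: filterI => //; apply: sumU; rewrite divr_gt0.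
have /filter_ex[n [/= h1 /hn0 h2]] := Usn.
lra.
Qed.

End Ultralimit.

(** * The critical parameter and the limit of resolvents *)

Section Eigenmetric.
Context {R : realType} (th : R) (q : nat) (q0 : (0 < q)%N).
Hypothesis th_lattice : exists n : int, q%:R * (2 * th) = n%:~R.
Implicit Types (x y r c : R) (i l m n M : nat).

Let N m : R -> R -> R := iter m (fold_step th) (@disc R).
(** The grid of multiples of [1 / q] is finite modulo 1, invariant under doubling and contains the
    critical value [2 * th]. A fold across the diameter adds at most one distance from that value to
    the grid when an end is on the grid, so the partial sums [U] control all iterates. *)
Let w m : R := \sum_(i < q) N m (2 * th) (i%:R / q%:R).
Let U m : R := 1 + \sum_(l < m) w l.

Let pN m : pmetric (N m). Proof. exact/pmetric_iter_fold/pmetric_disc. Qed.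

Definition lattice c := exists n : int, q%:R * c = n%:~R.

Lemma lattice_double c : lattice c -> lattice (2 * c).
Proof. by move=> [n nE]; exists (2 * n); rewrite intrM -nE; ring. Qed.

Let w_ge0 m : 0 <= w m.
Proof. by apply: sumr_ge0 => i _; exact: pm_ge0. Qed.

Let U_S m : U m.+1 = U m + w m.
Proof. by rewrite /U big_ord_recr /= addrA. Qed.

Let U_ge1 m : 1 <= U m.
Proof. by rewrite lerDl; apply: sumr_ge0. Qed.

Lemma lattice_rep d c : pmetric d -> lattice c ->
  exists i : 'I_q, forall x, d x c = d x (i%:R / q%:R).
Proof.
move=> pd [n nE]; have qn : (q%:R : R) != 0 by rewrite pnatr_eq0 -lt0n.
have qz : (0 < q%:Z)%R by rewrite ltz_nat.
have rlt : (`|(n %% q)%Z| < q)%N.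
  by rewrite -ltz_nat gez0_abs ?modz_ge0 ?ltz_pmod// gt_eqF.
exists (Ordinal rlt) => x /=.
have e : (`|(n %% q)%Z|%:R : R) = (n %% q)%Z%:~R.
  by rewrite pmulrn gez0_abs// modz_ge0// gt_eqF.
apply: (pm_circle pd) => //; apply/to_circle_eqP; exists (n %/ q)%Z.
apply: (mulfI qn); rewrite nE mulrDr e mulrC divfK// {1}(divz_eq n q) intrD intrM.
by rewrite addrC mulrC.
Qed.

Let N_w m c : lattice c -> N m (2 * th) c <= w m.
Proof.
move=> /(lattice_rep (pN m))[i ->]; rewrite /w (bigD1 i) //= lerDl.
by apply: sumr_ge0 => l _; exact: pm_ge0.
Qed.

Let disc_le1 x y : disc x y <= 1 :> R.
Proof. by rewrite /disc; case: (_ != _); rewrite ?ler01. Qed.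

Let N_U m x c : lattice c -> N m x c <= U m.
Proof.
elim: m x c => [|m IH] x c hc; first exact: le_trans (disc_le1 _ _) (U_ge1 _).
rewrite U_S /N iterS /fold_step; have hc2 := lattice_double hc.
case: ifP => _; first by apply: le_trans (IH _ _ hc2) _; rewrite lerDl.
by apply: lerD; [exact: IH|exact: N_w].
Qed.

Let N_2U m x y : N m x y <= 2 * U m.
Proof.
elim: m x y => [|m IH] x y.
  by apply: le_trans (disc_le1 _ _) _; have := U_ge1 0; lra.
have wm := w_ge0 m; rewrite U_S /N iterS /fold_step.
case: ifP => _; first by apply: le_trans (IH _ _) _; lra.
have h1 : N m (2 * x) (2 * th) <= U m by exact: N_U.
have h2 : N m (2 * y) (2 * th) <= U m by exact: N_U.
have := pm_sym (pN m) (2 * th) (2 * y); rewrite -/(N m); lra.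
Qed.

(** [N l] is at most [2 * U l] times [disc], and folding is monotone and commutes with nonnegative
    factors. *)
Let N_submul m l x y : N (m + l) x y <= 2 * U l * N m x y.
Proof.
have U0 : 0 <= 2 * U l by have := U_ge1 l; lra.
elim: m x y => [|m IH] x y.
  rewrite add0n /N /= -/(N l) /disc.
  have [e|_] := eqVneq (to_circle x) (to_circle y); last by rewrite mulr1.
  by rewrite (pm_circle (pN l) e erefl) (pm_refl (pN l)) mulr0.
rewrite addSn /N !iterS /fold_step -/(N (m + l)) -/(N m).
case: ifP => _; first exact: IH.
by rewrite mulrDr; apply: lerD; exact: IH.
Qed.

Let w_submul m l : w (m + l) <= 2 * U l * w m.
Proof. by rewrite /w mulr_sumr; apply: ler_sum => i _; exact: N_submul. Qed.

Definition subcritical r :=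
  0 <= r <= 1 /\ exists B, forall m, w m * r ^+ m <= B.

Lemma subcritical_le r r' : 0 <= r' <= r -> subcritical r -> subcritical r'.
Proof.
move=> r01 [r1 [B hB]]; split; first by lra.
exists B => m; apply: le_trans (hB m).
by apply: ler_wpM2l => //; apply: lerXn2r; rewrite ?nnegrE; lra.
Qed.

Lemma subcritical_half : subcritical 2^-1.
Proof.
split; first by lra.
have N2 m x y : N m x y <= 2 ^+ m.
  elim: m x y => [|m IH] x y; first exact: disc_le1.
  rewrite /N iterS /fold_step -/(N m) exprS; case: ifP => _.
    apply: le_trans (IH _ _) _; rewrite ler_peMl ?exprn_ge0//; lra.
  have := IH (2 * x) (2 * th); have := IH (2 * th) (2 * y); lra.
exists q%:R => m; rewrite exprVn ler_pdivrMr ?exprn_gt0//.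
apply: le_trans (_ : \sum_(i < q) 2 ^+ m <= _); first by apply: ler_sum.
by rewrite sumr_const card_ord mulr_natl.
Qed.

(** The radius of convergence of the power series with coefficients [w m], capped at 1. *)
Definition critical : R := sup [set r | subcritical r].

Lemma has_sup_subcritical : has_sup [set r | subcritical r].
Proof.
split; first by exists 2^-1; exact: subcritical_half.
by exists 1 => r [/andP[]].
Qed.

Lemma critical_bounds : 2^-1 <= critical <= 1.
Proof.
apply/andP; split.
  by apply: ub_le_sup subcritical_half; exact: (proj2 has_sup_subcritical).
by apply: ge_sup; [exact: (proj1 has_sup_subcritical)|move=> r [/andP[]]].
Qed.

Lemma subcritical_lt r : 0 <= r < critical -> subcritical r.
Proof.
move=> /andP[r0 rc]; have e0 : 0 < critical - r by rewrite subr_gt0.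
have [r' sr'] := sup_adherent e0 has_sup_subcritical.
rewrite -/critical => h; apply: subcritical_le sr'; lra.
Qed.

Lemma U_exp_bound r B m : 0 < r <= 1 -> (forall i, w i * r ^+ i <= B) ->
  U m * r ^+ m <= 1 + m%:R * B.
Proof.
move=> /andP[r0 r1] hB; have B0 : 0 <= B.
  by apply: le_trans (hB 0); rewrite mulr1.
elim: m => [|m IH]; first by rewrite /U big_ord0 addr0 mulr1 mul0r addr0.
have e0 : 0 <= U m * r ^+ m.
  by apply: mulr_ge0; [have := U_ge1 m; lra|apply: exprn_ge0; lra].
have f0 : 0 <= w m * r ^+ m by apply: mulr_ge0 => //; apply: exprn_ge0; lra.
rewrite U_S exprSr mulrA -[m.+1%:R]natr1.
apply: le_trans (_ : (U m + w m) * r ^+ m <= _).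
  by rewrite ler_piMr// mulrDl addr_ge0.
have := hB m; lra.
Qed.

(** A quadratic lower bound is what it takes to beat the linear factor of [U_exp_bound]. *)
Lemma bernoulli_sq (h : R) i : 0 <= h -> (i%:R * h) ^+ 2 <= (1 + h) ^+ (2 * i).
Proof.
move=> h0; rewrite mulnC exprM; apply: lerXn2r; rewrite ?nnegrE.
- by apply: mulr_ge0.
- by apply: exprn_ge0; lra.
elim: i => [|i IH]; first by rewrite mul0r exprn_ge0//; lra.
have : 1 <= (1 + h) ^+ i by apply: exprn_ege1; lra.
move=> h1; have h2 : h <= h * (1 + h) ^+ i by rewrite ler_peMr.
by rewrite exprS -[i.+1%:R]natr1; lra.
Qed.

Section CriticalBelowOne.
Context (L : nat) (L0 : (0 < L)%N) (x0 y0 : R).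
Hypothesis grow : forall i, 2 ^+ i <= N (L * i) x0 y0.

Lemma critical_lt1 : critical < 1.
Proof.
have L1 := L0; have Lr : 0 < L%:R :> R by rewrite ltr0n.
(* By Bernoulli [r ^+ L] is at least 3/4, so a doubling every [L] steps still outweighs it: the
   product is at least 3/2. *)
pose r : R := 1 - (4 * L%:R)^-1.
have Lr1 : 1 <= L%:R :> R by rewrite ler1n.
have L4 : 0 < (4 * L%:R)^-1 :> R by rewrite invr_gt0; lra.
have L5 : (4 * L%:R)^-1 <= 4^-1 :> R by rewrite lef_pV2 ?posrE; lra.
have rL : 3 / 4 <= r ^+ L.
  have bern l : 1 - l%:R * (4 * L%:R)^-1 <= r ^+ l.
    elim: l => [|l IH]; first by rewrite mul0r subr0.
    have r0 : 0 <= r by rewrite /r; lra.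
    have := ler_wpM2l r0 IH; rewrite -exprS; move: (r ^+ l.+1) => X.
    rewrite -[l.+1%:R]natr1 /r; set h := (4 * L%:R)^-1.
    have : 0 <= l%:R * h * h by rewrite !mulr_ge0// /h; lra.
    by lra.
  apply: le_trans (bern L).
  have -> : L%:R * (4 * L%:R)^-1 = 4^-1 :> R by field; rewrite gt_eqF.
  lra.
apply: (@le_lt_trans _ _ r); last by rewrite /r; lra.
apply: ge_sup; first exact: (proj1 has_sup_subcritical).
move=> r' sr'; rewrite leNgt; apply/negP => rr'.
have [_ [B hB]] : subcritical r by apply: subcritical_le sr'; rewrite /r in rr' *; lra.
have r01 : 0 < r <= 1 by rewrite /r; lra.
have B0 : 0 <= B by apply: le_trans (hB 0); rewrite mulr1.
have main i : (3 / 2) ^+ (2 * i) <= 2 * (1 + (L * (2 * i))%:R * B).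
  have h1 := le_trans (grow (2 * i)) (N_2U _ _ _).
  have h2 := U_exp_bound (L * (2 * i)) r01 hB.
  have h3 : (3 / 4) ^+ (2 * i) <= r ^+ (L * (2 * i)).
    by rewrite [leRHS]exprM; apply: lerXn2r; rewrite ?nnegrE//; lra.
  have -> : 3 / 2 = 2 * (3 / 4) :> R by lra.
  rewrite exprMn; apply: le_trans (_ : 2 * U (L * (2 * i)) * r ^+ (L * (2 * i)) <= _).
    by apply: ler_pM => //; apply: exprn_ge0; lra.
  by rewrite -mulrA ler_pM2l.
(* For [i > c] the inequality [i ^ 2 / 4 <= 2 * (1 + 2 * L * i * B)] fails, as [i * c] exceeds
   [16 * L * B * i + 8]. *)
pose c := 16 * (L%:R * B) + 9.
have c0 : 0 <= c by rewrite addr_ge0// !mulr_ge0.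
have [i ib] : exists i, c < i%:R by exists (Num.bound c); exact: archi_boundP.
have := le_trans (@bernoulli_sq 2^-1 i ltac:(lra)) _.
have -> : 1 + 2^-1 = 3 / 2 :> R by lra.
move=> /(_ _ (main i)); rewrite !natrM expr2 => bad.
have LB : 0 <= L%:R * B by rewrite mulr_ge0.
have i1 : 1 <= i%:R :> R by rewrite /c in ib; lra.
have : i%:R * c <= i%:R * i%:R by rewrite ler_pM2l; lra.
rewrite /c; lra.
Qed.
End CriticalBelowOne.

Lemma exp_diff_bound r r' l : 0 <= r -> r <= r' -> r' <= 1 ->
  r' ^+ l <= r ^+ l + l%:R * (r' - r).
Proof.
move=> r0 rr r1; elim: l => [|l IH]; first by rewrite mul0r addr0.
have h1 : r' * r' ^+ l <= r' * (r ^+ l + l%:R * (r' - r)).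
  by apply: ler_wpM2l IH; lra.
have h2 : r ^+ l <= 1 by apply: exprn_ile1; lra.
have h3 : 0 <= l%:R * (r' - r) by apply: mulr_ge0 => //; lra.
have h4 : r' * (l%:R * (r' - r)) <= l%:R * (r' - r) by rewrite ler_piMl.
have h5 : (r' - r) * r ^+ l <= r' - r by rewrite ler_piMr//; lra.
rewrite !exprS -[l.+1%:R]natr1; lra.
Qed.

(* If [2 * U l * critical ^+ l < 1], submultiplicativity of [w] would make
   numbers slightly above [critical] subcritical. *)
Lemma U_critical : critical < 1 -> forall l, 1 <= 2 * U l * critical ^+ l.
Proof.
move=> c1 l; rewrite leNgt; apply/negP => bad; have cb := critical_bounds.
have U1 := U_ge1 l; set g := 2 * U l * critical ^+ l in bad.
have l1 : 0 < l%:R + 1 :> R by rewrite ltr_wpDl.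
pose del := Num.min ((1 - g) / (2 * U l * (l%:R + 1))) (1 - critical).
have U0 : 0 < 2 * U l * (l%:R + 1) by rewrite mulr_gt0//; lra.
have del0 : 0 < del by rewrite lt_min divr_gt0//= ?subr_gt0//; lra.
have del1 : del <= 1 - critical by rewrite ge_min lexx orbT.
have del2 : 2 * U l * (l%:R + 1) * del <= 1 - g.
  by rewrite mulrC -ler_pdivlMr// ge_min lexx.
pose r := critical + del.
have rl : 2 * U l * r ^+ l <= 1.
  have h : r ^+ l <= critical ^+ l + l%:R * (r - critical).
    by apply: exp_diff_bound; rewrite /r; lra.
  have : 2 * U l * r ^+ l <= 2 * U l * (critical ^+ l + l%:R * (r - critical)).
    by apply: ler_wpM2l h; lra.
  have : 0 <= 2 * U l * del by apply: mulr_ge0; lra.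
  have -> : r - critical = del by rewrite /r; ring.
  by move: del2; rewrite /g; lra.
have r0 : 0 <= r by rewrite /r; lra.
have l0 : (0 < l)%N.
  by rewrite lt0n; apply/eqP => lE; move: bad; rewrite /g lE mulr1; have := U_ge1 0; lra.
suff : subcritical r.
  move=> sr; have := ub_le_sup (proj2 has_sup_subcritical) sr.
  by rewrite -/critical /r; lra.
split; first by rewrite /r; lra.
(* Since [2 * U l * r ^+ l <= 1], the term at [m] is at most the term at [m - l], so the first [l]
   terms bound them all. *)
exists (\sum_(i < l) w i * r ^+ i) => m.
have [n] := ubnP m; elim: n m => // n IH m; rewrite ltnS => mn.
have [ml|lm] := ltnP m l.
  rewrite (bigD1 (Ordinal ml)) //= lerDl; apply: sumr_ge0 => i _.
  by apply: mulr_ge0 => //; exact: exprn_ge0.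
have /IH : (m - l < n)%N by apply: leq_trans mn; rewrite ltn_subrL l0 (leq_trans l0).
apply: le_trans; rewrite -{1 2}(subnK lm) exprD mulrA.
have e0 : 0 <= r ^+ (m - l) by exact: exprn_ge0.
have e1 : 0 <= w (m - l) * r ^+ (m - l) by exact: mulr_ge0.
have : w (m - l + l) * r ^+ (m - l) <= 2 * U l * w (m - l) * r ^+ (m - l).
  by apply: ler_wpM2r => //; exact: w_submul.
move=> /(ler_wpM2r (exprn_ge0 l r0)) h; apply: le_trans h _.
have -> : 2 * U l * w (m - l) * r ^+ (m - l) * r ^+ l =
  w (m - l) * r ^+ (m - l) * (2 * U l * r ^+ l) by ring.
by rewrite ler_piMr.
Qed.

Let S r M : R := \sum_(m < M) r ^+ m * w m.

(** Summation by parts with [U (l + 1) - U l = w l]; the exact identity has [r * S r M] in place of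
    [S r M]. *)
Lemma S_U r M : 0 <= r <= 1 ->
  (1 - r) * \sum_(l < M) r ^+ l * U l <= 1 + S r M - r ^+ M * U M.
Proof.
move=> r01; elim: M => [|M IH].
  by rewrite /S !big_ord0 mulr0 mul1r /U big_ord0; lra.
rewrite /S !big_ord_recr /= -/(S r M) mulrDr U_S exprS.
have : 0 <= (1 - r) * (r ^+ M * w M).
  by apply: mulr_ge0; [lra|apply: mulr_ge0 => //; apply: exprn_ge0; lra].
lra.
Qed.

Lemma bernoulli_le (e : R) l : 0 <= e <= 1 -> 1 - l%:R * e <= (1 - e) ^+ l.
Proof.
move=> e01; elim: l => [|l IH]; first by rewrite mul0r subr0.
have e1 : 0 <= 1 - e by lra.
have := ler_wpM2l e1 IH; rewrite -exprS; move: ((1 - e) ^+ l.+1) => X.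
have : 0 <= l%:R * e * e by rewrite !mulr_ge0//; lra.
by rewrite -[l.+1%:R]natr1; lra.
Qed.

(** Two competing demands: [r] close enough to [critical] for [U_critical] to make [S] large, yet
    below it, so that comparison with a subcritical [r'] between them makes [r ^+ M * U M] small. *)
Lemma near_critical : critical < 1 -> forall n, exists r M,
  [/\ 0 <= r <= critical, critical - r <= n.+1%:R^-1, n.+1%:R <= S r M
    & r ^+ M * U M <= 1].
Proof.
move=> c1 n; have cb := critical_bounds.
(* The first [M0] terms [r ^+ l * U l] will be at least 1/4; then [(1 - critical) * M0 / 4] exceeds
   [n + 2], and [S_U] yields [S >= n + 1]. *)
pose c := 4 * (n%:R + 2) / (1 - critical).
have n0 : 0 <= n%:R :> R by [].
have c0 : 0 <= c by rewrite divr_ge0//; lra.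
have [M0 M0c] : exists M0, c < M0%:R by exists (Num.bound c); exact: archi_boundP.
have M01 : 1 <= M0%:R :> R.
  rewrite ler1n lt0n; apply/eqP => M00; rewrite M00 in M0c.
  by move: M0c; rewrite ltNge c0.
(* The second bound keeps [(1 - e) ^+ l] above 1/2 for [l < M0]. *)
pose e : R := Num.min n.+1%:R^-1 (2 * M0%:R)^-1.
have e0 : 0 < e by rewrite lt_min !invr_gt0 ltr0n /=; lra.
have e1 : e <= n.+1%:R^-1 by rewrite ge_min lexx.
have e2 : e <= (2 * M0%:R)^-1 by rewrite ge_min lexx orbT.
have e3 : M0%:R * e <= 2^-1.
  apply: le_trans (_ : M0%:R * (2 * M0%:R)^-1 <= _); first by rewrite ler_pM2l; lra.
  have -> : M0%:R * (2 * M0%:R)^-1 = 2^-1 :> R by field; rewrite gt_eqF//; lra.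
  exact: lexx.
have e4 : e <= 2^-1.
  by apply: le_trans e3; rewrite ler_peMl//; lra.
pose r := critical * (1 - e); pose r' := critical * (1 - e / 2).
have r0 : 0 < r by apply: mulr_gt0; lra.
have rr' : r < r' by rewrite ltr_pM2l; lra.
have r'c : r' < critical by rewrite gtr_pMr; lra.
have [_ [B hB]] : subcritical r' by apply: subcritical_lt; lra.
have B0 : 0 <= B by apply: le_trans (hB 0); rewrite mulr1.
pose h := (r' - r) / r.
have h0 : 0 < h by rewrite divr_gt0// subr_gt0.
have r'E : r' = r * (1 + h) by rewrite /h; field; rewrite gt_eqF.
pose cc := (2 * B + 1) / h ^+ 2 + M0%:R.
have cc1 : 0 <= (2 * B + 1) / h ^+ 2 by rewrite divr_ge0 ?exprn_ge0//; lra.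
have cc0 : 0 <= cc by rewrite addr_ge0.
have [i ic] : exists i, cc < i%:R by exists (Num.bound cc); exact: archi_boundP.
have i1 : (2 * B + 1) / h ^+ 2 < i%:R by rewrite /cc in ic; lra.
have i2 : (M0 <= i)%N by rewrite -(ler_nat R); rewrite /cc in ic; lra.
have i3 : 1 <= i%:R :> R by rewrite /cc in ic; lra.
have r1 : r < critical by lra.
exists r, (2 * i)%N; split.
- lra.
- rewrite /r; apply: le_trans e1.
  have -> : critical - critical * (1 - e) = critical * e by ring.
  by rewrite ler_piMl; lra.
- have lower l : (l < M0)%N -> 4^-1 <= r ^+ l * U l.
    move=> lM; have h1 := U_critical c1 l.
    have h2 := @bernoulli_le e l ltac:(lra).
    have h3 : 2^-1 <= (1 - e) ^+ l.
      have : l%:R * e <= M0%:R * e by apply: ler_wpM2r; [lra|rewrite ler_nat ltnW].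
      lra.
    rewrite /r exprMn; have u0 : 0 <= critical ^+ l * U l.
      by apply: mulr_ge0; [apply: exprn_ge0; lra|have := U_ge1 l; lra].
    have : 2^-1 * (critical ^+ l * U l) <= (1 - e) ^+ l * (critical ^+ l * U l).
      exact: ler_wpM2r.
    lra.
  have sum_lower M : (M0 <= M)%N -> M0%:R * 4^-1 <= \sum_(l < M) r ^+ l * U l.
    move=> /subnK <-; elim: (M - M0)%N => [|m IH].
      apply: le_trans (_ : \sum_(l < M0) 4^-1 <= _).
        by rewrite sumr_const card_ord mulr_natl.
      by rewrite add0n; apply: ler_sum => l _; exact: lower.
    rewrite addSn big_ord_recr /=; apply: le_trans IH _; rewrite lerDl.
    by apply: mulr_ge0; [apply: exprn_ge0; lra|have := U_ge1 (m + M0); lra].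
  have h1 := sum_lower (2 * i)%N ltac:(by rewrite mul2n -addnn; apply: leq_trans i2 (leq_addr _ _)).
  have h2 := @S_U r (2 * i) ltac:(lra).
  have h3 : (1 - critical) * (M0%:R * 4^-1) <= (1 - r) * \sum_(l < 2 * i) r ^+ l * U l.
    apply: ler_pM; [lra|by apply: mulr_ge0; lra|lra|exact: h1].
  have h4 : 4 * (n%:R + 2) < M0%:R * (1 - critical) by rewrite -ltr_pdivrMr//; lra.
  have : 0 <= r ^+ (2 * i) * U (2 * i).
    by apply: mulr_ge0; [apply: exprn_ge0; lra|have := U_ge1 (2 * i); lra].
  by rewrite -[n.+1%:R]natr1; lra.
have h1 := U_exp_bound (2 * i) (_ : 0 < r' <= 1) hB.
have {}h1 := h1 ltac:(lra).
have h2 := @bernoulli_sq h i (ltW h0).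
have h3 : 2 * B + 1 <= i%:R * h ^+ 2 by rewrite -ler_pdivrMr ?exprn_gt0// ltW.
have h4 : 1 + (2 * i)%:R * B <= (i%:R * h) ^+ 2.
  have : i%:R * (2 * B + 1) <= i%:R * (i%:R * h ^+ 2) by rewrite ler_pM2l//; lra.
  by rewrite natrM !expr2; lra.
have h5 : 0 < (1 + h) ^+ (2 * i) by apply: exprn_gt0; lra.
rewrite -(ler_pM2r h5) mul1r mulrAC -exprMn -r'E mulrC.
lra.
Qed.

(* Truncated resolvents of [fold_step]; near the critical parameter their
   defect as eigenvectors is absorbed by the divergence of [S]. *)
Let approx r M x y : R := \sum_(m < M) r ^+ m / S r M * N m x y.

Lemma pmetric_comb (a : nat -> R) (d : nat -> R -> R -> R) M :
  (forall m, 0 <= a m) -> (forall m, pmetric (d m)) ->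
  pmetric (fun x y => \sum_(m < M) a m * d m x y).
Proof.
move=> a0 pd; split.
- by move=> x y; apply: eq_bigr => m _; rewrite (pm_per (pd m)).
- by move=> x y; apply: eq_bigr => m _; rewrite (pm_sym (pd m)).
- by move=> x; rewrite big1// => m _; rewrite (pm_refl (pd m)) mulr0.
- move=> x y z; rewrite -big_split; apply: ler_sum => m _ /=.
  by rewrite -mulrDr ler_wpM2l// (pm_tri (pd m)).
- move=> v1 v2 v3 v4 h12 h23 h34 h41; rewrite -!big_split.
  by split; apply: ler_sum => m _ /=; rewrite -!mulrDr ler_wpM2l//;
    have [] := pm_cross (pd m) h12 h23 h34 h41.
Qed.

(** Folding and multiplying by [r] shifts the index of the sum, so only the boundary terms
    differ. *)
Lemma approx_fold r M x y : r * fold_step th (approx r M) x y =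
  approx r M x y + r ^+ M / S r M * N M x y - (S r M)^-1 * N 0 x y.
Proof.
have -> : fold_step th (approx r M) x y = \sum_(m < M) r ^+ m / S r M * N m.+1 x y.
  rewrite {1}/fold_step /approx; case: ifP => same.
    by apply: eq_bigr => m _; rewrite /N iterS /fold_step same.
  by rewrite -big_split; apply: eq_bigr => m _; rewrite /N /= [in RHS]/fold_step same mulrDr.
have e1 : \sum_(m < M.+1) r ^+ m / S r M * N m x y =
    approx r M x y + r ^+ M / S r M * N M x y by rewrite big_ord_recr.
rewrite -e1 big_ord_recl /= mul1r addrAC subrr add0r mulr_sumr.
by apply: eq_bigr => m _; rewrite /bump /= add1n exprS -!mulrA.
Qed.

Lemma approx_bound r M x y : critical < 1 -> 0 <= r <= critical -> 1 <= S r M ->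
  0 <= approx r M x y <= 4 / (1 - critical).
Proof.
move=> c1 rc S1; have cb := critical_bounds; apply/andP; split.
  apply: sumr_ge0 => m _; apply: mulr_ge0; last exact: pm_ge0.
  by apply: divr_ge0; [apply: exprn_ge0; lra|lra].
have h : \sum_(m < M) r ^+ m * N m x y <= 2 * \sum_(m < M) r ^+ m * U m.
  rewrite mulr_sumr; apply: ler_sum => m _; rewrite mulrCA; apply: ler_wpM2l => //.
  by apply: exprn_ge0; lra.
have -> : approx r M x y = (\sum_(m < M) r ^+ m * N m x y) / S r M.
  by rewrite mulr_suml; apply: eq_bigr => m _; rewrite mulrAC.
have h2 := @S_U r M ltac:(lra).
have h3 : 0 <= r ^+ M * U M.
  by apply: mulr_ge0; [apply: exprn_ge0; lra|have := U_ge1 M; lra].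
have h4 : 0 <= \sum_(l < M) r ^+ l * U l.
  by apply: sumr_ge0 => l _; apply: mulr_ge0; [apply: exprn_ge0; lra|have := U_ge1 l; lra].
have h5 : (1 - critical) * \sum_(l < M) r ^+ l * U l <=
    (1 - r) * \sum_(l < M) r ^+ l * U l by apply: ler_wpM2r => //; lra.
rewrite ler_pdivrMr; last by lra.
rewrite mulrAC ler_pdivlMr; last by lra.
have : (\sum_(m < M) r ^+ m * N m x y) * (1 - critical) <=
    2 * (\sum_(m < M) r ^+ m * U m) * (1 - critical) by apply: ler_wpM2r => //; lra.
lra.
Qed.

(** The divisor [S r M] is chosen for this normalization, which passes to the limit and keeps it
    from vanishing. *)
Lemma approx_total r M : 0 < S r M ->
  \sum_(i < q) approx r M (2 * th) (i%:R / q%:R) = 1.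
Proof.
move=> S0; rewrite exchange_big /=.
transitivity (\sum_(m < M) r ^+ m * w m / S r M); last first.
  by rewrite -mulr_suml divff// gt_eqF.
by apply: eq_bigr => m _; rewrite mulrAC /w mulr_sumr.
Qed.

Lemma eigenmetric : critical < 1 -> exists (rho K : R) (D : R -> R -> R),
  [/\ 0 < rho < 1, pmetric D, forall x y, D x y <= K,
      forall x y, D x y = rho * fold_step th D x y &
      exists x y, D x y != 0].
Proof.
move=> c1; have cb := critical_bounds.
have [rM rMP] : exists rM : nat -> R * nat, forall n,
    [/\ 0 <= (rM n).1 <= critical, critical - (rM n).1 <= n.+1%:R^-1,
      n.+1%:R <= S (rM n).1 (rM n).2 & (rM n).1 ^+ (rM n).2 * U (rM n).2 <= 1].
  have [rM rMP] := @choice _ _ (fun n (p : R * nat) => [/\ 0 <= p.1 <= critical,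
    critical - p.1 <= n.+1%:R^-1, n.+1%:R <= S p.1 p.2 & p.1 ^+ p.2 * U p.2 <= 1])
    (fun n => let: ex_intro r (ex_intro M h) := near_critical c1 n in
       ex_intro _ (r, M) h).
  by exists rM.
have n1 n : 1 <= n.+1%:R :> R by rewrite ler1n.
pose f n (p : R * R) := approx (rM n).1 (rM n).2 p.1 p.2.
pose K := 4 / (1 - critical).
have fK n p : 0 <= f n p <= K.
  have [h1 _ h3 _] := rMP n; apply: approx_bound => //; exact: le_trans h3.
have pf n : pmetric (fun x y => f n (x, y)).
  have [h1 _ h3 _] := rMP n; apply: (pmetric_comb (a := fun m => _ ^+ m / _)) => // m.
  by apply: divr_ge0; [apply: exprn_ge0; lra|have := n1 n; lra].
have [F FP] := bounded_ultralimit fK; pose D x y := F (x, y).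
have tr t : (forall n, \sum_(p <- t) p.1 * f n p.2 <= 0) ->
    \sum_(p <- t) p.1 * F p.2 <= 0.
  move=> h; apply: FP => e e0; exists 0 => n _; apply: le_trans (h n) _.
  by rewrite add0r ltW.
have le2 x y x' y' : (forall n, f n (x, y) <= f n (x', y')) -> D x y <= D x' y'.
  move=> h; have : \sum_(p <- [:: (1, (x, y)); (-1, (x', y'))]) p.1 * F p.2 <= 0.
    by apply: tr => n; rewrite !big_cons big_nil /=; have := h n; lra.
  by rewrite !big_cons big_nil /= /D; lra.
have le4 p1 p2 p3 p4 : (forall n, f n p1 + f n p2 <= f n p3 + f n p4) ->
    F p1 + F p2 <= F p3 + F p4.
  move=> h; have : \sum_(p <- [:: (1, p1); (1, p2); (-1, p3); (-1, p4)]) p.1 * F p.2 <= 0.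
    by apply: tr => n; rewrite !big_cons big_nil /=; have := h n; lra.
  by rewrite !big_cons big_nil /=; lra.
have D_refl x : D x x = 0.
  have h1 : \sum_(p <- [:: (1, (x, x))]) p.1 * F p.2 <= 0.
    by apply: tr => n; rewrite big_cons big_nil /= (pm_refl (pf n)); lra.
  have h2 : \sum_(p <- [:: (-1, (x, x))]) p.1 * F p.2 <= 0.
    by apply: tr => n; rewrite big_cons big_nil /= (pm_refl (pf n)); lra.
  by move: h1 h2; rewrite !big_cons !big_nil /= /D; lra.
have pD : pmetric D.
  split => //.
  - move=> x y; apply: le_anti; apply/andP.
    by split; apply: le2 => n; rewrite (pm_per (pf n)).
  - move=> x y; apply: le_anti; apply/andP.
    by split; apply: le2 => n; rewrite (pm_sym (pf n)).
  - move=> x y z; have := @le4 (x, z) (y, y) (x, y) (y, z).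
    rewrite -!/(D _ _) D_refl addr0; apply => n.
    by rewrite (pm_refl (pf n)) addr0; exact: (pm_tri (pf n)).
  - move=> v1 v2 v3 v4 h12 h23 h34 h41.
    by split; apply: le4 => n; have [] := pm_cross (pf n) h12 h23 h34 h41.
have DK x y : D x y <= K.
  have : \sum_(p <- [:: (1, (x, y))]) p.1 * F p.2 <= K.
    apply: FP => e e0; exists 0 => n _; rewrite big_cons big_nil /=.
    by have := fK n (x, y); lra.
  by rewrite big_cons big_nil /= /D; lra.
have K0 : 0 <= K by have := fK 0 (0, 0); lra.
(* The last term of the resolvent contributes at most [2 / S], the first [1 / S] with the opposite
   sign, and replacing the parameter by [critical] at most [2 * K] times their difference, whence
   [2 * K + 2]. *)
have err n x y :
    - ((2 * K + 2) / n.+1%:R) <= f n (x, y) - critical * fold_step th (fun u v => f n (u, v)) x y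
    <= (2 * K + 2) / n.+1%:R.
  have [h1 h2 h3 h4] := rMP n; have n1' := n1 n.
  set fo := fold_step th (fun u v => f n (u, v)) x y.
  have : (rM n).1 * fo = f n (x, y) + (rM n).1 ^+ (rM n).2 / S (rM n).1 (rM n).2
      * N (rM n).2 x y - (S (rM n).1 (rM n).2)^-1 * N 0 x y by exact: approx_fold.
  have fo0 : 0 <= fo by exact: (pm_ge0 (pmetric_fold th (pf n))).
  have fo2 : fo <= 2 * K.
    rewrite /fo /fold_step; case: ifP => _.
      by have := fK n (2 * x, 2 * y); lra.
    by have := fK n (2 * x, 2 * th); have := fK n (2 * th, 2 * y); lra.
  set Sn := S _ _ in h3 *; have Sn0 : 0 < Sn by lra.
  have SV0 : 0 < Sn^-1 by rewrite invr_gt0.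
  have SV : Sn^-1 <= n.+1%:R^-1 by rewrite lef_pV2// posrE; lra.
  have a0 : 0 <= (rM n).1 ^+ (rM n).2 * N (rM n).2 x y <= 2.
    apply/andP; split; first by apply: mulr_ge0; [apply: exprn_ge0; lra|exact: pm_ge0].
    apply: le_trans (_ : (rM n).1 ^+ (rM n).2 * (2 * U (rM n).2) <= _); last by lra.
    by apply: ler_wpM2l => //; apply: exprn_ge0; lra.
  have a1 : 0 <= (rM n).1 ^+ (rM n).2 / Sn * N (rM n).2 x y <= 2 / n.+1%:R.
    case/andP: a0 => a0 a2; rewrite mulrAC; apply/andP; split.
      by apply: divr_ge0; [exact: a0|exact: ltW].
    by apply: ler_pM; [exact: a0|exact: ltW|exact: a2|exact: SV].
  have b1 : 0 <= Sn^-1 * N 0 x y <= n.+1%:R^-1.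
    have N01 : 0 <= N 0 x y <= 1 by rewrite disc_le1 andbT; exact: pm_ge0.
    apply/andP; split; first by apply: mulr_ge0; lra.
    case/andP: N01 => N0 N1; rewrite -[leRHS]mulr1.
    by apply: ler_pM; [exact: ltW|exact: N0|exact: SV|exact: N1].
  have c1' : 0 <= (critical - (rM n).1) * fo <= n.+1%:R^-1 * (2 * K).
    apply/andP; split; first by apply: mulr_ge0; lra.
    by apply: ler_pM; [lra|exact: fo0|exact: h2|exact: fo2].
  have nV : 0 < n.+1%:R^-1 :> R by rewrite invr_gt0 ltr0n.
  have KV : 0 <= K * n.+1%:R^-1 by apply: mulr_ge0; [exact: K0|exact: ltW].
  move: a1 b1 c1' nV KV; move: (n.+1%:R^-1) ((rM n).1 ^+ _ / Sn * _) (Sn^-1 * N 0 x y).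
  by move=> V A B *; apply/andP; split; lra.
have errV e : 0 < e -> exists n0, forall n, (n0 <= n)%N -> (2 * K + 2) / n.+1%:R <= e.
  move=> e0; have c0 : 0 <= (2 * K + 2) / e by rewrite divr_ge0//; lra.
  exists (Num.bound ((2 * K + 2) / e)) => n; have := archi_boundP c0.
  move: (Num.bound _) => n0 hn0 n0n; rewrite ler_pdivrMr ?ltr0n// [e * _]mulrC -ler_pdivrMr//.
  by apply/ltW/(lt_le_trans hn0); rewrite ler_nat leqW.
have errE e : 0 < e -> exists n0, forall n, (n0 <= n)%N -> forall x y,
    - e <= f n (x, y) - critical * fold_step th (fun u v => f n (u, v)) x y <= e.
  move=> /errV[n0 hn0]; exists n0 => n /hn0 he x y; have /andP[k1 k2] := err n x y.
  apply/andP; split; last exact: le_trans k2 he.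
  by apply: le_trans k1; rewrite lerN2.
clear errV err.
exists critical, K, D; split => //.
- by lra.
- move=> x y; rewrite /fold_step; case: ifP => same.
    have h1 : \sum_(p <- [:: (1, (x, y)); (- critical, (2 * x, 2 * y))]) p.1 * F p.2 <= 0.
      apply: FP => e /errE[n0 hn0]; exists n0 => n /hn0/(_ x y) he; rewrite !big_cons big_nil /=.
      by move: he; rewrite /fold_step same; lra.
    have h2 : \sum_(p <- [:: (-1, (x, y)); (critical, (2 * x, 2 * y))]) p.1 * F p.2 <= 0.
      apply: FP => e /errE[n0 hn0]; exists n0 => n /hn0/(_ x y) he; rewrite !big_cons big_nil /=.
      by move: he; rewrite /fold_step same; lra.
    by move: h1 h2; rewrite !big_cons !big_nil /= /D; lra.
  have h1 : \sum_(p <- [:: (1, (x, y)); (- critical, (2 * x, 2 * th));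
      (- critical, (2 * th, 2 * y))]) p.1 * F p.2 <= 0.
    apply: FP => e /errE[n0 hn0]; exists n0 => n /hn0/(_ x y) he; rewrite !big_cons big_nil /=.
    by move: he; rewrite /fold_step same; lra.
  have h2 : \sum_(p <- [:: (-1, (x, y)); (critical, (2 * x, 2 * th));
      (critical, (2 * th, 2 * y))]) p.1 * F p.2 <= 0.
    apply: FP => e /errE[n0 hn0]; exists n0 => n /hn0/(_ x y) he; rewrite !big_cons big_nil /=.
    by move: he; rewrite /fold_step same; lra.
  by move: h1 h2; rewrite !big_cons !big_nil /= /D; lra.
apply: contrapT => all0.
have D0 x y : D x y = 0 by apply/eqP/negPn/negP => xy; apply: all0; exists x, y.
have : \sum_(p <- [seq (-1, (2 * th, (nat_of_ord i)%:R / q%:R)) | i : 'I_q <- enum 'I_q])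
    p.1 * F p.2 <= -1 :> R.
  apply: FP => e e0; exists 0 => n _; rewrite big_map big_enum /=.
  rewrite (eq_bigr (fun i : 'I_q => - f n (2 * th, i%:R / q%:R))); last first.
    by move=> i _; rewrite mulN1r.
  have [_ _ h3 _] := rMP n; rewrite sumrN approx_total; first by lra.
  by have := n1 n; lra.
rewrite big_map big_enum /= big1; first by lra.
by move=> i _; rewrite -/(D _ _) D0 mulr0.
Qed.

End Eigenmetric.

(** * The lamination *)

Section EigenLamination.
Context {R : realType} (th : R) (q : nat) (q0 : (0 < q)%N).
Hypothesis th_lattice : exists n : int, q%:R * (2 * th) = n%:~R.
Context (rho K : R) (D : R -> R -> R).
Hypotheses (rho01 : 0 < rho < 1) (pD : pmetric D) (DK : forall x y, D x y <= K).
Hypothesis D_fold : forall x y, D x y = rho * fold_step th D x y.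
Hypothesis D_neq0 : exists x y, D x y != 0.
Implicit Types (x y u v c : R) (n m : int).

Let rho0 : 0 < rho. Proof. by case/andP: rho01. Qed.
Let D_ge0 := pm_ge0 pD.
Let K0 : 0 <= K. Proof. exact: le_trans (D_ge0 0 0) (DK 0 0). Qed.

Lemma D_le0 x y : D x y <= 0 -> D x y = 0.
Proof. by move=> h; apply: le_anti; rewrite h D_ge0. Qed.

Lemma D_double x y : D x y = 0 -> D (2 * x) (2 * y) = 0.
Proof.
move=> xy; apply: D_le0; apply: le_trans (fold_ge th x y pD) _.
by rewrite -(pmulr_rle0 _ rho0) -D_fold xy.
Qed.

Lemma D_exp (i : nat) x y : D x y = 0 -> D (2 ^+ i * x) (2 ^+ i * y) = 0.
Proof.
move=> xy; elim: i => [|i IH]; first by rewrite !mul1r.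
by rewrite exprS -!mulrA; exact: D_double.
Qed.

Lemma side_between x y : side th x != side th y ->
  exists n, x <= th + n%:~R / 2 <= y \/ y <= th + n%:~R / 2 <= x.
Proof.
wlog xy : x y / x <= y => [hw|].
  have [xy|yx] := leP x y; first exact: hw.
  by rewrite eq_sym => /(hw _ _ (ltW yx))[n [h|h]]; exists n; [right|left].
move=> sxy; have /andP[h1 h2] := floor_itv (2 * (y - th)).
rewrite intrD1 in h2; set n := Num.floor _ in h1 h2.
exists n; left; apply/andP; split; last by lra.
rewrite leNgt; apply/negP => h; move/negP: sxy; apply; apply/eqP.
by apply: (@side_cell _ th x y n 0); rewrite ?addr0; lra.
Qed.

Lemma between_dist x y c : x <= c <= y \/ y <= c <= x ->
  `|x - c| <= `|x - y| /\ `|y - c| <= `|x - y|.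
Proof.
case=> h.
  rewrite (ler0_norm (_ : x - y <= 0)); last by lra.
  by rewrite !ler_norml; split; lra.
rewrite (ger0_norm (_ : 0 <= x - y)); last by lra.
by rewrite !ler_norml; split; lra.
Qed.

Let qr : 0 < q%:R :> R. Proof. by rewrite ltr0n. Qed.

(** If an end of the diameter lies between [x] and [c], its double is a grid point closer than
    [1 / q] to the grid point [2 * c], hence equal to it, and the second leg of the fold vanishes.
    Each step thus gains [rho] without branching. *)
Lemma D_near_lattice (i : nat) x c : lattice q c ->
  `|x - c| * 2 ^+ i < (2 * q%:R)^-1 -> D x c <= K * rho ^+ i.
Proof.
have [nth nthE] := th_lattice; have qr0 := qr.
elim: i x c => [|i IH] x c hc h; first by rewrite mulr1.
have i1 : 1 <= 2 ^+ i :> R by apply: exprn_ege1; rewrite ler1n.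
have h' : `|2 * x - 2 * c| * 2 ^+ i < (2 * q%:R)^-1.
  rewrite -mulrBr normrM ger0_norm//.
  by have -> : 2 * `|x - c| * 2 ^+ i = `|x - c| * 2 ^+ i.+1 by rewrite exprS; ring.
have next := IH _ _ (lattice_double hc) h'.
have -> : D x c = rho * D (2 * x) (2 * c); last first.
  by rewrite exprS mulrCA ler_pM2l.
rewrite D_fold; congr (_ * _); rewrite /fold_step; case: ifPn => // sxc.
have [n hn] := side_between sxc; have [l lE] := hc.
have near : `|2 * th + n%:~R - 2 * c| < q%:R^-1.
  have e1 : `|2 * th + n%:~R - 2 * c| <= 2 * `|x - c|.
    have -> : 2 * th + n%:~R - 2 * c = 2 * (th + n%:~R / 2 - c) by field.
    rewrite normrM ger0_norm// ler_pM2l//.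
    by have [_] := between_dist hn; rewrite distrC.
  have e2 : 2 * `|x - c| <= `|x - c| * 2 ^+ i.+1.
    by rewrite exprS mulrCA mulrA ler_peMr// mulr_ge0.
  have e3 : (2 * q%:R)^-1 <= q%:R^-1 :> R by rewrite lef_pV2 ?posrE; lra.
  lra.
have cE : 2 * c = 2 * th + n%:~R.
  have : (nth + n * q%:Z - 2 * l = 0)%R; last first.
    move=> /(congr1 (fun m => m%:~R : R)); rewrite intrB intrD !intrM -nthE -lE => e.
    apply: (mulfI (lt0r_neq0 qr0)); move: e; rewrite mulrDr /=; lra.
  have e : (nth + n * q%:Z - 2 * l)%:~R = q%:R * (2 * th + n%:~R - 2 * c) :> R.
    by rewrite intrB intrD !intrM -nthE -lE; ring.
  have : `|q%:R * (2 * th + n%:~R - 2 * c)| < 1.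
    by rewrite normrM gtr0_norm// -ltr_pdivlMl// mulr1.
  by rewrite ltr_norml -e => /andP[e1 e2]; apply: (@int_lt1 R).
have e0 : to_circle (2 * c) = to_circle (2 * th) by rewrite cE to_circleDint.
rewrite (pm_circle pD (erefl (to_circle (2 * x))) e0).
by rewrite (pm_circle pD (erefl (to_circle (2 * th))) e0) (pm_refl pD) addr0.
Qed.

(** The factor 2 is paid once: at the first separation both legs run to a grid point, and
    [D_near_lattice] takes over. *)
Lemma D_near (i : nat) x y :
  `|x - y| * 2 ^+ i < (2 * q%:R)^-1 -> D x y <= 2 * K * rho ^+ i.
Proof.
elim: i x y => [|i IH] x y h.
  by rewrite mulr1; apply: le_trans (DK _ _) _; have := K0; lra.
have dbl u : `|2 * u| * 2 ^+ i = `|u| * 2 ^+ i.+1.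
  by rewrite normrM ger0_norm// exprS mulrA [2 * `|u|]mulrC.
rewrite D_fold exprS mulrCA ler_pM2l// /fold_step; case: ifPn => sxy.
  by apply: IH; rewrite -mulrBr dbl.
have [n hn] := side_between sxy.
have e0 : to_circle (2 * th) = to_circle (2 * (th + n%:~R / 2)).
  by apply/to_circle_eqP; exists (- n); rewrite intrN; field.
have lat : lattice q (2 * (th + n%:~R / 2)).
  have [m mE] := th_lattice; exists (m + n * q%:Z).
  by rewrite intrD intrM -mE; field.
rewrite (pm_circle pD (erefl (to_circle (2 * x))) e0).
rewrite (pm_sym pD (2 * th)) (pm_circle pD (erefl (to_circle (2 * y))) e0).
have i0 : 0 < 2 ^+ i.+1 :> R by exact: exprn_gt0.
have near u : `|u - (th + n%:~R / 2)| <= `|x - y| ->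
    D (2 * u) (2 * (th + n%:~R / 2)) <= K * rho ^+ i.
  move=> hu; apply: D_near_lattice => //; rewrite -mulrBr dbl.
  by apply: le_lt_trans h; rewrite ler_pM2r.
have [hx hy] := between_dist hn.
by have := near _ hx; have := near _ hy; lra.
Qed.

Lemma D_continuous (e : R) : 0 < e ->
  exists2 del, 0 < del & forall x y, `|x - y| < del -> D x y < e.
Proof.
move=> e0; have c0 := K0; have rb := rho01; have qr0 := qr.
have [i hi] : exists i : nat, 2 * K * rho ^+ i < e.
  have c1 : 0 < 2 * K + 1 by lra.
  have rn : `|rho| < 1 by rewrite gtr0_norm; lra.
  have /cvgr0Pnorm_lt/(_ (e / (2 * K + 1))) := cvg_expr rn.
  move=> /(_ (divr_gt0 e0 c1))[n _ hn]; exists n.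
  have := hn n (leqnn n); rewrite /= ltr_pdivlMr// gtr0_norm ?exprn_gt0// => h.
  apply: le_lt_trans h; rewrite mulrC ler_pM2l ?exprn_gt0//; lra.
exists ((2 * q%:R)^-1 / 2 ^+ i); first by rewrite divr_gt0 ?exprn_gt0// invr_gt0; lra.
move=> x y; rewrite ltr_pdivlMr ?exprn_gt0// => /D_near h.
exact: le_lt_trans h hi.
Qed.

Definition lam_rel (x y : circle R) := D (angle x) (angle y) = 0.

Lemma lam_relE u v : lam_rel (to_circle u) (to_circle v) <-> D u v = 0.
Proof.
by rewrite /lam_rel (pm_circle pD (angleK (to_circle u)) (angleK (to_circle v))).
Qed.

Lemma D_trans x y z : D x y = 0 -> D y z = 0 -> D x z = 0.
Proof.
by move=> xy yz; apply: D_le0; apply: le_trans (pm_tri pD x y z) _; rewrite xy yz addr0.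
Qed.

Lemma D_sym0 x y : D x y = 0 -> D y x = 0.
Proof. by rewrite (pm_sym pD). Qed.

Lemma lam_rel_closed : closed [set p : (circle R * circle R)%type | lam_rel p.1 p.2].
Proof.
rewrite -[X in closed X]setCK; apply: open_closedC; rewrite openE => -[x y].
have [u ->] := to_circle_surj x; have [v ->] := to_circle_surj y.
move=> /= /lam_relE/eqP uv; have D0 : 0 < D u v by rewrite lt_neqAle eq_sym uv D_ge0.
have [del del0 hdel] := @D_continuous (D u v / 2) ltac:(by rewrite divr_gt0).
exists ([set x | exists2 u', x = to_circle u' & `|u' - u| < del],
  [set x | exists2 v', x = to_circle v' & `|v' - v| < del]) => /=.
  by split; exact: nbhs_to_circle.
move=> [_ _] [[u' /= -> hu] [v' /= -> hv]] /lam_relE uv'.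
have t1 := pm_tri pD u u' v; have t2 := pm_tri pD u' v' v.
have := hdel _ _ hu; have := hdel _ _ hv; have := pm_sym pD u u'; lra.
Qed.

Lemma lam_class_closed (x : circle R) : closed (eq_class lam_rel x).
Proof.
have [u ->] := to_circle_surj x.
rewrite -[X in closed X]setCK; apply: open_closedC; rewrite openE => y.
have [v ->] := to_circle_surj y.
move=> /= /lam_relE/eqP uv; have D0 : 0 < D u v by rewrite lt_neqAle eq_sym uv D_ge0.
have [del del0 hdel] := D_continuous D0.
apply: filterS (nbhs_to_circle v del0) => _ [v' -> hv] /lam_relE uv'.
have t1 := pm_tri pD u v' v; have := hdel _ _ hv; lra.
Qed.

(** Doubling stretches any arc over the whole circle and preserves distance zero. *)
Lemma class_interior_total u v (e : R) : 0 < e ->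
  (forall x, `|x - u| < e -> D v x = 0) -> forall x y, D x y = 0.
Proof.
move=> e0 hu.
have hv x : `|x - u| < e -> D u x = 0.
  move=> /hu h; apply: D_trans h; apply: D_sym0; apply: hu.
  by rewrite subrr normr0.
have [i hi] : exists i : nat, 1 < e * 2 ^+ i.
  have [i hi] : exists i : nat, e^-1 < i%:R.
    by exists (Num.bound e^-1); apply: archi_boundP; rewrite invr_ge0 ltW.
  exists i; rewrite -ltr_pdivrMl// mulr1; apply: lt_trans hi _.
  by rewrite -natrX ltr_nat ltn_expl.
have i0 : 0 < 2 ^+ i :> R by exact: exprn_gt0.
have all y : D (2 ^+ i * u) y = 0.
  have /andP[] := floor_itv (y - 2 ^+ i * u); rewrite intrD1.
  set m := Num.floor _ => h1 h2.
  have := @hv ((y - m%:~R) / 2 ^+ i); have -> : (y - m%:~R) / 2 ^+ i - u =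
      (y - m%:~R - 2 ^+ i * u) / 2 ^+ i by field; rewrite gt_eqF.
  rewrite normrM normfV (gtr0_norm i0) ltr_pdivrMr// ger0_norm; last by lra.
  move=> /(_ ltac:(lra))/(D_exp i).
  have -> : 2 ^+ i * ((y - m%:~R) / 2 ^+ i) = y - m%:~R by field; rewrite gt_eqF.
  move=> h.
  by rewrite -[RHS]h -(pm_int pD _ _ 0 (- m)) addr0 intrN.
by move=> x y; apply: D_trans (all y); apply: D_sym0.
Qed.

Lemma lam_class_nowhere_dense (x : circle R) : interior (closure (eq_class lam_rel x)) = set0.
Proof.
have <- := (closure_id _).1 (@lam_class_closed x).
apply/seteqP; split => // y.
have [u ->] := to_circle_surj x; have [v ->] := to_circle_surj y.
rewrite /interior /= => nb; have := @to_circle_continuous R v _ nb.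
move=> /nbhs_ballP[e /= e0 sub]; have [x0 [y0 /eqP]] := D_neq0; apply.
apply: (@class_interior_total v u e e0) => z hz.
by apply/lam_relE; apply: sub; rewrite /ball /= distrC.
Qed.

(** By continuity the lifts of the second class between [u] and [u + 1] have a least and a greatest
    element. A point of the first class between these would, together with [u], cross them, and
    [pm_cross] would merge the classes. *)
Lemma lam_class_unlinked (x y : circle R) :
  ~ lam_rel x y -> unlinked (eq_class lam_rel x) (eq_class lam_rel y).
Proof.
have [u ->] := to_circle_surj x; have [v0 ->] := to_circle_surj y => uv.
have Duv : D u v0 <> 0 by move=> h; apply: uv; apply/lam_relE.
have rep z : exists2 v, z = to_circle v & u <= v < u + 1.
  exists (u + ccw (to_circle u) z); first exact: ccwE.
  by have := ccw_bounds (to_circle u) z; lra.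
pose S := [set v | u <= v <= u + 1 /\ D v v0 = 0].
have S0 : S !=set0.
  have [v vE hv] := rep (to_circle v0); exists v; split; first by lra.
  by rewrite (pm_circle pD (esym vE) erefl) (pm_refl pD).
have Slb : has_lbound S by exists u => v [/andP[]].
have Sub : has_ubound S by exists (u + 1) => v [/andP[]].
have limit c : (forall e, 0 < e -> exists2 v, S v & `|c - v| < e) -> D c v0 = 0.
  move=> hc; apply: D_le0; apply/ler_addgt0Pr => e e0; rewrite add0r.
  have [del del0 hdel] := D_continuous e0; have [v [_ Sv] /hdel cv] := hc _ del0.
  have := pm_tri pD c v v0; lra.
have infS : D (inf S) v0 = 0.
  apply: limit => e e0; have [v Sv hv] := inf_adherent e0 (conj S0 Slb).
  exists v => //; have := ge_inf Slb Sv => h.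
  by rewrite distrC ger0_norm; lra.
have supS : D (sup S) v0 = 0.
  apply: limit => e e0; have [v Sv hv] := sup_adherent e0 (conj S0 Sub).
  exists v => //; have := ub_le_sup Sub Sv => h.
  by rewrite ger0_norm; lra.
have inf_lo : u <= inf S by apply: lb_le_inf => // v [/andP[]].
have sup_hi : sup S <= u + 1 by apply: ge_sup => // v [/andP[]].
have inf_sup : inf S <= sup S.
  by have [v Sv] := S0; apply: le_trans (ge_inf Slb Sv) (ub_le_sup Sub Sv).
have inf_lt : u < inf S.
  rewrite lt_neqAle inf_lo andbT; apply/eqP => h; apply: Duv.
  by rewrite h.
have sup_lt : sup S < u + 1.
  rewrite lt_neqAle sup_hi andbT; apply/eqP => h; apply: Duv.
  by rewrite -(pm_per pD) -h.
rewrite /unlinked setIC; apply: (@unlinked_arcs _ _ _ (inf S) (sup S)); first by lra.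
  move=> z; have [v -> hv] := rep z => /lam_relE zv.
  have Sv : S v by split; [lra|exact: D_sym0].
  by exists v => //; rewrite (ge_inf Slb Sv) (ub_le_sup Sub Sv).
move=> z; have [v -> hv] := rep z => /lam_relE zv.
have [vi|iv] := ltP v (inf S).
  by exists (v + 1); [rewrite (to_circleDint v 1)|lra].
have [sv|vs] := ltP (sup S) v; first by exists v => //; lra.
exfalso; apply: Duv.
have [_] := pm_cross pD inf_lo iv vs sup_hi.
rewrite zv (D_trans infS (D_sym0 supS)) addr0 => h.
have iv0 : D (inf S) v = 0.
  by apply: D_le0; have := D_ge0 u (sup S); lra.
exact: D_trans zv (D_trans (D_sym0 iv0) infS).
Qed.

Lemma lam_rel_lamination : lamination lam_rel.
Proof.
split.
- by move=> x; exact: pm_refl.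
- by move=> x y; exact: D_sym0.
- by move=> x y z; exact: D_trans.
- exact: lam_rel_closed.
- exact: lam_class_nowhere_dense.
- exact: lam_class_unlinked.
Qed.

Lemma lam_rel_invariant : invariant_lamination lam_rel.
Proof.
move=> x; have [u ->] := to_circle_surj x; exists (doubling (to_circle u)).
rewrite doubling_to_circle; apply/seteqP; split => [_ [y + <-]|z].
  have [v ->] := to_circle_surj y; rewrite doubling_to_circle => /lam_relE uv.
  by apply/lam_relE; exact: D_double.
have [w ->] := to_circle_surj z => /lam_relE uw.
(* Of the two preimages of [w] the one on the side of [u] is taken, because there the fold has no
   detour through [2 * th]. *)
have [v vw sv] : exists2 v, to_circle (2 * v) = to_circle w & side th u = side th v.
  have [e|e] := eqVneq (side th u) (side th (w / 2)).
    by exists (w / 2) => //; congr to_circle; field.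
  exists (w / 2 + 2^-1).
    by apply/to_circle_eqP; exists 1; field.
  by rewrite side_half; move: e; case: (side th u); case: (side th _).
exists (to_circle v); last by rewrite doubling_to_circle.
apply/lam_relE; rewrite D_fold /fold_step sv eqxx.
by rewrite (pm_circle pD erefl vw) uw mulr0.
Qed.

Lemma lam_rel_nondegenerate : ~ degenerate lam_rel.
Proof.
move=> deg; have [x [y /eqP]] := D_neq0; apply.
by apply/lam_relE; exact: deg.
Qed.

Lemma lam_rel_diameter : lam_rel (to_circle th) (opposite (to_circle th)).
Proof.
rewrite opposite_to_circle; apply/lam_relE; apply: D_sym0.
rewrite D_fold fold_center//.
have e : to_circle (2 * (th + 2^-1)) = to_circle (2 * th).
  by apply/to_circle_eqP; exists 1; field.
by rewrite (pm_circle pD e erefl) (pm_refl pD) mulr0.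
Qed.

End EigenLamination.

(** * From escaping diameters to laminations *)

Section Conclusion.
Context {R : realType}.
Implicit Types (theta : circle R) (k : nat) (j : int).

Lemma horseshoe_lamination (th s t : R) k j (q : nat) : (0 < q)%N ->
  (exists n : int, q%:R * (2 * th) = n%:~R) -> horseshoe_data k j s t ->
  s < th < t -> ~ survivors k (end_pieces k s t) (to_circle th) ->
  exists r : circle R -> circle R -> Prop,
    [/\ lamination r, invariant_lamination r, ~ degenerate r &
        r (to_circle th) (opposite (to_circle th))].
Proof.
move=> q0 lat hd /andP[th_lo th_hi] esc.
have [l l0 grow] := growth_exp2 hd th_lo th_hi esc.
have crit := critical_lt1 q0 lat l0 grow.
have [rho [K [D [rho01 pD DK Dfold Dneq]]]] := eigenmetric q0 lat crit.
exists (lam_rel D); split.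
- exact: (lam_rel_lamination q0 lat rho01 pD DK Dfold Dneq).
- exact: (lam_rel_invariant rho01 pD Dfold).
- exact: lam_rel_nondegenerate.
- exact: (lam_rel_diameter pD Dfold).
Qed.

(** Up to half turns a point is in the open arc, in a hole, or an endpoint; endpoints survive by
    [data_survivors]. *)
Lemma escapes_between theta k j (s t : R) :
  horseshoe_data k j s t -> escapes theta k s t ->
  exists u (n : int), theta = to_circle (u + n%:~R / 2) /\ s < u < t.
Proof.
move=> hd [nsurv nhole]; have [tau tauE] := to_circle_surj theta.
have /andP[] := floor_itv (2 * (tau - s)); rewrite intrD1.
set n := Num.floor _ => h1 h2.
have tauE' : theta = to_circle (tau - n%:~R / 2 + n%:~R / 2) by rewrite subrK.
have not_end u : u = s \/ u = t -> tau - n%:~R / 2 <> u.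
  move=> hu uE; apply: nsurv; rewrite tauE' uE; exact: (data_survivors hd).
exists (tau - n%:~R / 2), n; split => //; apply/andP; split.
  rewrite lt_neqAle; apply/andP; split; last by lra.
  by apply/eqP => e; apply: (not_end s); [left|].
rewrite ltNge; apply/negP; rewrite le_eqVlt => /predU1P[e|lt].
  by apply: (not_end t); [right|].
by apply: nhole; exists (tau - n%:~R / 2), n; split => //; lra.
Qed.

End Conclusion.

Theorem theorem6p7 (R : realType) (theta : circle R) (m : nat)
    (theta_lt_half : angle theta < 2^-1)
    (theta_periodic : periodic_point (doubling theta))
    (theta_depth : rotational_depth m theta) :
  (exists (k : nat) (a b : circle R),
     [/\ generates_traveling_horseshoe k a b,
         ~ (horseshoe k a b `|` main_holes a b) theta &
         ~ (horseshoe k a b `|` main_holes a b) (opposite theta)]) /\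
  (exists r : circle R -> circle R -> Prop,
     [/\ lamination r, invariant_lamination r, ~ degenerate r &
         r theta (opposite theta)]).
Proof.
have [k [j [s [t [hd esc]]]]] := depth_escapes theta_depth.
have esc' := escapes_opposite (hd_k hd) esc.
have [gen out] := escapes_horseshoe hd esc.
have [_ out'] := escapes_horseshoe hd esc'.
split; first by exists k, (to_circle s), (to_circle t).
have [u [n [thE ust]]] := escapes_between hd esc.
have [p per] := theta_periodic; have [p0 _ _] := per.
have uE : doubling theta = to_circle (2 * u).
  by rewrite thE doubling_to_circle; apply/to_circle_eqP; exists n; field.
(* A point fixed by [p] doublings is a multiple of [1 / (2 ^ p - 1)] modulo 1; this provides the
   grid. *)
have [l lE] : exists l : int, (2 ^ p - 1)%:R * (2 * u) = l%:~R.
  rewrite uE in per; have [l lE] := has_periodE per; exists l.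
  rewrite natrB ?expn_gt0// natrX mulrBl lE; ring.
have q0 : (0 < 2 ^ p - 1)%N by rewrite subn_gt0 -{1}(expn0 2) ltn_exp2l.
have diam : theta = to_circle u \/ theta = opposite (to_circle u).
  have [q [nE|nE]] := int_parity (R:=R) n; [left|right].
    by rewrite thE; apply/to_circle_eqP; exists q; rewrite nE; field.
  by rewrite thE opposite_to_circle; apply/to_circle_eqP; exists q; rewrite nE; field.
have escu : ~ survivors k (end_pieces k s t) (to_circle u).
  case: diam => [<-|e]; first by case: esc.
  by rewrite -(opposite_opposite (to_circle u)) -e; case: esc'.
have [r [lam inv ndeg ru]] := horseshoe_lamination q0 (ex_intro _ l lE) hd ust escu.
exists r; split => //; case: diam => -> //.
by rewrite opposite_opposite; exact: lam_sym lam _ _ ru.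
Qed.
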